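(* Let $0<q<1$, let $a,b,c,d,r$ be complex numbers with $\max\{|a|,|b|,|c|,|d|,|r|\}<1$, and put $\alpha=a^2bcdr/q$. Then \begin{align*} &\int_{0}^{\pi} \frac{(e^{2i\theta},e^{-2i\theta};q)_\infty}{(ae^{i\theta},ae^{-i\theta},be^{i\theta},be^{-i\theta},ce^{i\theta},ce^{-i\theta},de^{i\theta},de^{-i\theta},re^{i\theta},re^{-i\theta};q)_\infty}\, {}_3\phi_2\left({{ae^{i\theta}, ae^{-i\theta}, 0}\atop{\sqrt{q\alpha}, -\sqrt{q\alpha}}}; q, bcdr\right) d\theta\\ &=\frac{2\pi (abcd, abcr, abdr, acdr; q)_\infty}{(q, ab, ac, ad, ar, bc, bd, br, cd, cr, dr, a^2bcdr; q)_\infty} \sum_{n=0}^\infty \frac{(1-\alpha q^{4n})(\alpha, ab, ac, ad, ar; q)_{2n} (q; q^2)_n}{(1-\alpha)(q, abcd, abcr, abdr, acdr; q)_{2n} (q\alpha; q^2)_n} (-\alpha)^n (bcdr)^{2n} q^{3n^2-n}. \end{align*}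
   Context: For $0<q<1$ and base $p\in\{q,q^2\}$: $(a;p)_n=\prod_{k=0}^{n-1}(1-ap^k)$, $(a;p)_\infty=\prod_{k\ge0}(1-ap^k)$, $(a_1,\dots,a_m;p)_n=(a_1;p)_n\cdots(a_m;p)_n$. ${}_{3}\phi_2\left({{a_1,a_2,a_3}\atop{b_1,b_2}};q,z\right)=\sum_{n\ge0}\frac{(a_1,a_2,a_3;q)_n}{(q,b_1,b_2;q)_n}z^n$, and $\sqrt{q\alpha}$ denotes a fixed square root. *)

(* Defs.v *)
From Stdlib Require Export Reals List Lra Lia.
From Coquelicot Require Export Coquelicot.
Export ListNotations.

Local Open Scope C_scope.

(* Coquelicot's [Lim_seq] and [Series] are real-valued; these total operators
   work componentwise, with the usual meaning on convergent data. *)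
Definition C_lim_seq (u : nat -> C) : C :=
  (real (Lim_seq (fun n => Re (u n))), real (Lim_seq (fun n => Im (u n)))).

Definition C_series (u : nat -> C) : C := C_lim_seq (sum_n u).

Definition cis (t : R) : C := (cos t, sin t).

(* (a; p)_n, (a; p)_oo and their multi-parameter versions *)
Fixpoint qpoch (a : C) (p : R) (n : nat) : C :=
  match n with
  | O => 1
  | S k => qpoch a p k * (1 - a * p ^ k)
  end.

Definition qpoch_inf (a : C) (p : R) : C := C_lim_seq (qpoch a p).

Definition qpochs (l : list C) (p : R) (n : nat) : C :=
  fold_right (fun a x => qpoch a p n * x) 1 l.

Definition qpochs_inf (l : list C) (p : R) : C :=
  fold_right (fun a x => qpoch_inf a p * x) 1 l.

Definition phi32_term (a1 a2 a3 b1 b2 : C) (q : R) (z : C) (n : nat) : C :=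
  qpochs [a1; a2; a3] q n / qpochs [RtoC q; b1; b2] q n * z ^ n.

Definition phi32 (a1 a2 a3 b1 b2 : C) (q : R) (z : C) : C :=
  C_series (phi32_term a1 a2 a3 b1 b2 q z).

(* (1 - alpha q^(4n)) (alpha; q)_(2n) / (1 - alpha).  The quotient is a
   polynomial in alpha, but reads 0/0 at alpha = 1, where it stands for its
   limit; [wp_factorE] gives the value for every alpha. *)
Definition wp_factor (alpha : C) (q : R) (n : nat) : C :=
  if Ceq_dec alpha 1 then
    match n with
    | O => 1
    | S _ => (1 - q ^ (4 * n)) * qpoch q q (2 * n - 1)
    end
  else (1 - alpha * q ^ (4 * n)) * qpoch alpha q (2 * n) / (1 - alpha).

Lemma qpoch_Sl (a : C) (p : R) (n : nat) :
  qpoch a p (S n) = (1 - a) * qpoch (p * a) p n.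
Proof.
induction n as [|n IH]; [simpl; ring|].
change (qpoch a p (S (S n))) with (qpoch a p (S n) * (1 - a * p ^ S n)).
rewrite IH; simpl; ring.
Qed.

Lemma wp_factorE (alpha : C) (q : R) (n : nat) :
  wp_factor alpha q n =
    match n with
    | O => 1
    | S _ => (1 - alpha * q ^ (4 * n)) * qpoch (q * alpha) q (2 * n - 1)
    end.
Proof.
unfold wp_factor; destruct (Ceq_dec alpha 1) as [->|Ha].
- destruct n as [|n]; [reflexivity|].
  now rewrite Cmult_1_l, Cmult_1_r.
- assert (H : 1 - alpha <> 0).
  { intros E; apply Ha.
    replace alpha with (1 - (1 - alpha)) by ring; rewrite E; ring. }
  destruct n as [|n].
  + simpl; field; exact H.
  + replace (2 * S n)%nat with (S (2 * S n - 1)) at 1 by lia.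
    rewrite qpoch_Sl; field; exact H.
Qed.

(* Main.v *)
Require Import Defs.
From Stdlib Require Import ClassicalEpsilon.

Local Open Scope C_scope.

(** Write [w = bcdr], so that [q alpha = a^2 w].  The sequence
    [beta_k = 1 / ((q; q)_k (q alpha; q^2)_k)] belongs to a Bailey pair relative
    to [alpha] whose [alpha_n] vanish for odd [n].  Substituting it in the series
    3phi2, whose [k]-th term is [beta_k (a e, a / e; q)_k w^k] with
    [e = e^(i theta)], and exchanging the two sums leaves an inner 2phi1 at the
    argument summed by the q-Gauss formula.  The integrand becomes a rapidly
    convergent series of weights of Rahman's integral
    [int (e^2, e^-2, f e, f / e)_oo / prod_j (t_j e, t_j / e)_oo],
    [f = t_1 t_2 t_3 t_4 t_5], with [t_1 = a q^(2m)].

    Rahman's integral is evaluated by a q-difference argument: the integrals for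
    [t_1] and for [q t_1] are related by a telescoper [G(z) + G(1/z)] with
    [G(q z) = - G(1/z)], whose integral vanishes because the mean of [G] over the
    circles [|z| = q] and [|z| = 1] is the same.  So integral over claimed value is
    invariant under [t_j -> q t_j]; letting all [t_j -> 0] it does not depend on
    the parameters, and one special choice where the weight is elementary
    determines it. *)

(** * Complex limits and series *)

(** Only the even-indexed members of the Bailey pair survive, so the q-Gauss sum turns [a] into
    [a q^(2m)]; hence the base [q] factorials on the right have length [2n]. The numerator parameter
    of the resulting weight is [a q^(2m) w], the product of its five parameters, which is the shape
    of Rahman's integral.

    Two features of the hypotheses shape the formulas. Any of [a, b, c, d, r] may be 0, so nothing
    is divided by a parameter. Only [|q alpha| < 1] is known, so [alpha] may equal 1 or exceed 1 in
    modulus; estimates go through [q alpha] and borrow powers of [q] from [q^(3m^2-m)].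

    The telescoper shifts by [q] those factors whose zeros could otherwise lie in the annulus
    [q <= |z| <= 1]. There it is a uniform limit of Laurent polynomials, whose mean over a circle is
    the constant coefficient whatever the radius. The Bailey relation and the q-Gauss sum also rest
    on rational certificates, checked by [field]. *)

Definition Ccv (u : nat -> C) (l : C) : Prop :=
  is_lim_seq (fun n => Cmod (u n - l)) 0%R.

Lemma Cmod_dist_triangle (x y z : C) :
  (Cmod (x - z) <= Cmod (x - y) + Cmod (y - z))%R.
Proof. replace (x - z) with ((x - y) + (y - z)) by ring; apply Cmod_triangle. Qed.

Lemma Cmod_dist_sym (x y : C) : Cmod (x - y) = Cmod (y - x).
Proof. replace (x - y) with (- (y - x)) by ring; apply Cmod_opp. Qed.

Lemma Cmod_sub_le (x y : C) : (Cmod (x - y) <= Cmod x + Cmod y)%R.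
Proof.
unfold Cminus; eapply Rle_trans; [apply Cmod_triangle|].
rewrite Cmod_opp; lra.
Qed.

Lemma Cmod_sub_ge (x y : C) : (Cmod x - Cmod y <= Cmod (x - y))%R.
Proof.
assert (H := Cmod_triangle (x - y) y).
replace (x - y + y) with x in H by ring; lra.
Qed.

Lemma im_le_Cmod (c : C) : (Rabs (Im c) <= Cmod c)%R.
Proof. eapply Rle_trans; [|apply (Rmax_Cmod c)]; apply Rmax_r. Qed.

Lemma lim0_squeeze (u v : nat -> R) :
  (forall n, (0 <= u n <= v n)%R) -> is_lim_seq v 0%R -> is_lim_seq u 0%R.
Proof.
intros H Hv; apply is_lim_seq_le_le with (u := fun _ => 0%R) (w := v); auto.
apply is_lim_seq_const.
Qed.

Lemma lim0_scal (k : R) (u : nat -> R) :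
  is_lim_seq u 0%R -> is_lim_seq (fun n => k * u n)%R 0%R.
Proof.
intros H; replace (Finite 0) with (Rbar_mult k 0).
- now apply is_lim_seq_scal_l.
- simpl; f_equal; ring.
Qed.

Lemma lim0_plus (u v : nat -> R) :
  is_lim_seq u 0%R -> is_lim_seq v 0%R -> is_lim_seq (fun n => u n + v n)%R 0%R.
Proof.
intros H1 H2; replace (Finite 0) with (Finite (0 + 0)) by (f_equal; ring).
now apply is_lim_seq_plus'.
Qed.

Lemma lim0_eps (u : nat -> R) :
  (forall n, (0 <= u n)%R) ->
  is_lim_seq u 0%R <->
  (forall eps : R, (0 < eps)%R -> exists N, forall n, (N <= n)%nat -> (u n < eps)%R).
Proof.
intros Hp; split; intros H.
- apply is_lim_seq_spec in H; intros eps He.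
  destruct (H (mkposreal eps He)) as [N HN]; exists N; intros n Hn.
  specialize (HN n Hn); simpl in HN; rewrite Rminus_0_r, Rabs_pos_eq in HN; auto.
- apply is_lim_seq_spec; intros eps.
  destruct (H eps (cond_pos eps)) as [N HN]; exists N; intros n Hn.
  rewrite Rminus_0_r, Rabs_pos_eq; auto.
Qed.

Lemma Ccv_eps (u : nat -> C) (l : C) :
  Ccv u l <->
  (forall eps : R, (0 < eps)%R ->
     exists N, forall n, (N <= n)%nat -> (Cmod (u n - l) < eps)%R).
Proof. apply lim0_eps; intros n; apply Cmod_ge_0. Qed.

Lemma Ccv_squeeze (u : nat -> C) (l : C) (v : nat -> R) :
  (forall n, (Cmod (u n - l) <= v n)%R) -> is_lim_seq v 0%R -> Ccv u l.
Proof.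
intros H; apply lim0_squeeze; intros n; split; [apply Cmod_ge_0|apply H].
Qed.

Lemma Ccv_ext (u v : nat -> C) (l : C) :
  (forall n, u n = v n) -> Ccv u l -> Ccv v l.
Proof. intros H; apply is_lim_seq_ext; intros n; now rewrite H. Qed.

Lemma Ccv_const (l : C) : Ccv (fun _ => l) l.
Proof.
apply Ccv_squeeze with (fun _ => 0%R); [|apply is_lim_seq_const].
intros n; replace (l - l) with (RtoC 0) by ring; rewrite Cmod_0; lra.
Qed.

Lemma Ccv_plus (u v : nat -> C) (l k : C) :
  Ccv u l -> Ccv v k -> Ccv (fun n => u n + v n) (l + k).
Proof.
intros Hu Hv; eapply Ccv_squeeze; [|apply (lim0_plus _ _ Hu Hv)].
intros n; simpl; replace (u n + v n - (l + k)) with ((u n - l) + (v n - k)) by ring.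
apply Cmod_triangle.
Qed.

Lemma Ccv_mult (u v : nat -> C) (l k : C) :
  Ccv u l -> Ccv v k -> Ccv (fun n => u n * v n) (l * k).
Proof.
intros Hu Hv.
apply Ccv_squeeze with (fun n => Cmod (u n - l) * Cmod (v n - k)
  + (Cmod k * Cmod (u n - l) + Cmod l * Cmod (v n - k)))%R.
- intros n.
  replace (u n * v n - l * k)
    with ((u n - l) * (v n - k) + (k * (u n - l) + l * (v n - k))) by ring.
  eapply Rle_trans; [apply Cmod_triangle|]; rewrite Cmod_mult.
  apply Rplus_le_compat_l.
  eapply Rle_trans; [apply Cmod_triangle|]; rewrite !Cmod_mult; lra.
- apply lim0_plus; [|apply lim0_plus; apply lim0_scal; assumption].
  replace (Finite 0) with (Finite (0 * 0)) by (f_equal; ring).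
  apply is_lim_seq_mult'; assumption.
Qed.

Lemma Ccv_scal (c : C) (u : nat -> C) (l : C) :
  Ccv u l -> Ccv (fun n => c * u n) (c * l).
Proof. apply Ccv_mult, Ccv_const. Qed.

Lemma Ccv_unique (u : nat -> C) (l k : C) : Ccv u l -> Ccv u k -> l = k.
Proof.
intros Hl Hk.
assert (H : is_lim_seq (fun _ => Cmod (l - k)) 0%R).
{ eapply lim0_squeeze; [|apply (lim0_plus _ _ Hl Hk)].
  intros n; split; [apply Cmod_ge_0|].
  rewrite (Cmod_dist_sym (u n) l); apply Cmod_dist_triangle. }
apply is_lim_seq_unique in H; rewrite Lim_seq_const in H; injection H as H.
apply Cmod_eq_0 in H.
replace l with (l - k + k) by ring; rewrite H; ring.
Qed.

Lemma Ccv_subseq (u : nat -> C) (l : C) (phi : nat -> nat) :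
  (forall n, (n <= phi n)%nat) -> Ccv u l -> Ccv (fun n => u (phi n)) l.
Proof.
intros Hphi Hu; apply Ccv_eps; intros eps He.
destruct (proj1 (Ccv_eps _ _) Hu eps He) as [N HN].
exists N; intros n Hn; apply HN; specialize (Hphi n); lia.
Qed.

(** Closed balls are closed. The centre [x] is free, so that the lemma yields both size bounds, with
    [x = 0], and tail estimates, with [x] a partial sum or a finite product. *)
Lemma Ccv_le (u : nat -> C) (l x : C) (B : R) (n0 : nat) :
  (forall n, (n0 <= n)%nat -> (Cmod (u n - x) <= B)%R) -> Ccv u l ->
  (Cmod (l - x) <= B)%R.
Proof.
intros H Hu; apply le_epsilon; intros eps He.
destruct (proj1 (Ccv_eps _ _) Hu eps He) as [N HN].
specialize (HN (max N n0) ltac:(lia)); specialize (H (max N n0) ltac:(lia)).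
assert (T := Cmod_dist_triangle l (u (max N n0)) x).
rewrite (Cmod_dist_sym l (u (max N n0))) in T; lra.
Qed.

Lemma Ccv_lim_seq (u : nat -> C) (l : C) : Ccv u l -> C_lim_seq u = l.
Proof.
intros H; unfold C_lim_seq.
assert (Hp : forall (f : C -> R) (L : R),
   (forall n, (Rabs (f (u n) - L) <= Cmod (u n - l))%R) ->
   is_lim_seq (fun n => f (u n)) L).
{ intros f L Hf; apply is_lim_seq_spec; intros eps.
  destruct (proj1 (Ccv_eps _ _) H eps (cond_pos eps)) as [N HN].
  exists N; intros n Hn; eapply Rle_lt_trans; [apply Hf|apply HN, Hn]. }
rewrite (is_lim_seq_unique _ (Re l)), (is_lim_seq_unique _ (Im l)).
- now destruct l.
- apply (Hp Im); intros n; apply (im_le_Cmod (u n - l)).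
- apply (Hp Re); intros n; apply (re_le_Cmod (u n - l)).
Qed.

Lemma Ccv_is_series (u : nat -> C) (l : C) :
  Ccv (sum_n u) l <-> @is_series C_AbsRing C_NormedModule u l.
Proof.
rewrite Ccv_eps; split; intros H.
- apply filterlim_locally_ball_norm; intros eps.
  destruct (H eps (cond_pos eps)) as [N HN]; exists N; intros n Hn.
  apply HN, Hn.
- intros eps He.
  destruct (proj1 (filterlim_locally_ball_norm _ _) H (mkposreal eps He)) as [N HN].
  exists N; intros n Hn; apply HN, Hn.
Qed.

Lemma ex_series_Ccv (u : nat -> C) :
  @ex_series C_AbsRing C_NormedModule u -> Ccv (sum_n u) (C_series u).
Proof.
intros [l Hl]; apply Ccv_is_series in Hl.
unfold C_series; now rewrite (Ccv_lim_seq _ _ Hl).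
Qed.

Lemma ex_series_dominated (u : nat -> C) (v : nat -> R) :
  (forall n, (Cmod (u n) <= v n)%R) -> ex_series v ->
  @ex_series C_AbsRing C_NormedModule u.
Proof.
intros H Hv; apply (@ex_series_le C_AbsRing C_CompleteNormedModule u v); auto.
Qed.

Lemma Cmod_sum_n (u : nat -> C) (v : nat -> R) (n : nat) :
  (forall n, (Cmod (u n) <= v n)%R) -> (Cmod (sum_n u n) <= sum_n v n)%R.
Proof.
intros H; induction n as [|n IH].
- rewrite !sum_O; apply H.
- rewrite !sum_Sn; eapply Rle_trans; [apply Cmod_triangle|].
  apply Rplus_le_compat; [exact IH|apply H].
Qed.

Lemma sum_n_le_Series (v : nat -> R) (n : nat) :
  (forall n, (0 <= v n)%R) -> ex_series v -> (sum_n v n <= Series v)%R.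
Proof.
intros Hp Hv.
assert (Hl : is_lim_seq (sum_n v) (Series v)) by (apply Series_correct, Hv).
apply (is_lim_seq_incr_compare _ _ Hl).
intros k; rewrite sum_Sn; specialize (Hp (S k)); unfold plus; simpl; lra.
Qed.

Lemma sum_n_CS (u : nat -> C) (n : nat) : sum_n u (S n) = sum_n u n + u (S n).
Proof. rewrite sum_Sn; reflexivity. Qed.

Lemma sum_n_Cmult_l (c : C) (u : nat -> C) (n : nat) :
  sum_n (fun k => c * u k) n = c * sum_n u n.
Proof.
induction n as [|n IH]; [now rewrite !sum_O|].
rewrite !sum_Sn, IH; unfold plus; simpl; ring.
Qed.

Lemma sum_n_tail_bound (u : nat -> C) (v : nat -> R) (m n : nat) :
  (forall n, (Cmod (u n) <= v n)%R) -> ex_series v -> (n <= m)%nat ->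
  (Cmod (sum_n u m - sum_n u n) <= Series v - sum_n v n)%R.
Proof.
intros H Hv Hmn.
assert (Hp : forall k, (0 <= v k)%R).
{ intros k; eapply Rle_trans; [apply Cmod_ge_0|apply H]. }
apply Rle_trans with (sum_n v m - sum_n v n)%R.
- induction Hmn as [|m Hmn IH].
  + replace (sum_n u n - sum_n u n) with (RtoC 0) by ring; rewrite Cmod_0; lra.
  + rewrite !sum_Sn; unfold plus; simpl.
    eapply Rle_trans; [apply (Cmod_dist_triangle _ (sum_n u m))|].
    replace (sum_n u m + u (S m) - sum_n u m) with (u (S m)) by ring.
    specialize (H (S m)); lra.
- assert (T := sum_n_le_Series v m Hp Hv); lra.
Qed.

Lemma Series_tail_lim0 (v : nat -> R) :
  ex_series v -> is_lim_seq (fun n => Series v - sum_n v n)%R 0%R.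
Proof.
intros Hv; replace (Finite 0) with (Finite (Series v - Series v)) by (f_equal; ring).
apply is_lim_seq_minus'; [apply is_lim_seq_const|apply Series_correct, Hv].
Qed.

Lemma sum_n_Ccv (u : nat -> nat -> C) (l : nat -> C) (N : nat) :
  (forall m, Ccv (u m) (l m)) ->
  Ccv (fun k => sum_n (fun m => u m k) N) (sum_n l N).
Proof.
intros H; induction N as [|N IH].
- apply Ccv_ext with (u 0%nat); [intros n; now rewrite sum_O|].
  rewrite sum_O; apply H.
- rewrite sum_Sn; eapply Ccv_ext; [|apply (Ccv_plus _ _ _ _ IH (H (S N)))].
  intros n; simpl; now rewrite sum_Sn.
Qed.

(** Dominated convergence for series. The number of terms and the inner index are the same [k], the
    shape produced by truncating a double sum to a square. *)
Lemma tannery (u : nat -> nat -> C) (l : nat -> C) (v : nat -> R) :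
  (forall m, Ccv (u m) (l m)) ->
  (forall m k, (Cmod (u m k) <= v m)%R) -> ex_series v ->
  exists S, Ccv (sum_n l) S /\ Ccv (fun k => sum_n (fun m => u m k) k) S.
Proof.
intros Hu Hb Hv.
assert (Hl : forall m, (Cmod (l m) <= v m)%R).
{ intros m; replace (l m) with (l m - 0) by ring.
  apply (Ccv_le (u m) _ _ _ 0); [|apply Hu].
  intros k _; replace (u m k - 0) with (u m k) by ring; apply Hb. }
exists (C_series l).
assert (HS := ex_series_Ccv l (ex_series_dominated l v Hl Hv)).
split; [exact HS|].
apply Ccv_eps; intros eps He.
(* Four errors are kept small: the tails past [N] of the row and of the limit, the difference of the
   two sums up to [N], and the distance of the partial sum of [l] from its total. *)
assert (He3 : (0 < eps / 4)%R) by lra.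
assert (Hp : forall k, (0 <= v k)%R).
{ intros k; eapply Rle_trans; [apply Cmod_ge_0|apply Hl]. }
assert (Ht : forall n, (0 <= Series v - sum_n v n)%R).
{ intros n; assert (T := sum_n_le_Series v n Hp Hv); lra. }
destruct (proj1 (lim0_eps _ Ht) (Series_tail_lim0 v Hv) _ He3) as [N HN].
specialize (HN N (le_n N)).
destruct (proj1 (Ccv_eps _ _) HS _ He3) as [N1 HN1].
destruct (proj1 (Ccv_eps _ _) (sum_n_Ccv u l N Hu) _ He3) as [N2 HN2].
exists (max N (max N1 N2)); intros n Hn.
specialize (HN2 n ltac:(lia)); specialize (HN1 n ltac:(lia)).
assert (H1 := sum_n_tail_bound (fun m => u m n) v n N
  (fun m => Hb m n) Hv ltac:(lia)).
assert (H2 := sum_n_tail_bound l v n N Hl Hv ltac:(lia)).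
assert (T1 := Cmod_dist_triangle (sum_n (fun m => u m n) n)
  (sum_n (fun m => u m n) N) (C_series l)).
assert (T2 := Cmod_dist_triangle (sum_n (fun m => u m n) N) (sum_n l N) (C_series l)).
assert (T3 := Cmod_dist_triangle (sum_n l N) (sum_n l n) (C_series l)).
rewrite (Cmod_dist_sym (sum_n l N) (sum_n l n)) in T3; lra.
Qed.

(** * q-shifted factorials *)

Lemma qpoch_S (x : C) (p : R) (n : nat) :
  qpoch x p (S n) = qpoch x p n * (1 - x * p ^ n).
Proof. reflexivity. Qed.

Lemma qpoch_add (x : C) (p : R) (m n : nat) :
  qpoch x p (m + n) = qpoch x p m * qpoch (x * p ^ m) p n.
Proof.
induction n as [|n IH].
- rewrite Nat.add_0_r; simpl; ring.
- rewrite Nat.add_succ_r, !qpoch_S, IH, Cpow_add_r; ring.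
Qed.

Lemma qpoch_0 (p : R) (n : nat) : qpoch 0 p n = 1.
Proof. induction n as [|n IH]; [reflexivity|rewrite qpoch_S, IH; ring]. Qed.

(** Through this identity the pair [s, - s] in the denominator of the 3phi2 enters only by
    [s ^ 2 = q alpha], so either square root gives the same series. *)
Lemma qpoch_pm (x : C) (p : R) (n : nat) :
  qpoch x p n * qpoch (- x) p n = qpoch (x ^ 2) (p ^ 2)%R n.
Proof.
induction n as [|n IH]; [simpl; ring|].
rewrite !qpoch_S, <- IH, RtoC_pow, <- Cpow_mult_r, Nat.mul_comm, Cpow_mult_r.
ring.
Qed.

Lemma exp_le_mono (x y : R) : (x <= y)%R -> (exp x <= exp y)%R.
Proof. intros [H|H]; [now apply Rlt_le, exp_increasing|rewrite H; lra]. Qed.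

Section QPochhammer.

Variable q : R.
Hypothesis Hq : (0 < q < 1)%R.

Lemma Cmod_qpow (n : nat) : Cmod (q ^ n) = (q ^ n)%R.
Proof. rewrite Cmod_pow, Cmod_R, Rabs_pos_eq; lra. Qed.

Lemma qpow_bounds (n : nat) : (0 < q ^ n <= 1)%R.
Proof.
split; [apply pow_lt; lra|].
rewrite <- (pow1 n); apply pow_incr; lra.
Qed.

Lemma qpow_lim0 : is_lim_seq (fun n => q ^ n)%R 0%R.
Proof. apply is_lim_seq_geom; rewrite Rabs_pos_eq; lra. Qed.

(** From [|1 - x q^k| <= 1 + |x| q^k <= exp (|x| q^k)] and the geometric series: a common bound for
    all products with [|x| <= rho], finite or infinite. *)
Definition qbound (rho : R) : R := exp (rho / (1 - q)).

Lemma qbound_incr (x y : R) : (x <= y)%R -> (qbound x <= qbound y)%R.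
Proof.
intros H; apply exp_le_mono, Rmult_le_compat_r; [|exact H].
apply Rlt_le, Rinv_0_lt_compat; lra.
Qed.

Lemma qbound_pos (x : R) : (0 < qbound x)%R.
Proof. apply exp_pos. Qed.

Lemma qpoch_bound (x : C) (n : nat) : (Cmod (qpoch x q n) <= qbound (Cmod x))%R.
Proof.
(* The partial geometric sum in the exponent is what makes the induction close. *)
apply Rle_trans with (exp (Cmod x * ((1 - q ^ n) / (1 - q)))).
- induction n as [|n IH].
  + simpl; rewrite Cmod_1; replace (_ * _)%R with 0%R by (field; lra).
    rewrite exp_0; lra.
  + rewrite qpoch_S, Cmod_mult.
    replace (Cmod x * ((1 - q ^ S n) / (1 - q)))%R
      with (Cmod x * ((1 - q ^ n) / (1 - q)) + Cmod x * q ^ n)%R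
      by (simpl; field; lra).
    rewrite exp_plus; apply Rmult_le_compat; try apply Cmod_ge_0; [exact IH|].
    eapply Rle_trans; [apply Cmod_sub_le|].
    rewrite Cmod_1, Cmod_mult, Cmod_qpow.
    apply exp_ineq1_le.
- apply exp_le_mono; unfold Rdiv; apply Rmult_le_compat_l; [apply Cmod_ge_0|].
  assert (H := qpow_bounds n).
  rewrite <- (Rmult_1_l (/ (1 - q))) at 2; apply Rmult_le_compat_r; [|lra].
  apply Rlt_le, Rinv_0_lt_compat; lra.
Qed.

(** Factor [k] moves the product by at most [qbound |x| * |x| q^k]; the quotient is the sum of [q^k]
    over [n <= k < m]. *)
Lemma qpoch_dist (x : C) (m n : nat) : (n <= m)%nat ->
  (Cmod (qpoch x q m - qpoch x q n)
   <= qbound (Cmod x) * Cmod x * ((q ^ n - q ^ m) / (1 - q)))%R.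
Proof.
intros H; induction H as [|m H IH].
- replace (_ - _) with (RtoC 0) by ring.
  rewrite Cmod_0, Rminus_diag; unfold Rdiv; rewrite Rmult_0_l; lra.
- eapply Rle_trans; [apply (Cmod_dist_triangle _ (qpoch x q m))|].
  rewrite qpoch_S.
  replace (qpoch x q m * (1 - x * q ^ m) - qpoch x q m)
    with (- (qpoch x q m * (x * q ^ m))) by ring.
  rewrite Cmod_opp, !Cmod_mult, Cmod_qpow.
  replace (qbound (Cmod x) * Cmod x * ((q ^ n - q ^ S m) / (1 - q)))%R
    with (qbound (Cmod x) * (Cmod x * q ^ m)
          + qbound (Cmod x) * Cmod x * ((q ^ n - q ^ m) / (1 - q)))%R
    by (simpl; field; lra).
  apply Rplus_le_compat; [|exact IH].
  apply Rmult_le_compat_r; [|apply qpoch_bound].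
  apply Rmult_le_pos; [apply Cmod_ge_0|apply Rlt_le, qpow_bounds].
Qed.

Lemma qpoch_dist_tail (x : C) (m n : nat) : (n <= m)%nat ->
  (Cmod (qpoch x q m - qpoch x q n)
   <= qbound (Cmod x) * Cmod x * (q ^ n / (1 - q)))%R.
Proof.
intros H; eapply Rle_trans; [apply qpoch_dist, H|].
apply Rmult_le_compat_l.
- apply Rmult_le_pos; [apply Rlt_le, qbound_pos|apply Cmod_ge_0].
- apply Rmult_le_compat_r; [apply Rlt_le, Rinv_0_lt_compat; lra|].
  assert (T := qpow_bounds m); lra.
Qed.

Lemma qpoch_cv (x : C) : Ccv (qpoch x q) (qpoch_inf x q).
Proof.
set (d := fun n => match n return C with
  | O => RtoC 1 | S k => qpoch x q (S k) - qpoch x q k end).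
assert (Hs : forall n, sum_n d n = qpoch x q n).
{ induction n as [|n IH]; [now rewrite sum_O|].
  rewrite sum_Sn, IH; unfold d, plus; simpl; ring. }
assert (Hd : @ex_series C_AbsRing C_NormedModule d).
(* Increment [n + 1] is of order [q ^ n], hence the division by [q]; the summand 1 covers the term
   of index 0. *)
{ set (K := (1 + qbound (Cmod x) * Cmod x / q)%R).
  assert (HK : (0 <= qbound (Cmod x) * Cmod x)%R).
  { apply Rmult_le_pos; [apply Rlt_le, qbound_pos|apply Cmod_ge_0]. }
  apply ex_series_dominated with (fun n => K * q ^ n)%R.
  - assert (H0 : (0 <= qbound (Cmod x) * Cmod x / q)%R).
    { apply Rmult_le_pos; [exact HK|apply Rlt_le, Rinv_0_lt_compat; lra]. }
    intros [|n].
    + simpl; rewrite Cmod_1; unfold K; lra.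
    + unfold d; eapply Rle_trans; [apply qpoch_dist; lia|].
      replace (qbound (Cmod x) * Cmod x * ((q ^ n - q ^ S n) / (1 - q)))%R
        with (qbound (Cmod x) * Cmod x / q * q ^ S n)%R by (simpl; field; lra).
      apply Rmult_le_compat_r; [apply Rlt_le, qpow_bounds|unfold K; lra].
  - apply (ex_series_scal_l K (fun n => q ^ n)%R), ex_series_geom.
    rewrite Rabs_pos_eq; lra. }
apply ex_series_Ccv in Hd.
assert (H : Ccv (qpoch x q) (C_series d)) by (eapply Ccv_ext; [apply Hs|exact Hd]).
unfold qpoch_inf; now rewrite (Ccv_lim_seq _ _ H).
Qed.

Lemma qpoch_inf_dist (x : C) (n : nat) :
  (Cmod (qpoch_inf x q - qpoch x q n)
   <= qbound (Cmod x) * Cmod x * (q ^ n / (1 - q)))%R.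
Proof.
apply (Ccv_le (qpoch x q) _ _ _ n); [|apply qpoch_cv].
intros m Hm; now apply qpoch_dist_tail.
Qed.

Lemma qpoch_inf_bound (x : C) : (Cmod (qpoch_inf x q) <= qbound (Cmod x))%R.
Proof.
replace (qpoch_inf x q) with (qpoch_inf x q - 0) by ring.
apply (Ccv_le (qpoch x q) _ _ _ 0); [|apply qpoch_cv].
intros n _; replace (qpoch x q n - 0) with (qpoch x q n) by ring.
apply qpoch_bound.
Qed.

Lemma qpoch_inf_split (x : C) (n : nat) :
  qpoch_inf x q = qpoch x q n * qpoch_inf (x * q ^ n) q.
Proof.
apply (Ccv_unique (fun m => qpoch x q (n + m))).
- apply (Ccv_subseq (qpoch x q) _ (fun m => (n + m)%nat)); [lia|apply qpoch_cv].
- eapply Ccv_ext; [intros m; symmetry; apply qpoch_add|].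
  apply Ccv_scal, qpoch_cv.
Qed.

Lemma qpoch_inf_Sl (x : C) : qpoch_inf x q = (1 - x) * qpoch_inf (q * x) q.
Proof. rewrite (qpoch_inf_split x 1); simpl; f_equal; [ring|f_equal; ring]. Qed.

Lemma qpoch_inf_0 : qpoch_inf 0 q = 1.
Proof.
apply (Ccv_unique (qpoch 0 q)); [apply qpoch_cv|].
eapply Ccv_ext; [intros n; symmetry; apply qpoch_0|apply Ccv_const].
Qed.

Lemma qpoch_inf_near1 (x : C) : (Cmod x <= 1)%R ->
  (Cmod (qpoch_inf x q - 1) <= qbound 1 / (1 - q) * Cmod x)%R.
Proof.
intros Hx; eapply Rle_trans; [apply (qpoch_inf_dist x 0)|].
replace (qbound (Cmod x) * Cmod x * (q ^ 0 / (1 - q)))%R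
  with (qbound (Cmod x) / (1 - q) * Cmod x)%R by (simpl; field; lra).
apply Rmult_le_compat_r; [apply Cmod_ge_0|].
apply Rmult_le_compat_r; [apply Rlt_le, Rinv_0_lt_compat; lra|].
now apply qbound_incr.
Qed.

Lemma qpoch_ge_pow (rho : R) (x : C) (n : nat) :
  (Cmod x <= rho < 1)%R -> ((1 - rho) ^ n <= Cmod (qpoch x q n))%R.
Proof.
intros Hx; induction n as [|n IH]; [simpl; rewrite Cmod_1; lra|].
rewrite qpoch_S, Cmod_mult; simpl; rewrite Rmult_comm.
apply Rmult_le_compat; [apply pow_le; lra|lra|exact IH|].
eapply Rle_trans; [|apply Cmod_sub_ge].
rewrite Cmod_1, Cmod_mult, Cmod_qpow.
assert (H := qpow_bounds n).
assert (Cmod x * q ^ n <= Cmod x * 1)%R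
  by (apply Rmult_le_compat_l; [apply Cmod_ge_0|lra]).
lra.
Qed.

(* Far out in the product the factors stay within 1/2 of 1, and only finitely
   many factors precede. *)
Lemma qpoch_inf_lower (rho : R) : (0 <= rho < 1)%R ->
  exists m : R, (0 < m)%R /\
    forall x, (Cmod x <= rho)%R -> (m <= Cmod (qpoch_inf x q))%R.
Proof.
intros Hr.
assert (Hlim := lim0_scal (qbound 1 / (1 - q)) _ qpow_lim0).
assert (HB : (0 < qbound 1 / (1 - q))%R).
{ apply Rdiv_lt_0_compat; [apply qbound_pos|lra]. }
destruct (proj1 (lim0_eps _ (fun n => Rmult_le_pos _ _ (Rlt_le _ _ HB)
   (Rlt_le _ _ (proj1 (qpow_bounds n))))) Hlim (/ 2)%R ltac:(lra)) as [K HK].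
specialize (HK K (le_n K)).
exists ((1 - rho) ^ K * / 2)%R; split.
- apply Rmult_lt_0_compat; [apply pow_lt|]; lra.
- intros x Hx; rewrite (qpoch_inf_split x K), Cmod_mult.
  apply Rmult_le_compat; [apply pow_le; lra|lra|apply qpoch_ge_pow; lra|].
  assert (Hxq : (Cmod (x * q ^ K) <= q ^ K)%R).
  { rewrite Cmod_mult, Cmod_qpow.
    rewrite <- (Rmult_1_l (q ^ K)) at 2; apply Rmult_le_compat_r; [|lra].
    apply Rlt_le, qpow_bounds. }
  assert (H1 := qpoch_inf_near1 (x * q ^ K)
    (Rle_trans _ _ _ Hxq (proj2 (qpow_bounds K)))).
  assert (H2 : (qbound 1 / (1 - q) * Cmod (x * q ^ K)
     <= qbound 1 / (1 - q) * q ^ K)%R) by (apply Rmult_le_compat_l; lra).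
  assert (H3 := Cmod_sub_ge 1 (1 - qpoch_inf (x * q ^ K) q)).
  replace (1 - (1 - qpoch_inf (x * q ^ K) q)) with (qpoch_inf (x * q ^ K) q) in H3
    by ring.
  rewrite Cmod_1, (Cmod_dist_sym 1) in H3; lra.
Qed.

(** A finite product is the infinite one divided by its tail, and the tail is bounded above by
    [qbound 1]; this makes the bound uniform in [n]. *)
Lemma qpoch_lower (rho : R) : (0 <= rho < 1)%R ->
  exists m : R, (0 < m)%R /\
    forall x n, (Cmod x <= rho)%R -> (m <= Cmod (qpoch x q n))%R.
Proof.
intros Hr; destruct (qpoch_inf_lower rho Hr) as (m & Hm & H).
exists (m / qbound 1)%R; split; [apply Rdiv_lt_0_compat; [exact Hm|apply qbound_pos]|].
intros x n Hx.
specialize (H x Hx); rewrite (qpoch_inf_split x n), Cmod_mult in H.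
assert (HB : (Cmod (qpoch_inf (x * q ^ n) q) <= qbound 1)%R).
{ eapply Rle_trans; [apply qpoch_inf_bound|apply qbound_incr].
  rewrite Cmod_mult, Cmod_qpow; assert (T := qpow_bounds n).
  rewrite <- (Rmult_1_l 1); apply Rmult_le_compat; try lra; apply Cmod_ge_0. }
apply Rmult_le_reg_r with (qbound 1); [apply qbound_pos|].
unfold Rdiv; rewrite Rmult_assoc, Rinv_l, Rmult_1_r by (apply Rgt_not_eq, qbound_pos).
eapply Rle_trans; [exact H|apply Rmult_le_compat_l; [apply Cmod_ge_0|exact HB]].
Qed.

Lemma qpoch_neq0 (x : C) (n : nat) : (Cmod x < 1)%R -> qpoch x q n <> 0.
Proof.
intros Hx; apply Cmod_gt_0.
eapply Rlt_le_trans; [|apply (qpoch_ge_pow (Cmod x))].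
- apply (pow_lt (1 - Cmod x)); lra.
- lra.
Qed.

Lemma qpoch_inf_neq0 (x : C) : (Cmod x < 1)%R -> qpoch_inf x q <> 0.
Proof.
intros Hx; apply Cmod_gt_0.
destruct (qpoch_inf_lower (Cmod x)) as (m & Hm & H).
- split; [apply Cmod_ge_0|exact Hx].
- eapply Rlt_le_trans; [exact Hm|apply H; lra].
Qed.

Lemma one_minus_neq0 (x : C) : (Cmod x < 1)%R -> 1 - x <> 0.
Proof.
intros H E; replace x with (1 - (1 - x)) in H by ring.
rewrite E in H; replace (1 - 0) with (RtoC 1) in H by ring; rewrite Cmod_1 in H; lra.
Qed.

Lemma Cmod_mul_qpow_le (x : C) (n : nat) : (Cmod (x * q ^ n) <= Cmod x)%R.
Proof.
rewrite Cmod_mult, Cmod_qpow, <- Rmult_1_r.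
apply Rmult_le_compat_l; [apply Cmod_ge_0|apply qpow_bounds].
Qed.

(* The even and odd factors of [(q x^2; q)_oo] are [1 - q^(2k+1) x^2] and
   [1 - q^(2k+2) x^2], each a difference of two squares. *)
Lemma qpoch_inf_double (s x : C) : s ^ 2 = q ->
  qpoch_inf (q * x ^ 2) q
  = qpoch_inf (s * x) q * qpoch_inf (- (s * x)) q
    * (qpoch_inf (q * x) q * qpoch_inf (- (q * x)) q).
Proof.
intros Hs.
apply (Ccv_unique (fun n => qpoch (q * x ^ 2) q (2 * n))).
- apply (Ccv_subseq (qpoch (q * x ^ 2) q) _ (fun n => (2 * n)%nat)); [lia|].
  apply qpoch_cv.
- eapply Ccv_ext; [|apply Ccv_mult; apply Ccv_mult; apply qpoch_cv].
  intros n; simpl.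
  induction n as [|n IH]; [simpl; ring|].
  replace (S n + (S n + 0))%nat with (S (S (n + (n + 0)))) by lia.
  rewrite !(qpoch_S _ _ (S _)), (qpoch_S _ _ (n + _)), <- IH, !qpoch_S.
  rewrite Cpow_S, Cpow_add_r, Nat.add_0_r.
  transitivity (qpoch (s * x) q n * qpoch (- (s * x)) q n
    * (qpoch (q * x) q n * qpoch (- (q * x)) q n)
    * (1 - s ^ 2 * (x * q ^ n) ^ 2) * (1 - q ^ 2 * (x * q ^ n) ^ 2)); [ring|].
  rewrite Hs; ring.
Qed.

End QPochhammer.

(** * Integrals of Laurent-approximable functions *)

Lemma RtoC_neq_0 (x : R) : x <> 0%R -> RtoC x <> 0.
Proof. intros H E; apply H; now injection E. Qed.

Definition is_CInt (f : R -> C) (a b : R) (l : C) : Prop :=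
  @is_RInt C_R_NormedModule f a b l.

Lemma is_CInt_pair (f : R -> C) (a b x y : R) :
  is_RInt (fun t => Re (f t)) a b x -> is_RInt (fun t => Im (f t)) a b y ->
  is_CInt f a b (x, y).
Proof. intros H1 H2; apply (is_RInt_fct_extend_pair f a b x y H1 H2). Qed.

Lemma is_CInt_Re (f : R -> C) (a b : R) (l : C) :
  is_CInt f a b l -> is_RInt (fun t => Re (f t)) a b (Re l).
Proof. apply (is_RInt_fct_extend_fst f a b l). Qed.

Lemma is_CInt_Im (f : R -> C) (a b : R) (l : C) :
  is_CInt f a b l -> is_RInt (fun t => Im (f t)) a b (Im l).
Proof. apply (is_RInt_fct_extend_snd f a b l). Qed.

Lemma is_CInt_ext (f g : R -> C) (a b : R) (l : C) :
  (forall t, f t = g t) -> is_CInt f a b l -> is_CInt g a b l.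
Proof. intros H; apply is_RInt_ext; intros t _; apply H. Qed.

Lemma is_CInt_plus (f g : R -> C) (a b : R) (l k : C) :
  is_CInt f a b l -> is_CInt g a b k -> is_CInt (fun t => f t + g t) a b (l + k).
Proof. apply (@is_RInt_plus C_R_NormedModule). Qed.

(** A complex [c] is no scalar of the real module [C_R_NormedModule], so the product is integrated
    by components. *)
Lemma is_CInt_scal (c : C) (f : R -> C) (a b : R) (l : C) :
  is_CInt f a b l -> is_CInt (fun t => c * f t) a b (c * l).
Proof.
intros H; assert (H1 := is_CInt_Re _ _ _ _ H); assert (H2 := is_CInt_Im _ _ _ _ H).
apply is_CInt_pair.
- exact (is_RInt_minus _ _ _ _ _ _ (is_RInt_scal _ _ _ (Re c) _ H1)
    (is_RInt_scal _ _ _ (Im c) _ H2)).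
- exact (is_RInt_plus _ _ _ _ _ _ (is_RInt_scal _ _ _ (Re c) _ H2)
    (is_RInt_scal _ _ _ (Im c) _ H1)).
Qed.

Lemma is_CInt_unique (f : R -> C) (a b : R) (l k : C) :
  is_CInt f a b l -> is_CInt f a b k -> l = k.
Proof.
intros H1 H2.
rewrite <- (@is_RInt_unique C_R_CompleteNormedModule f a b l H1).
exact (@is_RInt_unique C_R_CompleteNormedModule f a b k H2).
Qed.

Lemma Cmod_le_Re_Im (z : C) : (Cmod z <= Rabs (Re z) + Rabs (Im z))%R.
Proof.
assert (E : z = RtoC (Re z) + Ci * RtoC (Im z)).
{ destruct z as [x y]; unfold Cplus, Cmult, Ci; simpl; f_equal; ring. }
rewrite E at 1; eapply Rle_trans; [apply Cmod_triangle|].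
rewrite Cmod_mult, Cmod_Ci, !Cmod_R, Rmult_1_l; apply Rle_refl.
Qed.

(** Integrability of [g] is a conclusion. Integrals of infinite products below are all obtained this
    way, ultimately from integrals of Laurent polynomials. *)
Lemma is_CInt_ulim (f : nat -> R -> C) (g : R -> C) (a b : R) (h : nat -> C) :
  (forall n, is_CInt (f n) a b (h n)) ->
  (forall eps : R, (0 < eps)%R -> exists N, forall n, (N <= n)%nat ->
     forall t, (Cmod (f n t - g t) < eps)%R) ->
  exists I, Ccv h I /\ is_CInt g a b I.
Proof.
intros Hf Hu.
destruct (@filterlim_RInt nat C_R_CompleteNormedModule f a b eventually
  eventually_filter g h Hf) as [I [H1 H2]].
- apply filterlim_locally; intros eps.
  destruct (Hu eps (cond_pos eps)) as [N HN]; exists N; intros n Hn t.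
  specialize (HN n Hn t); split.
  + eapply Rle_lt_trans; [apply (re_le_Cmod (f n t - g t))|exact HN].
  + eapply Rle_lt_trans; [apply (im_le_Cmod (f n t - g t))|exact HN].
- exists I; split; [|exact H2].
  apply Ccv_eps; intros eps He.
  assert (He2 : (0 < eps / 2)%R) by lra.
  destruct (proj1 (filterlim_locally _ _) H1 (mkposreal _ He2)) as [N HN].
  exists N; intros n Hn; destruct (HN n Hn) as [HR HI].
  eapply Rle_lt_trans; [apply Cmod_le_Re_Im|].
  apply Rlt_le_trans with (eps / 2 + eps / 2)%R; [|lra].
  apply Rplus_lt_compat; [exact HR|exact HI].
Qed.

Lemma ex_CInt_sub (f : R -> C) (a b c : R) (l : C) : (a <= b <= c)%R ->
  is_CInt f a c l -> exists k, is_CInt f b c k.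
Proof.
intros H Hf.
exact (@ex_RInt_Chasles_2 C_R_CompleteNormedModule f a b c H (ex_intro _ l Hf)).
Qed.

Lemma is_CInt_fold (f : R -> C) (l : C) : is_CInt f (- PI)%R PI l ->
  is_CInt (fun t => f t + f (- t)%R) 0%R PI l.
Proof.
intros H; assert (Hpi := PI_RGT_0).
destruct (ex_CInt_sub f (- PI) 0 PI l ltac:(lra) H) as [k2 H2].
destruct (@ex_RInt_Chasles_1 C_R_CompleteNormedModule f (- PI) 0 PI ltac:(lra)
  (ex_intro _ l H)) as [k1 H1].
assert (Hl := is_CInt_unique _ _ _ _ _ H (is_RInt_Chasles _ _ _ _ _ _ H1 H2)).
rewrite Hl; change (plus k1 k2) with (k1 + k2); rewrite Cplus_comm.
apply is_CInt_plus; [exact H2|].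
apply (is_RInt_swap (V := C_R_NormedModule)) in H1.
rewrite <- Ropp_0 in H1 at 1.
apply (is_RInt_comp_opp (V := C_R_NormedModule)) in H1.
apply (is_RInt_opp (V := C_R_NormedModule)) in H1.
replace k1 with (@opp C_R_NormedModule (@opp C_R_NormedModule k1)) by apply opp_opp.
eapply is_CInt_ext; [|exact H1].
intros t; simpl; apply (@opp_opp C_R_NormedModule).
Qed.

(** * Means of Laurent polynomials and of their uniform limits over circles *)

Lemma cis_add (x y : R) : cis (x + y) = cis x * cis y.
Proof. unfold cis, Cmult; simpl; rewrite cos_plus, sin_plus; f_equal; ring. Qed.

Lemma cis_0 : cis 0 = 1.
Proof. unfold cis; now rewrite cos_0, sin_0. Qed.

Lemma Cmod_cis (t : R) : Cmod (cis t) = 1%R.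
Proof.
unfold Cmod, cis; simpl.
replace (_ + _)%R with (Rsqr (sin t) + Rsqr (cos t))%R by (unfold Rsqr; ring).
rewrite sin2_cos2; apply sqrt_1.
Qed.

Lemma cis_neq0 (t : R) : cis t <> 0.
Proof. apply Cmod_gt_0; rewrite Cmod_cis; lra. Qed.

Lemma cis_opp (t : R) : cis (- t) = / cis t.
Proof.
assert (H : cis t * cis (- t) = 1) by (rewrite <- cis_add, Rplus_opp_r; apply cis_0).
replace (cis (- t)) with (/ cis t * (cis t * cis (- t))).
- rewrite H; ring.
- field; apply cis_neq0.
Qed.

Lemma cis_pow (t : R) (n : nat) : cis t ^ n = cis (INR n * t).
Proof.
induction n as [|n IH]; [simpl; now rewrite Rmult_0_l, cis_0|].
rewrite Cpow_S, IH, <- cis_add, S_INR; f_equal; ring.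
Qed.

(** The real frequency [m] serves positive and negative powers of [cis t] alike. *)
Lemma is_CInt_cis (m : R) : m <> 0%R -> sin (m * PI) = 0%R ->
  is_CInt (fun t => cis (m * t)) (- PI)%R PI 0.
Proof.
intros Hm Hs; apply is_CInt_pair; simpl.
- replace 0%R with (minus (sin (m * PI) / m) (sin (m * - PI) / m))%R.
  + apply (is_RInt_derive (fun t => sin (m * t) / m)%R (fun t => cos (m * t))).
    * intros t _; auto_derive; [trivial|field; exact Hm].
    * intros t _; apply continuity_pt_filterlim; reg.
  + unfold minus, plus, opp; simpl.
    rewrite <- Ropp_mult_distr_r, sin_neg, Hs; field; exact Hm.
- replace 0%R with (minus (- cos (m * PI) / m) (- cos (m * - PI) / m))%R.
  + apply (is_RInt_derive (fun t => - cos (m * t) / m)%R (fun t => sin (m * t))).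
    * intros t _; auto_derive; [trivial|field; exact Hm].
    * intros t _; apply continuity_pt_filterlim; reg.
  + unfold minus, plus, opp; simpl.
    rewrite <- Ropp_mult_distr_r, cos_neg; field; exact Hm.
Qed.

Lemma sin_INR_PI (n : nat) : sin (INR n * PI) = 0%R.
Proof. apply sin_eq_0_1; exists (Z.of_nat n); now rewrite INR_IZR_INZ. Qed.

(** Closure under equality away from 0 stands in for functional extensionality and disregards the
    default value of [/ 0]. *)
Inductive laurent : (C -> C) -> Prop :=
| laurent_pos (c : C) (n : nat) : laurent (fun z => c * z ^ n)
| laurent_neg (c : C) (n : nat) : laurent (fun z => c * (/ z) ^ n)
| laurent_add (f g : C -> C) :
    laurent f -> laurent g -> laurent (fun z => f z + g z)
| laurent_ext (f g : C -> C) :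
    (forall z : C, z <> 0 -> f z = g z) -> laurent f -> laurent g.

Lemma laurent_mul (f g : C -> C) :
  laurent f -> laurent g -> laurent (fun z => f z * g z).
Proof.
assert (Hpn : forall c d n m, laurent (fun z => c * z ^ n * (d * (/ z) ^ m))).
{ intros c d n m; destruct (Nat.le_ge_cases m n) as [H|H].
  - apply laurent_ext with (fun z => c * d * z ^ (n - m)); [|constructor].
    intros z Hz; rewrite Cpow_inv by exact Hz.
    replace (z ^ n) with (z ^ (n - m) * z ^ m) by (rewrite <- Cpow_add_r; f_equal; lia).
    field; now apply Cpow_nz.
  - apply laurent_ext with (fun z => c * d * (/ z) ^ (m - n)); [|constructor].
    intros z Hz; rewrite !Cpow_inv by exact Hz.
    replace (z ^ m) with (z ^ (m - n) * z ^ n) by (rewrite <- Cpow_add_r; f_equal; lia).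
    field; split; now apply Cpow_nz. }
intros Hf Hg; induction Hf as [c n|c n|f1 f2 _ IH1 _ IH2|f1 f2 He _ IH].
- induction Hg as [d m|d m|g1 g2 _ IH1 _ IH2|g1 g2 He _ IH].
  + apply laurent_ext with (fun z => c * d * z ^ (n + m)); [|constructor].
    intros z _; rewrite Cpow_add_r; ring.
  + apply Hpn.
  + refine (laurent_ext _ _ _ (laurent_add _ _ IH1 IH2)); intros z _; ring.
  + refine (laurent_ext _ _ _ IH); intros z Hz; now rewrite He.
- induction Hg as [d m|d m|g1 g2 _ IH1 _ IH2|g1 g2 He _ IH].
  + refine (laurent_ext _ _ _ (Hpn d c m n)); intros z _; ring.
  + apply laurent_ext with (fun z => c * d * (/ z) ^ (n + m)); [|constructor].
    intros z _; rewrite Cpow_add_r; ring.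
  + refine (laurent_ext _ _ _ (laurent_add _ _ IH1 IH2)); intros z _; ring.
  + refine (laurent_ext _ _ _ IH); intros z Hz; now rewrite He.
- refine (laurent_ext _ _ _ (laurent_add _ _ IH1 IH2)); intros z _; ring.
- refine (laurent_ext _ _ _ IH); intros z Hz; now rewrite He.
Qed.

(** Only the constant term contributes, and it does not see the radius. The point is that [I] is
    chosen before [s]. *)
Lemma laurent_CInt (f : C -> C) : laurent f ->
  exists I, forall s : R, (0 < s)%R -> is_CInt (fun t => f (s * cis t)) (- PI)%R PI I.
Proof.
assert (H0 : forall c, is_CInt (fun _ => c) (- PI)%R PI (RtoC (2 * PI) * c)).
{ intros c; replace (RtoC (2 * PI) * c) with (@scal R_Ring C_R_NormedModule (PI - - PI)%R c).
  - apply (@is_RInt_const C_R_NormedModule).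
  - destruct c as [x y]; unfold scal, Cmult; simpl; unfold prod_scal; simpl.
    unfold scal; simpl; unfold mult; simpl; f_equal; ring. }
assert (Hn0 : forall n s, (0 < s)%R -> RtoC s * cis n <> 0).
{ intros n s Hs; apply Cmult_neq_0; [apply RtoC_neq_0; lra|apply cis_neq0]. }
intros Hf; induction Hf as [c n|c n|f g _ [I HI] _ [J HJ]|f g He _ [I HI]].
- destruct n as [|n].
  + eexists; intros s _; eapply is_CInt_ext; [|apply (H0 c)]; intros t; simpl; ring.
  + exists 0; intros s Hs.
    replace (RtoC 0) with (c * s ^ S n * 0) by ring.
    apply is_CInt_ext with (fun t => c * s ^ S n * cis (INR (S n) * t)).
    * intros t; rewrite <- cis_pow, Cpow_mult_l; ring.
    * apply is_CInt_scal, is_CInt_cis; [|apply sin_INR_PI].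
      apply not_0_INR; lia.
- destruct n as [|n].
  + eexists; intros s _; eapply is_CInt_ext; [|apply (H0 c)]; intros t; simpl; ring.
  + exists 0; intros s Hs.
    replace (RtoC 0) with (c * (/ s) ^ S n * 0) by ring.
    apply is_CInt_ext with (fun t => c * (/ s) ^ S n * cis ((- INR (S n)) * t)).
    * intros t.
      replace (- INR (S n) * t)%R with (INR (S n) * - t)%R by ring.
      rewrite <- cis_pow, cis_opp, <- Cmult_assoc, <- Cpow_mult_l.
      do 2 f_equal; field; split; [apply cis_neq0|apply RtoC_neq_0; lra].
    * apply is_CInt_scal, is_CInt_cis.
      -- apply Ropp_neq_0_compat, not_0_INR; lia.
      -- rewrite <- Ropp_mult_distr_l, sin_neg, sin_INR_PI; ring.
- exists (I + J); intros s Hs; apply is_CInt_plus; [now apply HI|now apply HJ].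
- exists I; intros s Hs; eapply is_CInt_ext; [|apply (HI s Hs)].
  intros t; apply He, Hn0, Hs.
Qed.

(** With [rho = q] this is the region between the two circles compared by the telescoper; with
    [rho = 1] it is the unit circle alone. *)
Definition annulus (rho : R) (z : C) : Prop := (rho <= Cmod z <= 1)%R.

(* The functions holomorphic near the annulus that occur below all belong to
   this class, which spares us Cauchy's theorem. *)
Definition laurent_approx (rho : R) (g : C -> C) : Prop :=
  forall eps : R, (0 < eps)%R -> exists L, laurent L /\
    forall z, annulus rho z -> (Cmod (g z - L z) <= eps)%R.

Section LaurentApprox.

Variable rho : R.
Hypothesis Hrho : (0 < rho <= 1)%R.

Lemma annulus_neq0 (z : C) : annulus rho z -> z <> 0.
Proof. intros [H _]; apply Cmod_gt_0; lra. Qed.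

Lemma Cmod_inv_annulus (z : C) : annulus rho z -> (Cmod (/ z) <= / rho)%R.
Proof.
intros H; rewrite Cmod_inv by (now apply annulus_neq0).
apply Rinv_le_contravar; [lra|apply H].
Qed.

Lemma laurent_bounded (f : C -> C) : laurent f ->
  exists B : R, (0 < B)%R /\ forall z, annulus rho z -> (Cmod (f z) <= B)%R.
Proof.
assert (Hr : (1 <= / rho)%R) by (rewrite <- Rinv_1 at 1; apply Rinv_le_contravar; lra).
intros Hf; induction Hf as [c n|c n|f g _ [B [HB HI]] _ [D [HD HJ]]|f g He _ [B [HB HI]]].
- exists (Cmod c + 1)%R; split; [assert (T := Cmod_ge_0 c); lra|].
  intros z Hz; rewrite Cmod_mult, Cmod_pow.
  assert (Cmod z ^ n <= 1)%R.
  { rewrite <- (pow1 n); apply pow_incr; destruct Hz; split; [apply Cmod_ge_0|lra]. }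
  assert (T := Cmod_ge_0 c).
  assert (Cmod c * Cmod z ^ n <= Cmod c * 1)%R by (now apply Rmult_le_compat_l).
  lra.
- exists (Cmod c * (/ rho) ^ n + 1)%R.
  assert (T := Cmod_ge_0 c).
  assert (T2 : (0 <= (/ rho) ^ n)%R) by (apply pow_le; lra).
  assert (T3 := Rmult_le_pos _ _ T T2).
  split; [lra|].
  intros z Hz; rewrite Cmod_mult, Cmod_pow.
  assert (Cmod (/ z) ^ n <= (/ rho) ^ n)%R.
  { apply pow_incr; split; [apply Cmod_ge_0|now apply Cmod_inv_annulus]. }
  assert (Cmod c * Cmod (/ z) ^ n <= Cmod c * (/ rho) ^ n)%R
    by (now apply Rmult_le_compat_l).
  lra.
- exists (B + D)%R; split; [lra|]; intros z Hz.
  eapply Rle_trans; [apply Cmod_triangle|].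
  apply Rplus_le_compat; auto.
- exists B; split; [exact HB|]; intros z Hz.
  rewrite <- He by (now apply annulus_neq0); auto.
Qed.

Lemma laurent_laurent_approx (f : C -> C) : laurent f -> laurent_approx rho f.
Proof.
intros Hf eps He; exists f; split; [exact Hf|]; intros z _.
replace (f z - f z) with (RtoC 0) by ring; rewrite Cmod_0; lra.
Qed.

Lemma laurent_approx_bounded (f : C -> C) : laurent_approx rho f ->
  exists B : R, (0 < B)%R /\ forall z, annulus rho z -> (Cmod (f z) <= B)%R.
Proof.
intros Hf; destruct (Hf 1%R ltac:(lra)) as [L [HL HfL]].
destruct (laurent_bounded L HL) as [B [HB HLB]].
exists (B + 1)%R; split; [lra|]; intros z Hz.
replace (f z) with ((f z - L z) + L z) by ring.
eapply Rle_trans; [apply Cmod_triangle|].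
specialize (HfL z Hz); specialize (HLB z Hz); lra.
Qed.

Lemma laurent_approx_ulim (f : C -> C) :
  (forall eps : R, (0 < eps)%R -> exists g, laurent_approx rho g /\
     forall z, annulus rho z -> (Cmod (f z - g z) <= eps)%R) ->
  laurent_approx rho f.
Proof.
intros H eps He; destruct (H (eps / 2)%R ltac:(lra)) as [g [Hg Hfg]].
destruct (Hg (eps / 2)%R ltac:(lra)) as [L [HL HgL]].
exists L; split; [exact HL|]; intros z Hz.
eapply Rle_trans; [apply (Cmod_dist_triangle _ (g z))|].
specialize (Hfg z Hz); specialize (HgL z Hz); lra.
Qed.

Lemma laurent_approx_ext (f g : C -> C) :
  (forall z, annulus rho z -> f z = g z) ->
  laurent_approx rho f -> laurent_approx rho g.
Proof.
intros H Hf eps He; destruct (Hf eps He) as [L [HL HfL]].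
exists L; split; [exact HL|]; intros z Hz; rewrite <- H; auto.
Qed.

Lemma laurent_approx_const (c : C) : laurent_approx rho (fun _ => c).
Proof.
apply laurent_laurent_approx, laurent_ext with (fun z => c * z ^ 0).
- intros z _; simpl; ring.
- constructor.
Qed.

Lemma laurent_approx_id : laurent_approx rho (fun z => z).
Proof.
apply laurent_laurent_approx, laurent_ext with (fun z => 1 * z ^ 1).
- intros z _; simpl; ring.
- constructor.
Qed.

Lemma laurent_approx_inv : laurent_approx rho (fun z => / z).
Proof.
apply laurent_laurent_approx, laurent_ext with (fun z => 1 * (/ z) ^ 1).
- intros z _; simpl; ring.
- constructor.
Qed.

Lemma laurent_approx_plus (f g : C -> C) : laurent_approx rho f ->
  laurent_approx rho g -> laurent_approx rho (fun z => f z + g z).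
Proof.
intros Hf Hg eps He.
destruct (Hf (eps / 2)%R ltac:(lra)) as [L [HL HfL]].
destruct (Hg (eps / 2)%R ltac:(lra)) as [M [HM HgM]].
exists (fun z => L z + M z); split; [now apply laurent_add|]; intros z Hz.
replace (f z + g z - (L z + M z)) with ((f z - L z) + (g z - M z)) by ring.
eapply Rle_trans; [apply Cmod_triangle|].
specialize (HfL z Hz); specialize (HgM z Hz); lra.
Qed.

Lemma laurent_approx_mult (f g : C -> C) : laurent_approx rho f ->
  laurent_approx rho g -> laurent_approx rho (fun z => f z * g z).
Proof.
intros Hf Hg eps He.
destruct (laurent_approx_bounded f Hf) as [B [HB HfB]].
assert (H1 : (0 < eps / 2 / B)%R) by (repeat apply Rdiv_lt_0_compat; lra).
destruct (Hg _ H1) as [M [HM HgM]].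
destruct (laurent_bounded M HM) as [D [HD HMD]].
assert (H2 : (0 < eps / 2 / D)%R) by (repeat apply Rdiv_lt_0_compat; lra).
destruct (Hf _ H2) as [L [HL HfL]].
exists (fun z => L z * M z); split; [now apply laurent_mul|]; intros z Hz.
replace (f z * g z - L z * M z) with (f z * (g z - M z) + (f z - L z) * M z) by ring.
eapply Rle_trans; [apply Cmod_triangle|]; rewrite !Cmod_mult.
replace eps with (B * (eps / 2 / B) + eps / 2 / D * D)%R by (field; lra).
apply Rplus_le_compat; apply Rmult_le_compat; auto using Cmod_ge_0.
Qed.

Lemma laurent_approx_minus (f g : C -> C) : laurent_approx rho f ->
  laurent_approx rho g -> laurent_approx rho (fun z => f z - g z).
Proof.
intros Hf Hg; apply laurent_approx_ext with (fun z => f z + (RtoC (-1)) * g z).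
- intros z _; ring.
- apply laurent_approx_plus, laurent_approx_mult; auto using laurent_approx_const.
Qed.

Lemma laurent_approx_geom (u : C -> C) (k : R) : laurent_approx rho u -> (k < 1)%R ->
  (forall z, annulus rho z -> (Cmod (u z) <= k)%R) ->
  laurent_approx rho (fun z => / (1 - u z)).
Proof.
intros Hu Hk Huk; apply laurent_approx_ulim; intros eps He.
(* Makes the ratio nonnegative without exhibiting a point of the annulus. *)
set (k' := Rmax k 0).
assert (Hk' : (0 <= k' < 1)%R).
{ split; [apply Rmax_r|apply Rmax_lub_lt; lra]. }
assert (Hl : is_lim_seq (fun n => / (1 - k') * k' ^ n)%R 0%R).
{ apply lim0_scal, is_lim_seq_geom; rewrite Rabs_pos_eq; lra. }
assert (Hi : (0 < / (1 - k'))%R) by (apply Rinv_0_lt_compat; lra).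
destruct (proj1 (lim0_eps _ (fun n => Rmult_le_pos _ _ (Rlt_le _ _ Hi)
  (pow_le _ n (proj1 Hk')))) Hl eps He) as [N HN].
specialize (HN N (le_n N)).
assert (Hpow : forall n, laurent_approx rho (fun z => u z ^ n)).
{ induction n as [|n IH]; [exact (laurent_approx_const 1)|].
  now apply (laurent_approx_mult u (fun z => u z ^ n)). }
(* The partial geometric sums, known only through the equation they satisfy. *)
assert (Hfin : forall n, exists g, laurent_approx rho g /\
   forall z, (1 - u z) * g z = 1 - u z ^ n).
{ induction n as [|n [g [Hg Hgz]]].
  - exists (fun _ => 0); split; [apply laurent_approx_const|intros z; simpl; ring].
  - exists (fun z => g z + u z ^ n); split; [now apply laurent_approx_plus|].
    intros z; rewrite Cmult_plus_distr_l, Hgz, Cpow_S; ring. }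
destruct (Hfin N) as [g [Hg Hgz]]; exists g; split; [exact Hg|]; intros z Hz.
assert (Huz : (Cmod (u z) <= k')%R).
{ eapply Rle_trans; [apply Huk, Hz|apply Rmax_l]. }
assert (Hnz : 1 - u z <> 0) by (apply one_minus_neq0; lra).
replace (/ (1 - u z) - g z) with (/ (1 - u z) * u z ^ N).
- rewrite Cmod_mult, Cmod_inv, Cmod_pow by exact Hnz.
  apply Rlt_le; eapply Rle_lt_trans; [|exact HN].
  apply Rmult_le_compat.
  + apply Rlt_le, Rinv_0_lt_compat, Cmod_gt_0, Hnz.
  + apply pow_le, Cmod_ge_0.
  + apply Rinv_le_contravar; [lra|].
    assert (T := Cmod_sub_ge 1 (u z)); rewrite Cmod_1 in T; lra.
  + apply pow_incr; split; [apply Cmod_ge_0|exact Huz].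
- replace (u z ^ N) with (1 - (1 - u z) * g z) by (rewrite Hgz; ring).
  field; exact Hnz.
Qed.

(** The integrals [J n] of the approximants do not depend on the radius, hence neither does their
    limit. This replaces Cauchy's theorem for the annulus. *)
Lemma laurent_approx_CInt (f : C -> C) : laurent_approx rho f ->
  exists I, forall s : R, (rho <= s <= 1)%R ->
    is_CInt (fun t => f (s * cis t)) (- PI)%R PI I.
Proof.
intros Hf.
assert (Hpos : forall n, (0 < / (INR n + 1))%R).
{ intros n; apply Rinv_0_lt_compat; assert (T := pos_INR n); lra. }
set (L := fun n => proj1_sig (constructive_indefinite_description _ (Hf _ (Hpos n)))).
assert (HL : forall n, laurent (L n) /\
   forall z, annulus rho z -> (Cmod (f z - L n z) <= / (INR n + 1))%R).
{ intros n; exact (proj2_sig (constructive_indefinite_description _ (Hf _ (Hpos n)))). }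
set (J := fun n => proj1_sig (constructive_indefinite_description _
  (laurent_CInt _ (proj1 (HL n))))).
assert (HJ : forall n s, (0 < s)%R -> is_CInt (fun t => L n (s * cis t)) (- PI)%R PI (J n)).
{ intros n; exact (proj2_sig (constructive_indefinite_description _
  (laurent_CInt _ (proj1 (HL n))))). }
assert (H : forall s : R, (rho <= s <= 1)%R ->
  exists I, Ccv J I /\ is_CInt (fun t => f (s * cis t)) (- PI)%R PI I).
{ intros s Hs; apply is_CInt_ulim with (fun n t => L n (s * cis t)).
  - intros n; apply HJ; lra.
  - intros eps He.
    assert (Hl : is_lim_seq (fun n => / (INR n + 1))%R 0%R).
    { apply (is_lim_seq_inv _ p_infty); [|discriminate].
      apply (is_lim_seq_plus _ _ p_infty 1%R);
        [apply is_lim_seq_INR|apply is_lim_seq_const|reflexivity]. }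
    destruct (proj1 (lim0_eps _ (fun n => Rlt_le _ _ (Hpos n))) Hl eps He) as [N HN].
    exists N; intros n Hn t; eapply Rle_lt_trans; [|apply (HN n Hn)].
    rewrite Cmod_dist_sym; apply HL.
    unfold annulus; rewrite Cmod_mult, Cmod_cis, Cmod_R, Rmult_1_r, Rabs_pos_eq; lra. }
destruct (H 1%R ltac:(lra)) as [I [HI _]].
exists I; intros s Hs; destruct (H s Hs) as [I' [HI' Hint]].
now rewrite (Ccv_unique _ _ _ HI HI').
Qed.

Variable q : R.
Hypothesis Hq : (0 < q < 1)%R.

Lemma laurent_approx_qpoch (u : C -> C) (n : nat) :
  laurent_approx rho u -> laurent_approx rho (fun z => qpoch (u z) q n).
Proof.
intros Hu; induction n as [|n IH]; [exact (laurent_approx_const 1)|].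
apply (laurent_approx_mult (fun z => qpoch (u z) q n)); [exact IH|].
apply (laurent_approx_minus (fun _ => 1)); [apply laurent_approx_const|].
apply laurent_approx_mult; [exact Hu|apply laurent_approx_const].
Qed.

Lemma qpoch_inf_uniform (B : R) (eps : R) : (0 <= B)%R -> (0 < eps)%R ->
  exists N, forall x, (Cmod x <= B)%R ->
    (Cmod (qpoch_inf x q - qpoch x q N) <= eps)%R.
Proof.
intros HB He.
assert (Hb : (0 <= qbound q B * B / (1 - q))%R).
{ apply Rmult_le_pos; [|apply Rlt_le, Rinv_0_lt_compat; lra].
  apply Rmult_le_pos; [apply Rlt_le, qbound_pos|exact HB]. }
assert (Hl := lim0_scal (qbound q B * B / (1 - q)) _ (qpow_lim0 q Hq)).
destruct (proj1 (lim0_eps _ (fun n => Rmult_le_pos _ _ Hb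
  (Rlt_le _ _ (proj1 (qpow_bounds q Hq n))))) Hl eps He) as [N HN].
exists N; intros x Hx; specialize (HN N (le_n N)).
eapply Rle_trans; [apply qpoch_inf_dist, Hq|].
eapply Rle_trans; [|apply Rlt_le, HN].
replace (qbound q B * B / (1 - q) * q ^ N)%R
  with (qbound q B * B * (q ^ N / (1 - q)))%R by (field; lra).
apply Rmult_le_compat_r.
- apply Rmult_le_pos; [apply Rlt_le, qpow_bounds, Hq|apply Rlt_le, Rinv_0_lt_compat; lra].
- apply Rmult_le_compat; [apply Rlt_le, qbound_pos|apply Cmod_ge_0| |exact Hx].
  now apply qbound_incr.
Qed.

Lemma laurent_approx_qpoch_inf (u : C -> C) :
  laurent_approx rho u -> laurent_approx rho (fun z => qpoch_inf (u z) q).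
Proof.
intros Hu; apply laurent_approx_ulim; intros eps He.
destruct (laurent_approx_bounded u Hu) as [B [HB HuB]].
destruct (qpoch_inf_uniform B eps ltac:(lra) He) as [N HN].
exists (fun z => qpoch (u z) q N); split; [now apply laurent_approx_qpoch|].
intros z Hz; apply HN, HuB, Hz.
Qed.

Lemma laurent_approx_inv_qpoch_inf (u : C -> C) (k : R) : (0 <= k < 1)%R ->
  (forall z, annulus rho z -> (Cmod (u z) <= k)%R) ->
  laurent_approx rho u -> laurent_approx rho (fun z => / qpoch_inf (u z) q).
Proof.
intros Hk Huk Hu; apply laurent_approx_ulim; intros eps He.
destruct (qpoch_inf_lower q Hq k Hk) as [m [Hm Hinf]].
destruct (qpoch_lower q Hq k Hk) as [m' [Hm' Hfin]].
(* The tolerance compensates for [|1/A - 1/B| = |A - B| / |A B|] with [|A| >= m] and [|B| >= m']. *)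
destruct (qpoch_inf_uniform k (eps * (m * m')) ltac:(lra)
  ltac:(repeat apply Rmult_lt_0_compat; lra)) as [N HN].
exists (fun z => / qpoch (u z) q N); split.
- clear HN; induction N as [|N IH].
  + apply laurent_approx_ext with (fun _ => 1); [|apply laurent_approx_const].
    intros z _; simpl; field.
  + apply laurent_approx_ext
      with (fun z => / qpoch (u z) q N * / (1 - u z * q ^ N)).
    * intros z Hz; rewrite qpoch_S; field; split.
      -- apply one_minus_neq0.
         eapply Rle_lt_trans; [apply Cmod_mul_qpow_le, Hq|].
         specialize (Huk z Hz); lra.
      -- apply qpoch_neq0; [exact Hq|]; specialize (Huk z Hz); lra.
    * apply laurent_approx_mult; [exact IH|].
      apply laurent_approx_geom with k; [|lra|].
      -- apply laurent_approx_mult; [exact Hu|apply laurent_approx_const].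
      -- intros z Hz; eapply Rle_trans; [apply Cmod_mul_qpow_le, Hq|now apply Huk].
- intros z Hz; specialize (Huk z Hz).
  specialize (HN _ Huk); specialize (Hinf _ Huk); specialize (Hfin _ N Huk).
  assert (H1 : qpoch_inf (u z) q <> 0) by (apply Cmod_gt_0; lra).
  assert (H2 : qpoch (u z) q N <> 0) by (apply Cmod_gt_0; lra).
  replace (/ qpoch_inf (u z) q - / qpoch (u z) q N)
    with (- (qpoch_inf (u z) q - qpoch (u z) q N)
          / (qpoch_inf (u z) q * qpoch (u z) q N)) by (field; split; assumption).
  rewrite Cmod_div, Cmod_opp, Cmod_mult by (now apply Cmult_neq_0).
  assert (Hp : (0 < m * m')%R) by (now apply Rmult_lt_0_compat).
  apply Rle_trans with (eps * (m * m') / (m * m'))%R;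
    [|right; field; split; apply Rgt_not_eq; assumption].
  apply Rmult_le_compat; [apply Cmod_ge_0| |exact HN|].
  + apply Rlt_le, Rinv_0_lt_compat, Rmult_lt_0_compat; lra.
  + apply Rinv_le_contravar; [exact Hp|].
    apply Rmult_le_compat; lra.
Qed.

End LaurentApprox.

(** * Rahman's integral *)

(** The rational core of [rahman_contiguous]: what is left of that relation once the infinite
    products common to its terms are removed and the linear denominators cleared. *)
Lemma rahman_contiguous_poly (t1 t2 t3 t4 t5 z w : C) : z * w = 1 ->
  let f := t1 * t2 * t3 * t4 * t5 in
  (1 - z ^ 2) * (1 - w ^ 2)
  * ((1 - t1 * z) * (1 - t1 * w)
     * ((1 - t1 * t3 * t4 * t5) * (1 - t1 * t2 * t4 * t5)
        * (1 - t1 * t2 * t3 * t5) * (1 - t1 * t2 * t3 * t4))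
     - (1 - f * z) * (1 - f * w)
       * ((1 - t1 * t2) * (1 - t1 * t3) * (1 - t1 * t4) * (1 - t1 * t5)))
  = - (t1 * (1 - t1 * f))
    * (z * (1 - z ^ 2) * (1 - f * z)
       * ((1 - t1 * w) * (1 - t2 * w) * (1 - t3 * w) * (1 - t4 * w) * (1 - t5 * w))
     + w * (1 - w ^ 2) * (1 - f * w)
       * ((1 - t1 * z) * (1 - t2 * z) * (1 - t3 * z) * (1 - t4 * z) * (1 - t5 * z))).
Proof.
intros H; simpl.
assert (Hz : z <> 0).
{ intros E; rewrite E, Cmult_0_l in H; injection H; lra. }
replace w with (/ z) by (rewrite <- (Cmult_1_r (/ z)), <- H; field; exact Hz).
field; exact Hz.
Qed.

Lemma Cmod_mult_lt1 (x y : C) : (Cmod x < 1)%R -> (Cmod y < 1)%R -> (Cmod (x * y) < 1)%R.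
Proof.
intros Hx Hy; rewrite Cmod_mult.
apply Rle_lt_trans with (Cmod x * 1)%R; [|lra].
apply Rmult_le_compat_l; [apply Cmod_ge_0|lra].
Qed.

Lemma Cmod_mult_unit (x z : C) : Cmod z = 1%R -> Cmod (x * z) = Cmod x.
Proof. intros H; rewrite Cmod_mult, H; ring. Qed.

Lemma Cmod_inv_unit (z : C) : Cmod z = 1%R -> Cmod (/ z) = 1%R.
Proof.
intros H; rewrite Cmod_inv, H; [field|].
apply Cmod_gt_0; lra.
Qed.

Lemma is_CInt_reflect (f : R -> C) (a : R) (l : C) :
  is_CInt f (- a) a l -> is_CInt (fun t => f (- t)%R) (- a) a l.
Proof.
intros H.
apply (is_RInt_swap (V := C_R_NormedModule)) in H.
rewrite <- (Ropp_involutive a) in H at 1.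
apply (is_RInt_comp_opp (V := C_R_NormedModule)) in H.
apply (is_RInt_opp (V := C_R_NormedModule)) in H.
replace l with (@opp C_R_NormedModule (@opp C_R_NormedModule l)) by apply opp_opp.
eapply is_CInt_ext; [|exact H].
intros t; simpl; apply (@opp_opp C_R_NormedModule).
Qed.

(** Uniform convergence on the unit circle, with the limit fixed to be 1: then products and inverses
    preserve it without separate boundedness assumptions. *)
Definition ucv1 (f : nat -> C -> C) : Prop :=
  forall eps : R, (0 < eps)%R -> exists N, forall n, (N <= n)%nat ->
    forall z, Cmod z = 1%R -> (Cmod (f n z - 1) < eps)%R.

Lemma ucv1_mult (f g : nat -> C -> C) :
  ucv1 f -> ucv1 g -> ucv1 (fun n z => f n z * g n z).
Proof.
intros Hf Hg eps He.
set (e := Rmin 1 (eps / 3)).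
assert (He' : (0 < e)%R) by (apply Rmin_glb_lt; lra).
assert (e <= 1)%R by apply Rmin_l.
assert (e <= eps / 3)%R by apply Rmin_r.
destruct (Hf e He') as [N1 H1]; destruct (Hg e He') as [N2 H2].
exists (max N1 N2); intros n Hn z Hz.
specialize (H1 n ltac:(lia) z Hz); specialize (H2 n ltac:(lia) z Hz).
replace (f n z * g n z - 1)
  with ((f n z - 1) * (g n z - 1) + ((f n z - 1) + (g n z - 1))) by ring.
eapply Rle_lt_trans; [apply Cmod_triangle|].
eapply Rle_lt_trans; [apply Rplus_le_compat_l, Cmod_triangle|].
rewrite Cmod_mult.
assert (Cmod (f n z - 1) * Cmod (g n z - 1) <= 1 * Cmod (g n z - 1))%R.
{ apply Rmult_le_compat_r; [apply Cmod_ge_0|lra]. }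
lra.
Qed.

Lemma ucv1_inv (f : nat -> C -> C) : ucv1 f -> ucv1 (fun n z => / f n z).
Proof.
intros Hf eps He.
set (e := Rmin (/ 2) (eps / 2)).
assert (He' : (0 < e)%R) by (apply Rmin_glb_lt; lra).
assert (e <= / 2)%R by apply Rmin_l.
assert (e <= eps / 2)%R by apply Rmin_r.
destruct (Hf e He') as [N HN]; exists N; intros n Hn z Hz.
specialize (HN n Hn z Hz).
assert (Hlow : (/ 2 <= Cmod (f n z))%R).
{ assert (T := Cmod_sub_ge 1 (1 - f n z)).
  replace (1 - (1 - f n z)) with (f n z) in T by ring.
  rewrite Cmod_1, (Cmod_dist_sym 1) in T; lra. }
assert (Hnz : f n z <> 0) by (apply Cmod_gt_0; lra).
replace (/ f n z - 1) with (- (f n z - 1) * / f n z) by (field; exact Hnz).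
rewrite Cmod_mult, Cmod_opp, Cmod_inv by exact Hnz.
apply Rle_lt_trans with (Cmod (f n z - 1) * 2)%R; [|lra].
apply Rmult_le_compat_l; [apply Cmod_ge_0|].
rewrite <- (Rinv_inv 2); apply Rinv_le_contravar; lra.
Qed.

(** * The q-difference equation of Rahman's integral *)

Section Rahman.

Variable q : R.
Hypothesis Hq : (0 < q < 1)%R.

Local Notation P x := (qpoch_inf x q).

Definition rahman_weight (t1 t2 t3 t4 t5 z : C) : C :=
  P (z ^ 2) * P ((/ z) ^ 2)
  * (P (t1 * t2 * t3 * t4 * t5 * z) * P (t1 * t2 * t3 * t4 * t5 * / z))
  * (/ P (t1 * z) * / P (t2 * z) * / P (t3 * z) * / P (t4 * z) * / P (t5 * z))
  * (/ P (t1 * / z) * / P (t2 * / z) * / P (t3 * / z) * / P (t4 * / z)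
     * / P (t5 * / z)).

(** The factors free of [t1] stand first and last. The middle ones give the effect of [t1 -> q t1]:
    multiplication by the four [1 - t1 t_j] and division by the four [1 - t1 t_i t_j t_k]. *)
Definition rahman_value (t1 t2 t3 t4 t5 : C) : C :=
  P (t2 * t3 * t4 * t5) * (P (t1 * t3 * t4 * t5) * P (t1 * t2 * t4 * t5)
  * P (t1 * t2 * t3 * t5) * P (t1 * t2 * t3 * t4))
  * (/ P (t1 * t2) * / P (t1 * t3) * / P (t1 * t4) * / P (t1 * t5))
  * (/ P (t2 * t3) * / P (t2 * t4) * / P (t2 * t5)
     * / P (t3 * t4) * / P (t3 * t5) * / P (t4 * t5)).

(** The weight with every factor in [1/z] shifted by [q], times [z]. The shift keeps the zeros of
    the denominators inside [|z| < q], and the map [z -> q z] exchanges the factors in [z] with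
    those in [1/z]. *)
Definition rahman_cert (t1 t2 t3 t4 t5 z : C) : C :=
  z * (P (z ^ 2) * P (q * (/ z) ^ 2))
  * (P (t1 * t2 * t3 * t4 * t5 * z) * P (q * (t1 * t2 * t3 * t4 * t5 * / z)))
  * (/ P (t1 * z) * / P (t2 * z) * / P (t3 * z) * / P (t4 * z) * / P (t5 * z))
  * (/ P (q * (t1 * / z)) * / P (q * (t2 * / z)) * / P (q * (t3 * / z))
     * / P (q * (t4 * / z)) * / P (q * (t5 * / z))).

(** Cyclic rotation is enough symmetry: it brings each parameter in turn to the first place, where
    the shift acts. *)
Lemma rahman_weight_rot (t1 t2 t3 t4 t5 z : C) :
  rahman_weight t1 t2 t3 t4 t5 z = rahman_weight t2 t3 t4 t5 t1 z.
Proof.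
unfold rahman_weight.
replace (t2 * t3 * t4 * t5 * t1) with (t1 * t2 * t3 * t4 * t5) by ring; ring.
Qed.

Lemma rahman_value_rot (t1 t2 t3 t4 t5 : C) :
  rahman_value t1 t2 t3 t4 t5 = rahman_value t2 t3 t4 t5 t1.
Proof.
unfold rahman_value.
replace (t3 * t4 * t5 * t1) with (t1 * t3 * t4 * t5) by ring.
replace (t2 * t4 * t5 * t1) with (t1 * t2 * t4 * t5) by ring.
replace (t2 * t3 * t5 * t1) with (t1 * t2 * t3 * t5) by ring.
replace (t2 * t3 * t4 * t1) with (t1 * t2 * t3 * t4) by ring.
rewrite (Cmult_comm t2 t1), (Cmult_comm t3 t1), (Cmult_comm t4 t1), (Cmult_comm t5 t1).
ring.
Qed.

Lemma Pq_neq0 (x : C) : (Cmod x < 1)%R -> P (q * x) <> 0.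
Proof.
intros H; apply qpoch_inf_neq0; [exact Hq|].
apply Cmod_mult_lt1; [|exact H]; rewrite Cmod_R, Rabs_pos_eq; lra.
Qed.

Lemma q_neq0 : RtoC q <> 0.
Proof. apply RtoC_neq_0; lra. Qed.

(** Splitting off first factors leaves the same products [P (q x)] in all four terms; the rest is
    [rahman_contiguous_poly] divided by the linear denominators. *)
Lemma rahman_contiguous (t1 t2 t3 t4 t5 z : C) :
  (Cmod t1 < 1)%R -> (Cmod t2 < 1)%R -> (Cmod t3 < 1)%R -> (Cmod t4 < 1)%R ->
  (Cmod t5 < 1)%R -> Cmod z = 1%R ->
  rahman_weight (q * t1) t2 t3 t4 t5 z
  * ((1 - t1 * t3 * t4 * t5) * (1 - t1 * t2 * t4 * t5)
     * (1 - t1 * t2 * t3 * t5) * (1 - t1 * t2 * t3 * t4))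
  = rahman_weight t1 t2 t3 t4 t5 z
    * ((1 - t1 * t2) * (1 - t1 * t3) * (1 - t1 * t4) * (1 - t1 * t5))
    - t1 * (1 - t1 * (t1 * t2 * t3 * t4 * t5))
      * (rahman_cert t1 t2 t3 t4 t5 z + rahman_cert t1 t2 t3 t4 t5 (/ z)).
Proof.
intros H1 H2 H3 H4 H5 Hz.
assert (Hz0 : z <> 0) by (apply Cmod_gt_0; lra).
assert (Hw := Cmod_inv_unit z Hz).
assert (Hzw : z * / z = 1) by (field; exact Hz0).
assert (Hpoly := rahman_contiguous_poly t1 t2 t3 t4 t5 z (/ z) Hzw); cbv zeta in Hpoly.
unfold rahman_weight, rahman_cert.
replace (/ / z) with z by (field; exact Hz0).
assert (Hu : forall t u, (Cmod t < 1)%R -> Cmod u = 1%R ->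
   / P (t * u) = / (1 - t * u) * / P (q * (t * u)) /\ 1 - t * u <> 0).
{ intros t u Ht Hu'.
  assert (T : (Cmod (t * u) < 1)%R) by (now rewrite Cmod_mult_unit).
  assert (T1 := one_minus_neq0 _ T); assert (T2 := Pq_neq0 _ T).
  rewrite (qpoch_inf_Sl q Hq (t * u)); split; [field; now split|exact T1]. }
(* From here on the inverse of [z] is a variable, related to [z] only by [Hzw] and [Hpoly]. *)
generalize dependent (/ z); intros w Hw Hzw Hpoly.
destruct (Hu t1 z H1 Hz) as [E1 N1]; destruct (Hu t2 z H2 Hz) as [E2 N2];
destruct (Hu t3 z H3 Hz) as [E3 N3]; destruct (Hu t4 z H4 Hz) as [E4 N4];
destruct (Hu t5 z H5 Hz) as [E5 N5];
destruct (Hu t1 w H1 Hw) as [F1 M1]; destruct (Hu t2 w H2 Hw) as [F2 M2];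
destruct (Hu t3 w H3 Hw) as [F3 M3]; destruct (Hu t4 w H4 Hw) as [F4 M4];
destruct (Hu t5 w H5 Hw) as [F5 M5].
rewrite E1, E2, E3, E4, E5, F1, F2, F3, F4, F5.
rewrite (qpoch_inf_Sl q Hq (z ^ 2)), (qpoch_inf_Sl q Hq (w ^ 2)).
replace (q * t1 * t2 * t3 * t4 * t5 * z) with (q * (t1 * t2 * t3 * t4 * t5 * z)) by ring.
replace (q * t1 * t2 * t3 * t4 * t5 * w) with (q * (t1 * t2 * t3 * t4 * t5 * w)) by ring.
replace (q * t1 * z) with (q * (t1 * z)) by ring.
replace (q * t1 * w) with (q * (t1 * w)) by ring.
rewrite (qpoch_inf_Sl q Hq (t1 * t2 * t3 * t4 * t5 * z)),
  (qpoch_inf_Sl q Hq (t1 * t2 * t3 * t4 * t5 * w)).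
set (f := t1 * t2 * t3 * t4 * t5) in *.
assert (X : (1 - z ^ 2) * (1 - w ^ 2) * ((1 - t1 * z) * (1 - t1 * w))
    * ((1 - t1 * t3 * t4 * t5) * (1 - t1 * t2 * t4 * t5)
        * (1 - t1 * t2 * t3 * t5) * (1 - t1 * t2 * t3 * t4))
  = (1 - z ^ 2) * (1 - w ^ 2) * ((1 - f * z) * (1 - f * w)
       * ((1 - t1 * t2) * (1 - t1 * t3) * (1 - t1 * t4) * (1 - t1 * t5)))
    - t1 * (1 - t1 * f)
    * (z * (1 - z ^ 2) * (1 - f * z)
       * ((1 - t1 * w) * (1 - t2 * w) * (1 - t3 * w) * (1 - t4 * w) * (1 - t5 * w))
     + w * (1 - w ^ 2) * (1 - f * w)
       * ((1 - t1 * z) * (1 - t2 * z) * (1 - t3 * z) * (1 - t4 * z) * (1 - t5 * z)))).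
{ set (lhs := (1 - z ^ 2) * (1 - w ^ 2) * ((1 - t1 * z) * (1 - t1 * w))
    * ((1 - t1 * t3 * t4 * t5) * (1 - t1 * t2 * t4 * t5)
        * (1 - t1 * t2 * t3 * t5) * (1 - t1 * t2 * t3 * t4))).
  set (c := (1 - z ^ 2) * (1 - w ^ 2) * ((1 - f * z) * (1 - f * w)
       * ((1 - t1 * t2) * (1 - t1 * t3) * (1 - t1 * t4) * (1 - t1 * t5)))).
  transitivity (c + (lhs - c)); [ring|].
  transitivity (c + - (t1 * (1 - t1 * f))
    * (z * (1 - z ^ 2) * (1 - f * z)
       * ((1 - t1 * w) * (1 - t2 * w) * (1 - t3 * w) * (1 - t4 * w) * (1 - t5 * w))
     + w * (1 - w ^ 2) * (1 - f * w)
       * ((1 - t1 * z) * (1 - t2 * z) * (1 - t3 * z) * (1 - t4 * z) * (1 - t5 * z)))).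
  - rewrite <- Hpoly; unfold lhs, c; f_equal; ring.
  - unfold c; ring. }
clear Hpoly E1 E2 E3 E4 E5 F1 F2 F3 F4 F5 Hu; clearbody f.
(* The ten inverted products become [c], [c0] to [c8], and the four others [c9] to [c12]; these
   names are used in the common multiplier of [X] below. *)
repeat match goal with
  |- context [/ qpoch_inf ?x ?p] => generalize (/ qpoch_inf x p); intro end.
repeat match goal with
  |- context [qpoch_inf ?x ?p] => generalize (qpoch_inf x p); intro end.
revert X N1 N2 N3 N4 N5 M1 M2 M3 M4 M5.
generalize (1 - t1 * z) (1 - t2 * z) (1 - t3 * z) (1 - t4 * z) (1 - t5 * z)
  (1 - t1 * w) (1 - t2 * w) (1 - t3 * w) (1 - t4 * w) (1 - t5 * w)
  (1 - z ^ 2) (1 - w ^ 2) (1 - f * z) (1 - f * w)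
  (1 - t1 * t3 * t4 * t5) (1 - t1 * t2 * t4 * t5) (1 - t1 * t2 * t3 * t5)
  (1 - t1 * t2 * t3 * t4) (1 - t1 * t2) (1 - t1 * t3) (1 - t1 * t4) (1 - t1 * t5)
  (1 - t1 * f).
intros a1 a2 a3 a4 a5 b1 b2 b3 b4 b5 vz vw fz fw g2 g3 g4 g5 e2 e3 e4 e5 ef X; intros.
match type of X with ?l = _ => match goal with |- ?g = _ =>
  transitivity (l * (c9 * c10 * c11 * c12 * (c * c0 * c1 * c2 * c3)
    * (c4 * c5 * c6 * c7 * c8)
    / (a1 * a2 * a3 * a4 * a5 * (b1 * b2 * b3 * b4 * b5)))) end end.
- field; repeat split; assumption.
- rewrite X; field; repeat split; assumption.
Qed.

(** For [q <= |z| <= 1] both [t z] and [q t / z] have modulus at most [|t| < 1], so no denominator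
    vanishes on the annulus. *)
Lemma rahman_cert_approx (t1 t2 t3 t4 t5 : C) :
  (Cmod t1 < 1)%R -> (Cmod t2 < 1)%R -> (Cmod t3 < 1)%R -> (Cmod t4 < 1)%R ->
  (Cmod t5 < 1)%R -> laurent_approx q (rahman_cert t1 t2 t3 t4 t5).
Proof.
intros H1 H2 H3 H4 H5.
assert (Hr : (0 < q <= 1)%R) by lra.
assert (Hid := laurent_approx_id q); assert (Hinv := laurent_approx_inv q).
assert (Hc := laurent_approx_const q).
assert (Hm := laurent_approx_mult q Hr).
assert (HP : forall u, laurent_approx q u -> laurent_approx q (fun z => P (u z)))
  by (intros; now apply laurent_approx_qpoch_inf).
assert (Hsq : forall u, laurent_approx q u -> laurent_approx q (fun z => u z ^ 2)).
{ intros u Hu; apply laurent_approx_ext with (fun z => u z * u z); [intros; ring|auto]. }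
assert (Hin : forall t, (Cmod t < 1)%R -> laurent_approx q (fun z => / P (t * z))).
{ intros t Ht; apply laurent_approx_inv_qpoch_inf with (Cmod t); auto.
  - split; [apply Cmod_ge_0|exact Ht].
  - intros z Hz; rewrite Cmod_mult, <- Rmult_1_r.
    apply Rmult_le_compat_l; [apply Cmod_ge_0|apply Hz]. }
assert (Hout : forall t, (Cmod t < 1)%R ->
  laurent_approx q (fun z => / P (q * (t * / z)))).
{ intros t Ht; apply laurent_approx_inv_qpoch_inf with (Cmod t); auto.
  - split; [apply Cmod_ge_0|exact Ht].
  - intros z Hz; rewrite !Cmod_mult, Cmod_R, Rabs_pos_eq by lra.
    assert (T := Cmod_inv_annulus q Hr z Hz).
    replace (Cmod t) with (q * (Cmod t * / q))%R at 2 by (field; lra).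
    apply Rmult_le_compat_l; [lra|].
    apply Rmult_le_compat_l; [apply Cmod_ge_0|exact T]. }
unfold rahman_cert.
repeat match goal with
| |- laurent_approx _ (fun z => / qpoch_inf (?t * z) _) => apply Hin; assumption
| |- laurent_approx _ (fun z => / qpoch_inf _ _) => apply Hout; assumption
| |- laurent_approx _ (fun z => / z) => apply Hinv
| |- laurent_approx _ (fun z => z) => apply Hid
| |- laurent_approx _ (fun _ => ?c) => apply Hc
| |- laurent_approx _ (fun z => @?f z * @?g z) => apply (Hm f g)
| |- laurent_approx _ (fun z => qpoch_inf (@?u z) _) => apply (HP u)
| |- laurent_approx _ (fun z => @?u z ^ 2) => apply (Hsq u)
end.
Qed.

(** Restricted to the circle, because the unshifted [t / z] may leave the unit disc once
    [|z| < 1]. *)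
Lemma rahman_weight_approx (t1 t2 t3 t4 t5 : C) :
  (Cmod t1 < 1)%R -> (Cmod t2 < 1)%R -> (Cmod t3 < 1)%R -> (Cmod t4 < 1)%R ->
  (Cmod t5 < 1)%R -> laurent_approx 1 (rahman_weight t1 t2 t3 t4 t5).
Proof.
intros H1 H2 H3 H4 H5.
assert (Hr : (0 < 1 <= 1)%R) by lra.
assert (Hid := laurent_approx_id 1); assert (Hinv := laurent_approx_inv 1).
assert (Hc := laurent_approx_const 1).
assert (Hm := laurent_approx_mult 1 Hr).
assert (HP : forall u, laurent_approx 1 u -> laurent_approx 1 (fun z => P (u z)))
  by (intros; now apply laurent_approx_qpoch_inf).
assert (Hsq : forall u, laurent_approx 1 u -> laurent_approx 1 (fun z => u z ^ 2)).
{ intros u Hu; apply laurent_approx_ext with (fun z => u z * u z); [intros; ring|auto]. }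
assert (Hin : forall t, (Cmod t < 1)%R -> laurent_approx 1 (fun z => / P (t * z))).
{ intros t Ht; apply laurent_approx_inv_qpoch_inf with (Cmod t); auto.
  - split; [apply Cmod_ge_0|exact Ht].
  - intros z [Hz1 Hz2]; rewrite Cmod_mult_unit; lra. }
assert (Hout : forall t, (Cmod t < 1)%R -> laurent_approx 1 (fun z => / P (t * / z))).
{ intros t Ht; apply laurent_approx_inv_qpoch_inf with (Cmod t); auto.
  - split; [apply Cmod_ge_0|exact Ht].
  - intros z [Hz1 Hz2]; rewrite Cmod_mult_unit; [lra|apply Cmod_inv_unit; lra]. }
unfold rahman_weight.
repeat match goal with
| |- laurent_approx _ (fun z => / qpoch_inf (?t * z) _) => apply Hin; assumption
| |- laurent_approx _ (fun z => / qpoch_inf _ _) => apply Hout; assumption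
| |- laurent_approx _ (fun z => / z) => apply Hinv
| |- laurent_approx _ (fun z => z) => apply Hid
| |- laurent_approx _ (fun _ => ?c) => apply Hc
| |- laurent_approx _ (fun z => @?f z * @?g z) => apply (Hm f g)
| |- laurent_approx _ (fun z => qpoch_inf (@?u z) _) => apply (HP u)
| |- laurent_approx _ (fun z => @?u z ^ 2) => apply (Hsq u)
end.
Qed.

(** The parameter factors are merely exchanged. The sign comes from the theta-like part
    [z P(z^2) P(q/z^2)], since [q z (1 - 1/(q z^2)) = - (1 - q z^2) / z]. *)
Lemma rahman_cert_shift (t1 t2 t3 t4 t5 z : C) : z <> 0 ->
  rahman_cert t1 t2 t3 t4 t5 (q * z) = - rahman_cert t1 t2 t3 t4 t5 (/ z).
Proof.
intros Hz; assert (Hq0 := q_neq0); unfold rahman_cert.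
replace (/ / z) with z by (field; exact Hz).
assert (E : forall t, q * (t * / (q * z)) = t * / z) by (intros; field; now split).
assert (E' : forall t, t * (q * z) = q * (t * z)) by (intros; ring).
rewrite !E, !E'.
replace (q * (/ (q * z)) ^ 2) with (/ (q * z ^ 2)) by (simpl; field; now split).
rewrite (qpoch_inf_Sl q Hq (/ (q * z ^ 2))), (qpoch_inf_Sl q Hq (q * z ^ 2)).
replace (q * / (q * z ^ 2)) with ((/ z) ^ 2) by (simpl; field; now split).
replace ((q * z) ^ 2) with (q * (q * z ^ 2)) by (simpl; ring).
set (X := / P _ * _ * _ * _ * _); set (Y := / P _ * _ * _ * _ * _).
field; split; assumption.
Qed.

Lemma rahman_cert_CInt (t1 t2 t3 t4 t5 : C) :
  (Cmod t1 < 1)%R -> (Cmod t2 < 1)%R -> (Cmod t3 < 1)%R -> (Cmod t4 < 1)%R ->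
  (Cmod t5 < 1)%R ->
  is_CInt (fun t => rahman_cert t1 t2 t3 t4 t5 (cis t)
    + rahman_cert t1 t2 t3 t4 t5 (/ cis t)) 0 PI 0.
Proof.
intros H1 H2 H3 H4 H5.
destruct (laurent_approx_CInt q ltac:(lra) _
  (rahman_cert_approx t1 t2 t3 t4 t5 H1 H2 H3 H4 H5)) as [I HI].
set (G := rahman_cert t1 t2 t3 t4 t5) in *.
assert (J1 : is_CInt (fun t => G (cis t)) (- PI) PI I).
{ eapply is_CInt_ext; [|apply (HI 1%R); lra]; intros t; simpl; now rewrite Cmult_1_l. }
assert (J2 : is_CInt (fun t => - (1) * G (cis (- t))) (- PI) PI I).
{ eapply is_CInt_ext; [|apply (HI q); lra].
  intros t; unfold G; rewrite rahman_cert_shift, cis_opp by apply cis_neq0; ring. }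
assert (J3 : is_CInt (fun t => - (1) * G (cis (- t))) (- PI) PI (- (1) * I)).
{ apply is_CInt_scal, (is_CInt_reflect (fun t => G (cis t))), J1. }
(* [J2] is the integral over [|z| = q] rewritten by the shift, [J3] minus the integral over
   [|z| = 1]; hence [I = - I]. *)
assert (E := is_CInt_unique _ _ _ _ _ J2 J3).
assert (E0 : I = 0).
{ replace I with ((I - - (1) * I) * / 2) by (field; apply RtoC_neq_0; lra).
  rewrite <- E; ring. }
rewrite E0 in J1; apply is_CInt_fold in J1.
eapply is_CInt_ext; [|exact J1]; intros t; simpl; now rewrite cis_opp.
Qed.

(** Records the ratio [c] of integral to claimed value, the quantity that the parameter shifts leave
    invariant. *)
Definition rahman_int (c t1 t2 t3 t4 t5 : C) : Prop :=
  is_CInt (fun t => rahman_weight t1 t2 t3 t4 t5 (cis t)) 0 PI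
    (c * rahman_value t1 t2 t3 t4 t5).

Lemma rahman_int_rot (c t1 t2 t3 t4 t5 : C) :
  rahman_int c t1 t2 t3 t4 t5 -> rahman_int c t2 t3 t4 t5 t1.
Proof.
unfold rahman_int; rewrite (rahman_value_rot t1); apply is_CInt_ext.
intros t; apply rahman_weight_rot.
Qed.

Lemma Cmod_q_mult (x : C) : (Cmod x < 1)%R -> (Cmod (q * x) < 1)%R.
Proof. intros H; apply Cmod_mult_lt1; [rewrite Cmod_R, Rabs_pos_eq; lra|exact H]. Qed.

Lemma rahman_int_shift (c t1 t2 t3 t4 t5 : C) :
  (Cmod t1 < 1)%R -> (Cmod t2 < 1)%R -> (Cmod t3 < 1)%R -> (Cmod t4 < 1)%R ->
  (Cmod t5 < 1)%R ->
  rahman_int c t1 t2 t3 t4 t5 -> rahman_int c (q * t1) t2 t3 t4 t5.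
Proof.
intros H1 H2 H3 H4 H5 H.
set (N1 := (1 - t1 * t3 * t4 * t5) * (1 - t1 * t2 * t4 * t5)
     * (1 - t1 * t2 * t3 * t5) * (1 - t1 * t2 * t3 * t4)).
set (N2 := (1 - t1 * t2) * (1 - t1 * t3) * (1 - t1 * t4) * (1 - t1 * t5)).
assert (A1 : 1 - t1 * t3 * t4 * t5 <> 0)
  by (apply one_minus_neq0; repeat apply Cmod_mult_lt1; assumption).
assert (A2 : 1 - t1 * t2 * t4 * t5 <> 0)
  by (apply one_minus_neq0; repeat apply Cmod_mult_lt1; assumption).
assert (A3 : 1 - t1 * t2 * t3 * t5 <> 0)
  by (apply one_minus_neq0; repeat apply Cmod_mult_lt1; assumption).
assert (A4 : 1 - t1 * t2 * t3 * t4 <> 0)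
  by (apply one_minus_neq0; repeat apply Cmod_mult_lt1; assumption).
assert (HN1 : N1 <> 0) by (repeat apply Cmult_neq_0; assumption).
assert (B : forall t, (Cmod t < 1)%R ->
  / P (t1 * t) = / (1 - t1 * t) * / P (q * (t1 * t)) /\ 1 - t1 * t <> 0).
{ intros t Ht; assert (T := Cmod_mult_lt1 t1 t H1 Ht).
  assert (T1 := one_minus_neq0 _ T); assert (T2 := Pq_neq0 _ T).
  rewrite (qpoch_inf_Sl q Hq (t1 * t)); split; [field; now split|exact T1]. }
unfold rahman_int.
(* The telescoper integrates to 0, so the shift multiplies the integral by [N2 / N1], and the
   claimed value changes by the same factor. *)
replace (c * rahman_value (q * t1) t2 t3 t4 t5)
  with (/ N1 * (N2 * (c * rahman_value t1 t2 t3 t4 t5)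
    + - (t1 * (1 - t1 * (t1 * t2 * t3 * t4 * t5))) * 0)).
- apply is_CInt_ext with (fun t =>
    / N1 * (N2 * rahman_weight t1 t2 t3 t4 t5 (cis t)
      + - (t1 * (1 - t1 * (t1 * t2 * t3 * t4 * t5)))
      * (rahman_cert t1 t2 t3 t4 t5 (cis t) + rahman_cert t1 t2 t3 t4 t5 (/ cis t)))).
  + intros t.
    assert (E := rahman_contiguous t1 t2 t3 t4 t5 (cis t) H1 H2 H3 H4 H5 (Cmod_cis t)).
    fold N1 N2 in E.
    transitivity (/ N1 * (rahman_weight (q * t1) t2 t3 t4 t5 (cis t) * N1)).
    * rewrite E; ring.
    * field; exact HN1.
  + apply is_CInt_scal, is_CInt_plus; apply is_CInt_scal; [exact H|].
    now apply rahman_cert_CInt.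
- destruct (B t2 H2) as [E2 M2]; destruct (B t3 H3) as [E3 M3];
  destruct (B t4 H4) as [E4 M4]; destruct (B t5 H5) as [E5 M5].
  unfold rahman_value; rewrite E2, E3, E4, E5.
  rewrite (qpoch_inf_Sl q Hq (t1 * t3 * t4 * t5)),
    (qpoch_inf_Sl q Hq (t1 * t2 * t4 * t5)),
    (qpoch_inf_Sl q Hq (t1 * t2 * t3 * t5)), (qpoch_inf_Sl q Hq (t1 * t2 * t3 * t4)).
  replace (q * t1 * t3 * t4 * t5) with (q * (t1 * t3 * t4 * t5)) by ring.
  replace (q * t1 * t2 * t4 * t5) with (q * (t1 * t2 * t4 * t5)) by ring.
  replace (q * t1 * t2 * t3 * t5) with (q * (t1 * t2 * t3 * t5)) by ring.
  replace (q * t1 * t2 * t3 * t4) with (q * (t1 * t2 * t3 * t4)) by ring.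
  replace (q * t1 * t2) with (q * (t1 * t2)) by ring.
  replace (q * t1 * t3) with (q * (t1 * t3)) by ring.
  replace (q * t1 * t4) with (q * (t1 * t4)) by ring.
  replace (q * t1 * t5) with (q * (t1 * t5)) by ring.
  unfold N1, N2; clear - A1 A2 A3 A4 M2 M3 M4 M5.
  repeat match goal with
    |- context [/ qpoch_inf ?x ?p] => generalize (/ qpoch_inf x p); intro end.
  repeat match goal with
    |- context [qpoch_inf ?x ?p] => generalize (qpoch_inf x p); intro end.
  revert A1 A2 A3 A4 M2 M3 M4 M5.
  generalize (1 - t1 * t3 * t4 * t5) (1 - t1 * t2 * t4 * t5)
   (1 - t1 * t2 * t3 * t5) (1 - t1 * t2 * t3 * t4)
   (1 - t1 * t2) (1 - t1 * t3) (1 - t1 * t4) (1 - t1 * t5).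
  intros; field; repeat split; assumption.
Qed.

Lemma rahman_int_scale (c t1 t2 t3 t4 t5 : C) (n : nat) :
  (Cmod t1 < 1)%R -> (Cmod t2 < 1)%R -> (Cmod t3 < 1)%R -> (Cmod t4 < 1)%R ->
  (Cmod t5 < 1)%R -> rahman_int c t1 t2 t3 t4 t5 ->
  rahman_int c (q ^ n * t1) (q ^ n * t2) (q ^ n * t3) (q ^ n * t4) (q ^ n * t5).
Proof.
intros H1 H2 H3 H4 H5 H.
assert (Hn : forall t k, (Cmod t < 1)%R -> (Cmod (q ^ k * t) < 1)%R).
{ intros t k Ht; rewrite Cmult_comm; eapply Rle_lt_trans; [|exact Ht].
  apply Cmod_mul_qpow_le, Hq. }
induction n as [|n IH].
- simpl; now rewrite !Cmult_1_l.
- rewrite Cpow_S, <- !Cmult_assoc.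
  (* Each round shifts the leading parameter and rotates; five rounds restore the order with all
     five shifted once. *)
  do 5 (apply rahman_int_rot, rahman_int_shift; auto using Cmod_q_mult).
Qed.

Lemma ucv1_qpoch_inf (x : nat -> C -> C) :
  (forall n z, Cmod z = 1%R -> (Cmod (x n z) <= q ^ n)%R) ->
  ucv1 (fun n z => P (x n z)).
Proof.
intros Hx eps He.
assert (HB : (0 < qbound q 1 / (1 - q))%R).
{ apply Rdiv_lt_0_compat; [apply qbound_pos|lra]. }
assert (Hl := lim0_scal (qbound q 1 / (1 - q)) _ (qpow_lim0 q Hq)).
destruct (proj1 (lim0_eps _ (fun n => Rmult_le_pos _ _ (Rlt_le _ _ HB)
  (Rlt_le _ _ (proj1 (qpow_bounds q Hq n))))) Hl eps He) as [N HN].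
exists N; intros n Hn z Hz; specialize (HN n Hn); specialize (Hx n z Hz).
assert (T := qpow_bounds q Hq n).
eapply Rle_lt_trans; [apply (qpoch_inf_near1 q Hq); lra|].
eapply Rle_lt_trans; [|exact HN].
apply Rmult_le_compat_l; lra.
Qed.

End Rahman.

(** * Determination of the constant in Rahman's integral *)

Section RahmanValue.

Variable q : R.
Hypothesis Hq : (0 < q < 1)%R.

Local Notation P x := (qpoch_inf x q).

(** Along [q^n t_j] the weight tends uniformly to [(z^2, z^-2; q)_oo] and the value to 1. Thus [c]
    is an integral without parameters, the same for every choice of the [t_j]. *)
Lemma rahman_int_0 (c t1 t2 t3 t4 t5 : C) :
  (Cmod t1 < 1)%R -> (Cmod t2 < 1)%R -> (Cmod t3 < 1)%R -> (Cmod t4 < 1)%R ->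
  (Cmod t5 < 1)%R -> rahman_int q c t1 t2 t3 t4 t5 ->
  is_CInt (fun t => P (cis t ^ 2) * P ((/ cis t) ^ 2)) 0 PI c.
Proof.
intros H1 H2 H3 H4 H5 H.
assert (Hb : forall t, (Cmod t < 1)%R -> forall n, (Cmod (q ^ n * t) <= q ^ n)%R).
{ intros t Ht n; rewrite Cmod_mult, (Cmod_qpow q Hq), <- Rmult_1_r.
  apply Rmult_le_compat_l; [apply Rlt_le, (qpow_bounds q Hq)|lra]. }
assert (Hb1 : forall x y n, (Cmod x <= q ^ n)%R -> (Cmod y <= q ^ n)%R ->
  (Cmod (x * y) <= q ^ n)%R).
{ intros x y n Hx Hy; rewrite Cmod_mult, <- Rmult_1_r.
  assert (T := qpow_bounds q Hq n).
  apply Rmult_le_compat; try apply Cmod_ge_0; lra. }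
set (rest := fun n z =>
  (P (q ^ n * t1 * (q ^ n * t2) * (q ^ n * t3) * (q ^ n * t4) * (q ^ n * t5) * z)
   * P (q ^ n * t1 * (q ^ n * t2) * (q ^ n * t3) * (q ^ n * t4) * (q ^ n * t5) * / z))
  * (/ P (q ^ n * t1 * z) * / P (q ^ n * t2 * z) * / P (q ^ n * t3 * z)
     * / P (q ^ n * t4 * z) * / P (q ^ n * t5 * z))
  * (/ P (q ^ n * t1 * / z) * / P (q ^ n * t2 * / z) * / P (q ^ n * t3 * / z)
     * / P (q ^ n * t4 * / z) * / P (q ^ n * t5 * / z))).
assert (Hrest : ucv1 rest).
{ unfold rest; repeat apply ucv1_mult; try apply ucv1_inv;
  apply (ucv1_qpoch_inf q Hq); intros n z Hz; assert (Hz' := Cmod_inv_unit z Hz);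
  rewrite Cmod_mult_unit by assumption; auto 10. }
(* The dummy argument [z] lets the closure properties of [ucv1] apply to a sequence of constants. *)
set (val := fun n (z : C) => rahman_value q (q ^ n * t1) (q ^ n * t2) (q ^ n * t3)
  (q ^ n * t4) (q ^ n * t5)).
assert (Hval : ucv1 val).
{ unfold val, rahman_value; repeat apply ucv1_mult; try apply ucv1_inv;
  apply (ucv1_qpoch_inf q Hq); intros n z Hz; auto 10. }
destruct (laurent_approx_bounded 1 ltac:(lra) (fun z => P (z ^ 2) * P ((/ z) ^ 2)))
  as [B [HB HBz]].
{ assert (Hm := laurent_approx_mult 1 ltac:(lra)).
  apply (Hm (fun z => P (z ^ 2)) (fun z => P ((/ z) ^ 2)));
    apply (laurent_approx_qpoch_inf 1 ltac:(lra) q Hq);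
    [apply laurent_approx_ext with (fun z => z * z)
    |apply laurent_approx_ext with (fun z => / z * / z)]; try (intros; ring);
    apply Hm; apply laurent_approx_id || apply laurent_approx_inv. }
destruct (is_CInt_ulim
  (fun n t => rahman_weight q (q ^ n * t1) (q ^ n * t2) (q ^ n * t3)
    (q ^ n * t4) (q ^ n * t5) (cis t))
  (fun t => P (cis t ^ 2) * P ((/ cis t) ^ 2)) 0 PI (fun n => c * val n 1))
  as [I [HI1 HI2]].
- intros n; exact (rahman_int_scale q Hq c t1 t2 t3 t4 t5 n H1 H2 H3 H4 H5 H).
- intros eps He.
  destruct (Hrest (eps / B)%R ltac:(now apply Rdiv_lt_0_compat)) as [N HN].
  exists N; intros n Hn t; specialize (HN n Hn (cis t) (Cmod_cis t)).
  replace (rahman_weight q _ _ _ _ _ _ - _)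
    with (P (cis t ^ 2) * P ((/ cis t) ^ 2) * (rest n (cis t) - 1))
    by (unfold rahman_weight, rest; ring).
  rewrite Cmod_mult.
  assert (HBt : (Cmod (P (cis t ^ 2) * P ((/ cis t) ^ 2)) <= B)%R).
  { apply HBz; unfold annulus; rewrite Cmod_cis; lra. }
  apply Rle_lt_trans with (B * Cmod (rest n (cis t) - 1))%R.
  + apply Rmult_le_compat_r; [apply Cmod_ge_0|exact HBt].
  + replace eps with (B * (eps / B))%R by (field; lra).
    now apply Rmult_lt_compat_l.
- replace c with I; [exact HI2|].
  assert (Hv : Ccv (fun n => val n 1) 1).
  { apply Ccv_eps; intros eps He.
    destruct (Hval eps He) as [N HN]; exists N; intros n Hn.
    apply HN; [exact Hn|apply Cmod_1]. }
  apply (Ccv_scal c) in Hv; rewrite Cmult_1_r in Hv.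
  exact (Ccv_unique _ _ _ HI1 Hv).
Qed.

Lemma is_CInt_one_minus_cis2 :
  is_CInt (fun t => (1 - cis t ^ 2) * (1 - (/ cis t) ^ 2)) 0 PI (RtoC (2 * PI)).
Proof.
apply is_CInt_ext with (fun t => RtoC (2 - 2 * cos (2 * t))).
- intros t.
  assert (Hc := cis_neq0 t).
  transitivity (2 - (cis (2 * t) + cis (- (2 * t)))).
  + unfold cis, Cminus, Cplus, Copp, RtoC; simpl.
    rewrite cos_neg, sin_neg; f_equal; ring.
  + rewrite cis_opp.
    replace (2 * t)%R with (INR 2 * t)%R by (simpl; ring).
    rewrite <- cis_pow; simpl; field; exact Hc.
- apply is_CInt_pair; simpl.
  + replace (2 * PI)%R
      with (minus (2 * PI - sin (2 * PI)) (2 * 0 - sin (2 * 0)))%R.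
    * apply (is_RInt_derive (fun t => 2 * t - sin (2 * t))%R
        (fun t => 2 - 2 * cos (2 * t))%R).
      -- intros t _; auto_derive; [trivial|ring].
      -- intros t _; apply continuity_pt_filterlim; reg.
    * unfold minus, plus, opp; simpl.
      rewrite sin_2PI, Rmult_0_r, sin_0; ring.
  + replace 0%R with (scal (PI - 0)%R 0%R) at 2
      by (unfold scal; simpl; unfold mult; simpl; ring).
    apply (@is_RInt_const R_NormedModule).
Qed.

(* [qpoch_inf_double] collapses the denominators at these parameters. *)
Lemma rahman_special : exists s : C, (Cmod s < 1)%R /\
  (forall z : C, z <> 0 -> Cmod z = 1%R ->
     rahman_weight q s (- s) q (- q) 0 z = (1 - z ^ 2) * (1 - (/ z) ^ 2))
  /\ rahman_value q s (- s) q (- q) 0 = P q.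
Proof.
assert (Hs0 : (0 < sqrt q < 1)%R).
{ split; [apply sqrt_lt_R0; lra|].
  rewrite <- sqrt_1; apply sqrt_lt_1; lra. }
set (s := RtoC (sqrt q)).
assert (Hs : (Cmod s < 1)%R) by (unfold s; rewrite Cmod_R, Rabs_pos_eq; lra).
assert (Hs2 : s ^ 2 = q).
{ unfold s; rewrite <- RtoC_pow; f_equal; rewrite pow2_sqrt; lra. }
assert (Hss : s * s = q) by (rewrite <- Hs2; ring).
assert (Hqm : (Cmod q < 1)%R) by (rewrite Cmod_R, Rabs_pos_eq; lra).
assert (Hd : forall z, P (q * z ^ 2)
  = P (s * z) * P (- (s * z)) * (P (q * z) * P (- (q * z)))).
{ intros z; now apply qpoch_inf_double. }
exists s; split; [exact Hs|split].
- intros z Hz0 Hz.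
  assert (Hz' := Cmod_inv_unit z Hz).
  assert (Hn : forall t u, (Cmod t < 1)%R -> Cmod u = 1%R -> P (t * u) <> 0).
  { intros t u Ht Hu; apply qpoch_inf_neq0; [exact Hq|now rewrite Cmod_mult_unit]. }
  assert (Hopp : forall t, (Cmod t < 1)%R -> (Cmod (- t) < 1)%R)
    by (intros; now rewrite Cmod_opp).
  unfold rahman_weight.
  (* The fifth parameter 0 makes [f = 0], which turns the numerator products into 1. *)
  replace (s * - s * q * - q * 0 * z) with (RtoC 0) by ring.
  replace (s * - s * q * - q * 0 * / z) with (RtoC 0) by ring.
  rewrite !Cmult_0_l, (qpoch_inf_0 q Hq).
  rewrite (qpoch_inf_Sl q Hq (z ^ 2)), (qpoch_inf_Sl q Hq ((/ z) ^ 2)), !Hd.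
  assert (Hmo : forall x y : C, - (x * y) = - x * y) by (intros; ring).
  rewrite !Hmo.
  assert (A1 := Hn s z Hs Hz); assert (A2 := Hn (- s) z (Hopp _ Hs) Hz).
  assert (A3 := Hn q z Hqm Hz); assert (A4 := Hn (- q) z (Hopp _ Hqm) Hz).
  assert (B1 := Hn s _ Hs Hz'); assert (B2 := Hn (- s) _ (Hopp _ Hs) Hz').
  assert (B3 := Hn q _ Hqm Hz'); assert (B4 := Hn (- q) _ (Hopp _ Hqm) Hz').
  revert A1 A2 A3 A4 B1 B2 B3 B4.
  generalize (P (s * z)) (P (- s * z)) (P (q * z)) (P (- q * z))
    (P (s * / z)) (P (- s * / z)) (P (q * / z)) (P (- q * / z)).
  generalize (1 - z ^ 2) (1 - (/ z) ^ 2).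
  intros; field; repeat split; assumption.
- unfold rahman_value.
  rewrite !Cmult_0_r, (qpoch_inf_0 q Hq).
  replace (s * - s * q * - q) with (q * (q * q))
    by (transitivity (s * s * q * q); [rewrite Hss|]; ring).
  replace (s * - s) with (- (q)) by (rewrite <- Hss; ring).
  replace (- s * q) with (- (s * q)) by ring.
  replace (s * - q) with (- (s * q)) by ring.
  replace (- s * - q) with (s * q) by ring.
  replace (q * - q) with (- (q * q)) by ring.
  assert (Hsq : (Cmod (s * q) < 1)%R) by now apply Cmod_mult_lt1.
  assert (Hqq : (Cmod (q * q) < 1)%R) by now apply Cmod_mult_lt1.
  assert (N1 := qpoch_inf_neq0 q Hq _ Hsq).
  assert (N2 := qpoch_inf_neq0 q Hq _ Hqq).
  assert (N3 := qpoch_inf_neq0 q Hq _ Hqm).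
  rewrite <- Cmod_opp in Hsq, Hqq, Hqm.
  assert (M1 := qpoch_inf_neq0 q Hq _ Hsq).
  assert (M2 := qpoch_inf_neq0 q Hq _ Hqq).
  assert (M3 := qpoch_inf_neq0 q Hq _ Hqm).
  (* [E1] and [E2] are [qpoch_inf_double] at [x = s] and at [x = 1]. *)
  assert (E1 : P (q * q) = P q * P (- (q)) * (P (s * q) * P (- (s * q)))).
  { rewrite <- Hs2 at 2; rewrite Hd, Hss, !(Cmult_comm q s); reflexivity. }
  assert (E2 : P q = (1 - s) * P (s * q) * ((1 - - s) * P (- (s * q)))
     * (P q * ((1 - - (q)) * P (- (q * q))))).
  { assert (E := Hd 1).
    replace (q * 1 ^ 2) with (RtoC q) in E by ring.
    rewrite !Cmult_1_r in E; rewrite E at 1.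
    rewrite (qpoch_inf_Sl q Hq s), (qpoch_inf_Sl q Hq (- s)), (qpoch_inf_Sl q Hq (- (q))).
    replace (q * - s) with (- (s * q)) by ring.
    replace (q * - (q)) with (- (q * q)) by ring.
    now rewrite (Cmult_comm q s). }
  (* Euler's identity [(q; q^2)_oo (-q; q)_oo = 1], obtained by cancelling [P q] from [E2]. *)
  assert (E3 : (1 - q * q) * (P (s * q) * P (- (s * q)) * P (- (q * q))) = 1).
  { transitivity (P q * / P q); [|now apply Cinv_r].
    rewrite E2 at 1.
    transitivity ((1 - s * s) * (1 - - (q)) * (P (s * q) * P (- (s * q))
      * P (- (q * q))) * (P q * / P q)); [|ring].
    rewrite Hss, Cinv_r by exact N3; ring. }
  assert (E4 : P (q * q) = (1 - q * q) * P (q * (q * q))) by apply (qpoch_inf_Sl q Hq).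
  assert (N4 : 1 - q * q <> 0).
  { apply one_minus_neq0; now apply Cmod_mult_lt1; rewrite <- Cmod_opp. }
  replace (P (q * (q * q))) with (P (q * q) / (1 - q * q)) by (rewrite E4; field; exact N4).
  rewrite E1.
  replace (P (- (q * q))) with (/ ((1 - q * q) * (P (s * q) * P (- (s * q))))).
  + field; repeat split; assumption.
  + transitivity (/ ((1 - q * q) * (P (s * q) * P (- (s * q))))
      * ((1 - q * q) * (P (s * q) * P (- (s * q)) * P (- (q * q))))).
    * rewrite E3; ring.
    * field; repeat split; assumption.
Qed.

Lemma rahman_value_neq0 (t1 t2 t3 t4 t5 : C) :
  (Cmod t1 < 1)%R -> (Cmod t2 < 1)%R -> (Cmod t3 < 1)%R -> (Cmod t4 < 1)%R ->
  (Cmod t5 < 1)%R -> rahman_value q t1 t2 t3 t4 t5 <> 0.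
Proof.
intros H1 H2 H3 H4 H5.
assert (Hinv : forall x : C, x <> 0 -> / x <> 0).
{ intros x Hx E; assert (T : x * / x = 1) by now apply Cinv_r.
  rewrite E, Cmult_0_r in T; injection T; lra. }
unfold rahman_value; repeat apply Cmult_neq_0; try apply Hinv;
  apply (qpoch_inf_neq0 q Hq); repeat apply Cmod_mult_lt1; assumption.
Qed.

Theorem rahman_integral (t1 t2 t3 t4 t5 : C) :
  (Cmod t1 < 1)%R -> (Cmod t2 < 1)%R -> (Cmod t3 < 1)%R -> (Cmod t4 < 1)%R ->
  (Cmod t5 < 1)%R ->
  is_CInt (fun t => rahman_weight q t1 t2 t3 t4 t5 (cis t)) 0 PI
    (RtoC (2 * PI) / P q * rahman_value q t1 t2 t3 t4 t5).
Proof.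
intros H1 H2 H3 H4 H5; assert (Hpi := PI_RGT_0).
assert (Hqm : (Cmod q < 1)%R) by (rewrite Cmod_R, Rabs_pos_eq; lra).
assert (HPq := qpoch_inf_neq0 q Hq _ Hqm).
destruct (laurent_approx_CInt 1 ltac:(lra) _
  (rahman_weight_approx q Hq t1 t2 t3 t4 t5 H1 H2 H3 H4 H5)) as [I HI].
specialize (HI 1%R ltac:(lra)).
destruct (ex_CInt_sub _ (- PI) 0 PI I ltac:(lra) HI) as [l Hl].
assert (HR := rahman_value_neq0 t1 t2 t3 t4 t5 H1 H2 H3 H4 H5).
(* The ratio is available because the weight is integrable and the claimed value nonzero; uniqueness
   of the limit integral then identifies it with the constant of the special case. *)
set (c := l / rahman_value q t1 t2 t3 t4 t5).
assert (Hc : rahman_int q c t1 t2 t3 t4 t5).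
{ unfold rahman_int, c.
  replace (l / _ * _) with l by (field; exact HR).
  eapply is_CInt_ext; [|exact Hl]; intros t; simpl; now rewrite Cmult_1_l. }
destruct rahman_special as [s [Hs [Hsw Hsv]]].
assert (Hsp : rahman_int q (RtoC (2 * PI) / P q) s (- s) q (- q) 0).
{ unfold rahman_int; rewrite Hsv.
  replace (_ / P q * P q) with (RtoC (2 * PI)) by (field; exact HPq).
  eapply is_CInt_ext; [|apply is_CInt_one_minus_cis2].
  intros t; symmetry; exact (Hsw (cis t) (cis_neq0 t) (Cmod_cis t)). }
apply rahman_int_0 in Hsp; try assumption; try (rewrite Cmod_opp; assumption);
  [|rewrite Cmod_0; lra].
assert (Hc0 := rahman_int_0 c t1 t2 t3 t4 t5 H1 H2 H3 H4 H5 Hc).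
now rewrite <- (is_CInt_unique _ _ _ _ _ Hc0 Hsp).
Qed.

End RahmanValue.

(** * The q-Gauss sum *)

Section QGauss.

Variable q : R.
Hypothesis Hq : (0 < q < 1)%R.

Local Notation P x := (qpoch_inf x q).

(** The terms of 2phi1(x, y; c; q, c/(xy)), parametrized by the argument [w = c/(xy)] rather than by
    [c], so that [x] and [y] may be 0. *)
Definition gauss_term (x y w : C) (n : nat) : C :=
  qpoch x q n * qpoch y q n * w ^ n / (qpoch q q n * qpoch (x * y * w) q n).

Section FixedArguments.

Variables x y : C.
Hypothesis Hx : (Cmod x <= 1)%R.
Hypothesis Hy : (Cmod y <= 1)%R.

Lemma Cmod_q_lt1 : (Cmod q < 1)%R.
Proof. rewrite Cmod_R, Rabs_pos_eq; lra. Qed.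

Lemma Cmod_xyw_le (w : C) : (Cmod (x * y * w) <= Cmod w)%R.
Proof.
rewrite !Cmod_mult; apply Rle_trans with (1 * Cmod w)%R; [|lra].
apply Rmult_le_compat_r; [apply Cmod_ge_0|].
rewrite <- (Rmult_1_l 1); apply Rmult_le_compat; auto; apply Cmod_ge_0.
Qed.

Lemma gauss_term_bound (rho : R) : (0 <= rho < 1)%R ->
  exists K : R, (0 < K)%R /\ forall w n, (Cmod w <= rho)%R ->
    (Cmod (gauss_term x y w n) <= K * Cmod w ^ n)%R.
Proof.
intros Hr.
(* One radius for both denominators, [(q; q)_n] and [(x y w; q)_n]. *)
set (r := Rmax q rho).
assert (Hr' : (0 <= r < 1)%R).
{ split; [apply Rle_trans with rho; [lra|apply Rmax_r]|apply Rmax_lub_lt; lra]. }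
destruct (qpoch_lower q Hq r Hr') as [m [Hm Hlow]].
assert (HB := qbound_pos q 1).
exists (qbound q 1 * qbound q 1 / (m * m))%R; split.
- apply Rdiv_lt_0_compat; now apply Rmult_lt_0_compat.
- intros w n Hw; unfold gauss_term.
  assert (L1 : (m <= Cmod (qpoch q q n))%R).
  { apply Hlow; rewrite Cmod_R, Rabs_pos_eq by lra; apply Rmax_l. }
  assert (L2 : (m <= Cmod (qpoch (x * y * w) q n))%R).
  { apply Hlow; eapply Rle_trans; [apply Cmod_xyw_le|].
    eapply Rle_trans; [exact Hw|apply Rmax_r]. }
  assert (N1 : qpoch q q n <> 0) by (apply Cmod_gt_0; lra).
  assert (N2 : qpoch (x * y * w) q n <> 0) by (apply Cmod_gt_0; lra).
  rewrite Cmod_div, !Cmod_mult, Cmod_pow by now apply Cmult_neq_0.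
  replace (qbound q 1 * qbound q 1 / (m * m) * Cmod w ^ n)%R
    with (qbound q 1 * qbound q 1 * Cmod w ^ n / (m * m))%R
    by (field; apply Rgt_not_eq; exact Hm).
  assert (Hb : forall v, (Cmod v <= 1)%R -> (Cmod (qpoch v q n) <= qbound q 1)%R).
  { intros v Hv; eapply Rle_trans; [apply (qpoch_bound q Hq)|now apply qbound_incr]. }
  assert (Hp : (0 <= Cmod w ^ n)%R) by apply pow_le, Cmod_ge_0.
  apply Rmult_le_compat.
  + repeat apply Rmult_le_pos; try apply Cmod_ge_0; exact Hp.
  + apply Rlt_le, Rinv_0_lt_compat, Rmult_lt_0_compat; lra.
  + apply Rmult_le_compat_r; [exact Hp|].
    apply Rmult_le_compat; auto; apply Cmod_ge_0.
  + apply Rinv_le_contravar; [now apply Rmult_lt_0_compat|].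
    apply Rmult_le_compat; lra.
Qed.

Lemma gauss_term_cv (w : C) : (Cmod w < 1)%R ->
  Ccv (sum_n (gauss_term x y w)) (C_series (gauss_term x y w)).
Proof.
intros Hw; apply ex_series_Ccv.
destruct (gauss_term_bound (Cmod w)) as [K [HK HB]]; [split; [apply Cmod_ge_0|exact Hw]|].
apply ex_series_dominated with (fun n => K * Cmod w ^ n)%R.
- intros n; apply HB; lra.
- apply (ex_series_scal_l K (fun n => Cmod w ^ n)%R), ex_series_geom.
  rewrite Rabs_pos_eq; [exact Hw|apply Cmod_ge_0].
Qed.

(** The term of index 0 is 1 and the others are dominated by a geometric series starting at [K |w|].
    This fixes the limit of the iteration [w -> q w]. *)
Lemma gauss_term_near1 (rho : R) : (0 <= rho < 1)%R ->
  exists K : R, (0 < K)%R /\ forall w, (Cmod w <= rho)%R ->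
    (Cmod (C_series (gauss_term x y w) - 1) <= K * Cmod w)%R.
Proof.
intros Hr; destruct (gauss_term_bound rho Hr) as [K [HK HB]].
exists (K / (1 - rho))%R; split; [apply Rdiv_lt_0_compat; lra|].
intros w Hw; assert (Hw0 := Cmod_ge_0 w).
apply (Ccv_le _ _ _ _ 0) with (2 := gauss_term_cv w ltac:(lra)).
intros n _.
apply Rle_trans with (K * Cmod w * ((1 - Cmod w ^ n) / (1 - Cmod w)))%R.
- induction n as [|n IH].
  + rewrite sum_O; unfold gauss_term; simpl.
    replace (1 * 1 * 1 / (1 * 1) - 1) with (RtoC 0) by field.
    rewrite Cmod_0; right; field; lra.
  + rewrite sum_Sn; unfold plus; simpl.
    replace (sum_n (gauss_term x y w) n + gauss_term x y w (S n) - 1)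
      with ((sum_n (gauss_term x y w) n - 1) + gauss_term x y w (S n)) by ring.
    eapply Rle_trans; [apply Cmod_triangle|].
    eapply Rle_trans; [apply Rplus_le_compat; [exact IH|apply HB, Hw]|].
    right; simpl; field; lra.
- replace (K / (1 - rho) * Cmod w)%R with (K * Cmod w * (1 / (1 - rho)))%R
    by (field; lra).
  apply Rmult_le_compat_l; [apply Rmult_le_pos; lra|].
  assert (0 <= Cmod w ^ n)%R by (apply pow_le; lra).
  assert (Cmod w ^ n <= 1)%R by (rewrite <- (pow1 n); apply pow_incr; lra).
  apply Rmult_le_compat; try lra.
  + apply Rlt_le, Rinv_0_lt_compat; lra.
  + apply Rinv_le_contravar; lra.
Qed.

(** Finite form of the functional equation under [w -> q w], in which the denominator parameter
    moves along with the argument. The right side is the boundary term of a telescoping sum and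
    tends to 0. *)
Lemma gauss_telescope (w : C) (N : nat) : (Cmod w < 1)%R ->
  (1 - w) * (1 - x * y * w) * sum_n (gauss_term x y w) N
  - (1 - x * w) * (1 - y * w) * sum_n (gauss_term x y (q * w)) N
  = - ((1 - x * y * w) * (1 - q ^ S N) * gauss_term x y w (S N)).
Proof.
intros Hw.
assert (Hc : (Cmod (x * y * w) < 1)%R) by (eapply Rle_lt_trans; [apply Cmod_xyw_le|exact Hw]).
assert (Hqn : forall n, 1 - q ^ S n <> 0).
{ intros n; apply one_minus_neq0; rewrite Cpow_S, Cmod_mult, Cmod_R, Rabs_pos_eq by lra.
  rewrite (Cmod_qpow q Hq); assert (T := qpow_bounds q Hq n); nra. }
assert (Hcn : forall n, 1 - x * y * w * q ^ n <> 0).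
{ intros n; apply one_minus_neq0; eapply Rle_lt_trans; [|exact Hc].
  apply Cmod_mul_qpow_le, Hq. }
assert (Hnz1 : forall n, qpoch q q n <> 0) by (intros; apply qpoch_neq0, Cmod_q_lt1; exact Hq).
assert (Hnz2 : forall n, qpoch (x * y * w) q n <> 0) by (intros; now apply qpoch_neq0).
assert (Hc0 : 1 - x * y * w <> 0) by now apply one_minus_neq0.
assert (Hshift : forall n, gauss_term x y (q * w) n
   = gauss_term x y w n * (q ^ n * (1 - x * y * w) / (1 - x * y * w * q ^ n))).
{ intros n; unfold gauss_term.
  assert (E := qpoch_Sl (x * y * w) q n); rewrite qpoch_S in E.
  replace (x * y * (q * w)) with (q * (x * y * w)) by ring.
  replace (qpoch (q * (x * y * w)) q n)
    with (qpoch (x * y * w) q n * (1 - x * y * w * q ^ n) / (1 - x * y * w))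
    by (rewrite E; field; exact Hc0).
  rewrite Cpow_mult_l; field; repeat split; auto. }
assert (Hnext : forall n, gauss_term x y w (S n) = gauss_term x y w n
   * ((1 - x * q ^ n) * (1 - y * q ^ n) * w / ((1 - q ^ S n) * (1 - x * y * w * q ^ n)))).
{ intros n; unfold gauss_term; rewrite !qpoch_S, (Cpow_S w), <- (Cpow_S q n).
  field; repeat split; auto. }
induction N as [|N IH].
- rewrite !sum_O, Hshift, Hnext.
  specialize (Hqn 0%nat); specialize (Hcn 0%nat).
  simpl in *; rewrite Cmult_1_r in *.
  field; repeat split; auto.
- rewrite !sum_n_CS.
  transitivity (((1 - w) * (1 - x * y * w) * sum_n (gauss_term x y w) N
    - (1 - x * w) * (1 - y * w) * sum_n (gauss_term x y (q * w)) N)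
    + ((1 - w) * (1 - x * y * w) * gauss_term x y w (S N)
    - (1 - x * w) * (1 - y * w) * gauss_term x y (q * w) (S N))); [ring|].
  rewrite IH, Hshift, (Hnext (S N)).
  specialize (Hqn (S N)); specialize (Hcn (S N)).
  rewrite (Cpow_S q (S N)) in Hqn |- *; clear IH.
  generalize dependent (q ^ S N); intros X H1 H2.
  field; repeat split; auto.
Qed.

Lemma gauss_functional (w : C) : (Cmod w < 1)%R ->
  (1 - w) * (1 - x * y * w) * C_series (gauss_term x y w)
  = (1 - x * w) * (1 - y * w) * C_series (gauss_term x y (q * w)).
Proof.
intros Hw.
assert (Hqw : (Cmod (q * w) < 1)%R) by now apply Cmod_q_mult.
destruct (gauss_term_bound (Cmod w)) as [K [HK HB]]; [split; [apply Cmod_ge_0|exact Hw]|].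
assert (H0 : Ccv (gauss_term x y w) 0).
{ apply Ccv_squeeze with (fun n => K * Cmod w ^ n)%R.
  - intros n; replace (gauss_term x y w n - 0) with (gauss_term x y w n) by ring.
    apply HB; lra.
  - apply lim0_scal, is_lim_seq_geom; rewrite Rabs_pos_eq; [exact Hw|apply Cmod_ge_0]. }
assert (H1 := Ccv_plus _ _ _ _
  (Ccv_scal ((1 - w) * (1 - x * y * w)) _ _ (gauss_term_cv w Hw))
  (Ccv_scal (- ((1 - x * w) * (1 - y * w))) _ _ (gauss_term_cv (q * w) Hqw))).
assert (H2 : Ccv (fun n => - ((1 - x * y * w) * (1 - q ^ S n) * gauss_term x y w (S n))) 0).
{ assert (Hqc : Ccv (fun n => q ^ n) 0).
  { apply Ccv_squeeze with (fun n => q ^ n)%R; [|apply qpow_lim0, Hq].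
    intros n; replace (q ^ n - 0) with (q ^ n) by ring; rewrite (Cmod_qpow q Hq); lra. }
  assert (T := Ccv_scal (- (1 - x * y * w)) _ _ (Ccv_mult _ _ _ _
    (Ccv_plus _ _ _ _ (Ccv_const 1) (Ccv_scal (- (1)) _ _ Hqc)) H0)).
  apply (Ccv_subseq _ _ S) in T; [|lia].
  replace (- (1 - x * y * w) * ((1 + - (1) * 0) * 0)) with (RtoC 0) in T by ring.
  eapply Ccv_ext; [|exact T]; intros n; simpl; ring. }
assert (E : (1 - w) * (1 - x * y * w) * C_series (gauss_term x y w)
  + - ((1 - x * w) * (1 - y * w)) * C_series (gauss_term x y (q * w)) = 0).
{ apply (Ccv_unique _ _ _ H1).
  eapply Ccv_ext; [|exact H2].
  intros n; cbv beta; rewrite <- (gauss_telescope w n Hw); ring. }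
set (l := (1 - w) * _ * _) in *.
transitivity (l + - ((1 - x * w) * (1 - y * w)) * C_series (gauss_term x y (q * w))
  + (1 - x * w) * (1 - y * w) * C_series (gauss_term x y (q * w))); [ring|].
rewrite E; ring.
Qed.

(** Iterating the functional equation moves [w] to [w q^N], where the sum tends to 1, while the
    accumulated factors become the four infinite products. *)
Theorem q_gauss (w : C) : (Cmod w < 1)%R ->
  Ccv (sum_n (gauss_term x y w)) (P (x * w) * P (y * w) / (P (x * y * w) * P w)).
Proof.
intros Hw.
assert (Hc : forall v, (Cmod v < 1)%R -> (Cmod (x * y * v) < 1)%R)
  by (intros v Hv; eapply Rle_lt_trans; [apply Cmod_xyw_le|exact Hv]).
assert (Hqw : forall n, (Cmod (w * q ^ n) < 1)%R)
  by (intros n; eapply Rle_lt_trans; [apply Cmod_mul_qpow_le, Hq|exact Hw]).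
set (F := fun v => C_series (gauss_term x y v)).
assert (Hit : forall N, qpoch w q N * qpoch (x * y * w) q N * F w
  = qpoch (x * w) q N * qpoch (y * w) q N * F (w * q ^ N)).
{ induction N as [|N IH]; [simpl; now rewrite !Cmult_1_l, Cmult_1_r|].
  rewrite !qpoch_S.
  assert (E := gauss_functional (w * q ^ N) (Hqw N)); fold (F (w * q ^ N)) in E.
  replace (q * (w * q ^ N)) with (w * q ^ S N) in E by (simpl; ring).
  fold (F (w * q ^ S N)) in E.
  transitivity ((1 - w * q ^ N) * (1 - x * y * (w * q ^ N))
    * (qpoch w q N * qpoch (x * y * w) q N * F w)); [ring|].
  rewrite IH.
  transitivity (qpoch (x * w) q N * qpoch (y * w) q N
    * ((1 - w * q ^ N) * (1 - x * y * (w * q ^ N)) * F (w * q ^ N))); [ring|].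
  rewrite E; ring. }
assert (HF : Ccv (fun N => F (w * q ^ N)) 1).
{ destruct (gauss_term_near1 (Cmod w)) as [K [HK HB]]; [split; [apply Cmod_ge_0|exact Hw]|].
  apply Ccv_squeeze with (fun n => K * q ^ n)%R; [|apply lim0_scal, qpow_lim0, Hq].
  intros n; eapply Rle_trans; [apply HB, Cmod_mul_qpow_le, Hq|].
  apply Rmult_le_compat_l; [lra|].
  rewrite Cmod_mult, (Cmod_qpow q Hq).
  rewrite <- (Rmult_1_l (q ^ n)) at 2; apply Rmult_le_compat_r; [|lra].
  apply Rlt_le, (qpow_bounds q Hq). }
assert (H1 := Ccv_mult _ _ _ _ (Ccv_mult _ _ _ _ (qpoch_cv q Hq w)
  (qpoch_cv q Hq (x * y * w))) (Ccv_const (F w))).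
assert (H2 := Ccv_mult _ _ _ _ (Ccv_mult _ _ _ _ (qpoch_cv q Hq (x * w))
  (qpoch_cv q Hq (y * w))) HF).
assert (E := Ccv_unique _ _ _ (Ccv_ext _ _ _ Hit H1) H2).
assert (N1 := qpoch_inf_neq0 q Hq _ Hw); assert (N2 := qpoch_inf_neq0 q Hq _ (Hc w Hw)).
replace (P (x * w) * P (y * w) / (P (x * y * w) * P w)) with (F w).
- now apply gauss_term_cv.
- rewrite Cmult_1_r in E; rewrite <- E; field; now split.
Qed.

End FixedArguments.

End QGauss.

(** * A Bailey pair *)

Section BaileyPair.

Variable q : R.
Hypothesis Hq : (0 < q < 1)%R.

(** The usual convention [1/(q; q)_(n-k) = 0] for [k > n], which truncated subtraction alone would
    turn into 1. *)
Definition inv_qfact (n k : nat) : C :=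
  if (k <=? n)%nat then / qpoch q q (n - k) else 0.

Lemma qpoch_qq_neq0 (n : nat) : qpoch q q n <> 0.
Proof. apply qpoch_neq0; [exact Hq|apply Cmod_q_lt1, Hq]. Qed.

Lemma qpow_neq0 (n : nat) : q ^ n <> 0.
Proof. apply Cpow_nz, q_neq0, Hq. Qed.

Lemma one_minus_qpow_neq0 (n : nat) : 1 - q * q ^ n <> 0.
Proof.
apply one_minus_neq0; rewrite Cmod_mult, (Cmod_qpow q Hq), Cmod_R, Rabs_pos_eq by lra.
assert (T := qpow_bounds q Hq n); nra.
Qed.

(** This recurrence and the next are multiplied out so as to survive the boundary: at [k = n + 1],
    respectively [k = n], both sides vanish. *)
Lemma inv_qfact_Sl (n k : nat) :
  (q ^ k - q * q ^ n) * inv_qfact (S n) k = q ^ k * inv_qfact n k.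
Proof.
unfold inv_qfact.
destruct (Nat.leb_spec k (S n)) as [H|H]; destruct (Nat.leb_spec k n) as [H'|H'].
- replace (S n - k)%nat with (S (n - k)) by lia; rewrite qpoch_S.
  replace (q ^ n) with (q ^ (n - k) * q ^ k) by (rewrite <- Cpow_add_r; f_equal; lia).
  assert (T1 := qpoch_qq_neq0 (n - k)); assert (T2 := one_minus_qpow_neq0 (n - k)).
  field; now split.
- replace k with (S n) by lia; rewrite Cpow_S; ring.
- lia.
- ring.
Qed.

Lemma inv_qfact_Sr (n k : nat) :
  q ^ k * inv_qfact n (S k) = (q ^ k - q ^ n) * inv_qfact n k.
Proof.
unfold inv_qfact.
destruct (Nat.leb_spec (S k) n) as [H|H]; destruct (Nat.leb_spec k n) as [H'|H'].
- replace (n - k)%nat with (S (n - S k)) by lia; rewrite qpoch_S.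
  replace (q ^ n) with (q * q ^ (n - S k) * q ^ k)
    by (rewrite <- Cpow_S, <- Cpow_add_r; f_equal; lia).
  assert (T1 := qpoch_qq_neq0 (n - S k)); assert (T2 := one_minus_qpow_neq0 (n - S k)).
  field; now split.
- lia.
- replace k with n by lia; ring.
- ring.
Qed.

Variable alpha : C.
Hypothesis Halpha : (Cmod (q * alpha) < 1)%R.

(** The member of index [2m] of the Bailey pair; it is also the summand of the theorem without the
    factors depending on [a, b, c, d, r] separately from [alpha]. *)
Definition bailey_coef (m : nat) : C :=
  wp_factor alpha q m * qpoch q (q ^ 2)%R m
  / (qpoch q q (2 * m) * qpoch (q * alpha) (q ^ 2)%R m)
  * (- alpha) ^ m * q ^ (3 * m ^ 2 - m).

Lemma q2_bounds : (0 < q ^ 2 < 1)%R.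
Proof. simpl; nra. Qed.

Lemma qpoch_qa_neq0 (n : nat) : qpoch (q * alpha) q n <> 0.
Proof. now apply qpoch_neq0. Qed.

Lemma qpoch_qa2_neq0 (n : nat) : qpoch (q * alpha) (q ^ 2)%R n <> 0.
Proof. apply qpoch_neq0; [exact q2_bounds|exact Halpha]. Qed.

(* [bailey_coef (m+1)] stripped of the factor [1 - alpha q^(4m+4)], which may
   vanish while the WZ certificate below has it in its denominator. *)
Definition bailey_coef' (m : nat) : C :=
  qpoch (q * alpha) q (2 * m + 1) * qpoch q (q ^ 2)%R (S m)
  / (qpoch q q (2 * m + 2) * qpoch (q * alpha) (q ^ 2)%R (S m))
  * (- alpha) ^ S m * q ^ (3 * S m ^ 2 - S m).

Lemma bailey_coef_S (m : nat) :
  bailey_coef (S m) = (1 - alpha * (q ^ (2 * m + 2)) ^ 2) * bailey_coef' m.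
Proof.
unfold bailey_coef, bailey_coef'; rewrite wp_factorE.
replace (2 * S m - 1)%nat with (2 * m + 1)%nat by lia.
replace (4 * S m)%nat with ((2 * m + 2) * 2)%nat by lia.
replace (2 * S m)%nat with (2 * m + 2)%nat by lia.
rewrite Cpow_mult_r; unfold Cdiv; ring.
Qed.

Lemma bailey_coef_0 : bailey_coef 0 = 1.
Proof. unfold bailey_coef; rewrite wp_factorE; simpl; field. Qed.

Lemma bailey_coef'_0 : (1 - q ^ 2) * bailey_coef' 0 = - alpha * q ^ 2.
Proof.
unfold bailey_coef'; simpl.
assert (T1 := one_minus_qpow_neq0 0); assert (T2 := one_minus_qpow_neq0 1).
assert (T3 := one_minus_neq0 _ Halpha); simpl in T1, T2.
rewrite Cmult_1_r in T1; rewrite !Cmult_1_r, Cmult_1_l in *.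
field; repeat split; assumption.
Qed.

Lemma Cpow_q2 (m : nat) : RtoC (q ^ 2) ^ m = q ^ (2 * m).
Proof. now rewrite RtoC_pow, <- Cpow_mult_r. Qed.

Lemma bailey_coef'_S (m : nat) :
  (1 - q ^ 2 * q ^ (2 * m + 2)) * bailey_coef' (S m)
  = (1 - alpha * q ^ (2 * m + 2)) * (- alpha) * q ^ 2 * (q ^ (2 * m + 2)) ^ 3
    * bailey_coef' m.
Proof.
unfold bailey_coef'.
replace (2 * S m + 1)%nat with (S (S (2 * m + 1))) by lia.
replace (2 * S m + 2)%nat with (S (S (2 * m + 2))) by lia.
(* The exponent grows by [6m + 8 = 2 + 3 (2m + 2)]. *)
replace (3 * S (S m) ^ 2 - S (S m))%nat
  with (2 + (2 * m + 2) * 3 + (3 * S m ^ 2 - S m))%nat by (simpl; nia).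
rewrite (Cpow_add_r q (2 + (2 * m + 2) * 3)), (Cpow_add_r q 2 ((2 * m + 2) * 3)),
  (Cpow_mult_r q (2 * m + 2) 3).
rewrite (qpoch_S q (q ^ 2)%R (S m)), (qpoch_S (q * alpha) (q ^ 2)%R (S m)).
rewrite (qpoch_S _ _ (S (2 * m + 1))), (qpoch_S _ _ (2 * m + 1)),
  (qpoch_S _ _ (S (2 * m + 2))), (qpoch_S _ _ (2 * m + 2)).
rewrite Cpow_q2, (Cpow_S (- alpha) (S m)).
replace (S (2 * m + 1))%nat with (2 * m + 2)%nat by lia.
replace (2 * S m)%nat with (2 * m + 2)%nat by lia.
rewrite (Cpow_S q (2 * m + 2)).
replace (q ^ (2 * m + 2)) with (q * q ^ (2 * m + 1))
  by (rewrite <- Cpow_S; f_equal; lia).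
assert (T1 := one_minus_qpow_neq0 (2 * m + 2)).
assert (T2 := one_minus_qpow_neq0 (S (2 * m + 2))).
assert (T3 := qpoch_qq_neq0 (2 * m + 2)).
assert (T4 := qpoch_qa2_neq0 (S m)).
assert (T5 : 1 - q * alpha * (q * q ^ (2 * m + 1)) <> 0).
{ apply one_minus_neq0; rewrite <- Cpow_S.
  eapply Rle_lt_trans; [apply Cmod_mul_qpow_le, Hq|exact Halpha]. }
assert (T6 := qpow_neq0 (2 * m + 1)).
rewrite (Cpow_S q (2 * m + 2)) in T2.
replace (q ^ (2 * m + 2)) with (q * q ^ (2 * m + 1)) in *
  by (rewrite <- Cpow_S; f_equal; lia).
revert T1 T2 T3 T4 T5.
generalize (q ^ (2 * m + 1)) (q ^ (3 * S m ^ 2 - S m)) ((- alpha) ^ S m)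
  (qpoch q q (2 * m + 2)) (qpoch (q * alpha) (q ^ 2)%R (S m))
  (qpoch q (q ^ 2)%R (S m)) (qpoch (q * alpha) q (2 * m + 1)).
intros X Y Z A1 A2 A3 A4 T1 T2 T3 T4 T5.
field; repeat split; assumption.
Qed.

(** The summand of the Bailey relation divided by the claimed value, so that its sum over [m] should
    be 1. Its WZ mate [g] satisfies [b (n+1) m - b n m = g n m - g n (m-1)]. *)
Let b (n m : nat) : C :=
  bailey_coef m * inv_qfact n (2 * m) / qpoch (q * alpha) q (n + 2 * m)
  * (qpoch q q n * qpoch (q * alpha) (q ^ 2)%R n).

Let g (n m : nat) : C :=
  - (q * q ^ n) / q ^ (2 * m + 2) * (1 - q ^ (2 * m + 2)) * bailey_coef' m
  * (qpoch q q n * qpoch (q * alpha) (q ^ 2)%R n)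
  * inv_qfact (S n) (2 * m + 2) / qpoch (q * alpha) q (n + 2 * m + 1).

Lemma one_minus_qa_neq0 (k : nat) : 1 - q * alpha * q ^ k <> 0.
Proof.
apply one_minus_neq0; eapply Rle_lt_trans; [apply Cmod_mul_qpow_le, Hq|exact Halpha].
Qed.

(** The boundary of the WZ relation, with [g n (-1)] read as 0. *)
Lemma bailey_wz_0 (n : nat) : b (S n) 0 - b n 0 = g n 0.
Proof.
unfold b, g; rewrite bailey_coef_0.
assert (E1 := inv_qfact_Sl n 0); assert (E2 := inv_qfact_Sr (S n) 0).
assert (E3 := inv_qfact_Sr (S n) 1).
assert (E0 := bailey_coef'_0).
change (2 * 0)%nat with 0%nat; change (0 + 2)%nat with 2%nat.
rewrite !Nat.add_0_r, Nat.add_1_r, !qpoch_S, Cpow_q2.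
replace (2 * n)%nat with (n * 2)%nat by lia; rewrite Cpow_mult_r.
rewrite (Cpow_S q n) in E2, E3; change (q ^ 1) with (q * 1) in E3; simpl (q ^ 0) in *.
assert (N1 := qpoch_qq_neq0 n); assert (N2 := one_minus_qpow_neq0 n).
assert (N3 := qpoch_qa_neq0 n); assert (N4 := one_minus_qa_neq0 n).
assert (N5 : 1 - q ^ 2 <> 0) by exact (one_minus_qpow_neq0 1).
assert (Nq := q_neq0 q Hq).
assert (F1 : inv_qfact (S n) 0 = / (qpoch q q n * (1 - q * q ^ n))) by reflexivity.
assert (F0 : inv_qfact n 0 = / qpoch q q n).
{ unfold inv_qfact; simpl; now rewrite Nat.sub_0_r. }
rewrite F1 in E2 |- *; rewrite F0.
assert (F2 : inv_qfact (S n) 1 = / qpoch q q n).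
{ rewrite <- (Cmult_1_l (inv_qfact _ _)), E2; field; now split. }
rewrite F2 in E3.
assert (F3 : inv_qfact (S n) 2 = (1 - q ^ n) / qpoch q q n).
{ transitivity (/ q * (q * 1 * inv_qfact (S n) 2)); [field; exact Nq|].
  rewrite E3; idtac. field; now split. }
assert (F4 : bailey_coef' 0 = - alpha * q ^ 2 / (1 - q ^ 2)).
{ rewrite <- E0; field; exact N5. }
rewrite F3, F4.
revert N1 N2 N3 N4.
generalize (qpoch q q n) (qpoch (q * alpha) q n) (q ^ n)
  (qpoch (q * alpha) (q ^ 2)%R n).
intros Y Z X W; intros.
field; repeat split; assumption.
Qed.

Lemma bailey_wz_S (n m : nat) : b (S n) (S m) - b n (S m) = g n (S m) - g n m.
Proof.
unfold b, g; rewrite bailey_coef_S.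
assert (E1 := inv_qfact_Sl n (2 * m + 2)).
assert (E2 := inv_qfact_Sr (S n) (2 * m + 2)).
assert (E3 := inv_qfact_Sr (S n) (S (2 * m + 2))).
assert (E0 := bailey_coef'_S m).
replace (2 * S m)%nat with (2 * m + 2)%nat by lia.
replace (2 * m + 2 + 2)%nat with (S (S (2 * m + 2))) by lia.
replace (S n + (2 * m + 2))%nat with (S (S (n + 2 * m + 1))) by lia.
replace (n + (2 * m + 2) + 1)%nat with (S (S (n + 2 * m + 1))) by lia.
replace (n + (2 * m + 2))%nat with (S (n + 2 * m + 1)) by lia.
rewrite (qpoch_S _ _ (S (n + 2 * m + 1))), (qpoch_S _ _ (n + 2 * m + 1)).
rewrite (qpoch_S _ _ n), (qpoch_S (q * alpha) (q ^ 2)%R n), Cpow_q2.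
replace (2 * n)%nat with (n * 2)%nat by lia; rewrite Cpow_mult_r.
rewrite !(Cpow_S q (S (2 * m + 2))), !(Cpow_S q (2 * m + 2)), (Cpow_S q n) in *.
assert (N3 := qpoch_qa_neq0 (n + 2 * m + 1)).
assert (N4 := one_minus_qa_neq0 (n + 2 * m + 1)).
assert (N5 := one_minus_qa_neq0 (S (n + 2 * m + 1))).
assert (N6 : 1 - q ^ 2 * q ^ (2 * m + 2) <> 0).
{ assert (T := one_minus_qpow_neq0 (S (2 * m + 2))); rewrite Cpow_S in T.
  now replace (q ^ 2 * q ^ (2 * m + 2)) with (q * (q * q ^ (2 * m + 2))) by ring. }
assert (Nq := q_neq0 q Hq); assert (Np := qpow_neq0 (2 * m + 2)).
rewrite (Cpow_S q (n + 2 * m + 1)) in N5 |- *.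
(* Leaves [q^n] and [q^(2m+2)] as the only powers with variable exponent, so that they can be
   treated as independent variables. *)
replace (q ^ (n + 2 * m + 1)) with (q ^ n * q ^ (2 * m + 2) / q) in *
  by (rewrite <- Cpow_add_r; replace (n + (2 * m + 2))%nat with (S (n + 2 * m + 1)) by lia;
      rewrite Cpow_S; field; exact Nq).
assert (F1 : inv_qfact n (2 * m + 2)
  = (q ^ (2 * m + 2) - q * q ^ n) / q ^ (2 * m + 2) * inv_qfact (S n) (2 * m + 2)).
{ transitivity (/ q ^ (2 * m + 2) * (q ^ (2 * m + 2) * inv_qfact n (2 * m + 2)));
    [field; exact Np|rewrite <- E1; field; exact Np]. }
assert (F2 : inv_qfact (S n) (S (2 * m + 2))
  = (q ^ (2 * m + 2) - q * q ^ n) / q ^ (2 * m + 2) * inv_qfact (S n) (2 * m + 2)).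
{ transitivity (/ q ^ (2 * m + 2) * (q ^ (2 * m + 2) * inv_qfact (S n) (S (2 * m + 2))));
    [field; exact Np|rewrite E2; field; exact Np]. }
assert (F3 : inv_qfact (S n) (S (S (2 * m + 2)))
  = (q * q ^ (2 * m + 2) - q * q ^ n) / (q * q ^ (2 * m + 2))
    * inv_qfact (S n) (S (2 * m + 2))).
{ transitivity (/ (q * q ^ (2 * m + 2))
     * (q * q ^ (2 * m + 2) * inv_qfact (S n) (S (S (2 * m + 2)))));
    [field; now split|rewrite E3; field; now split]. }
assert (F0 : bailey_coef' (S m) = (1 - alpha * q ^ (2 * m + 2)) * (- alpha) * q ^ 2
   * (q ^ (2 * m + 2)) ^ 3 * bailey_coef' m / (1 - q ^ 2 * q ^ (2 * m + 2))).
{ rewrite <- E0; field; exact N6. }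
rewrite F3, F2, F1, F0.
clear E0 E1 E2 E3 F0 F1 F2 F3.
revert N3 N4 N5 N6 Np.
generalize (q ^ (2 * m + 2)) (q ^ n) (qpoch q q n) (qpoch (q * alpha) (q ^ 2)%R n)
  (qpoch (q * alpha) q (n + 2 * m + 1)) (inv_qfact (S n) (2 * m + 2)) (bailey_coef' m).
intros Pm X Y W Z J E N3 N4 N5 N6 Np.
(* Without the quotients by [q], the nonvanishing hypotheses take the form of the side conditions of
   [field]. *)
replace (q * alpha * (X * Pm / q)) with (alpha * X * Pm) in * by (field; exact Nq).
replace (q * alpha * (q * (X * Pm / q))) with (q * alpha * X * Pm) in *
  by (field; exact Nq).
replace (q ^ 2 * Pm) with (q * q * Pm) in * by ring.
field; repeat split; assumption.
Qed.

(** The condition says that every [m] with [2m <= n] is included. Passing from [n] to [n + 1]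
    changes the sum by [g n M], which vanishes as soon as [n + 1 < 2M + 2]. *)
Lemma bailey_sum (n M : nat) : (n < 2 * M + 2)%nat -> sum_n (b n) M = 1 :> C.
Proof.
revert M; induction n as [|n IH]; intros M H.
- clear H; induction M as [|M IH].
  + rewrite sum_O; unfold b; rewrite bailey_coef_0; simpl.
    unfold inv_qfact; simpl; field.
  + rewrite sum_n_CS, IH; unfold b, inv_qfact.
    replace (2 * S M <=? 0)%nat with false by (symmetry; apply Nat.leb_gt; lia).
    unfold Cdiv; ring.
- assert (Hg : forall N, sum_n (b (S n)) N = sum_n (b n) N + g n N :> C).
  { induction N as [|N IHN].
    - rewrite !sum_O, <- bailey_wz_0; ring.
    - rewrite !sum_n_CS, IHN.
      transitivity (sum_n (b n) N + g n N + b n (S N) + (b (S n) (S N) - b n (S N)));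
        [ring|rewrite bailey_wz_S; ring]. }
  rewrite Hg, IH by lia.
  unfold g, inv_qfact.
  replace (2 * M + 2 <=? S n)%nat with false by (symmetry; apply Nat.leb_gt; lia).
  unfold Cdiv; ring.
Qed.

Theorem bailey_pair (n M : nat) : (n <= M)%nat ->
  sum_n (fun m => bailey_coef m
    * (inv_qfact n (2 * m) / qpoch (q * alpha) q (n + 2 * m))) M
  = / (qpoch q q n * qpoch (q * alpha) (q ^ 2)%R n) :> C.
Proof.
intros HnM; assert (H := bailey_sum n M ltac:(lia)).
assert (N1 := qpoch_qq_neq0 n); assert (N2 := qpoch_qa2_neq0 n).
set (K := qpoch q q n * qpoch (q * alpha) (q ^ 2)%R n) in *.
assert (HK : K <> 0) by now apply Cmult_neq_0.
rewrite <- (Cmult_1_r (/ K)), <- H, <- sum_n_Cmult_l.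
apply sum_n_ext; intros m; unfold b; fold K.
assert (N3 := qpoch_qa_neq0 (n + 2 * m)).
match goal with |- ?l = ?r => change (l = r :> C) end.
field; now split.
Qed.

End BaileyPair.

(** * Expansion of the integrand *)

Lemma Ccv_from (u : nat -> C) (l : C) (n0 : nat) :
  Ccv (fun n => u (n0 + n)%nat) l -> Ccv u l.
Proof.
rewrite !Ccv_eps; intros H eps He; destruct (H eps He) as [N HN].
exists (n0 + N)%nat; intros n Hn.
replace n with (n0 + (n - n0))%nat by lia; apply HN; lia.
Qed.

Lemma sum_n_skip (u : nat -> C) (n0 n : nat) :
  (forall k, (k < n0)%nat -> u k = 0) ->
  sum_n u (n0 + n) = sum_n (fun k => u (n0 + k)%nat) n :> C.
Proof.
intros H; induction n as [|n IH].
- rewrite sum_O, Nat.add_0_r.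
  destruct n0 as [|n0]; [apply sum_O|].
  rewrite sum_n_CS.
  replace (sum_n u n0) with (RtoC 0); [ring|].
  assert (Hz : forall j, (j <= n0)%nat -> sum_n u j = 0 :> C).
  { induction j as [|j IHj]; intros Hj.
    - rewrite sum_O; apply H; lia.
    - rewrite sum_n_CS, IHj, H by lia; ring. }
  now rewrite Hz.
- rewrite Nat.add_succ_r, !sum_n_CS, IH, Nat.add_succ_r; reflexivity.
Qed.

Lemma sum_n_Cplus (u v : nat -> C) (n : nat) :
  sum_n (fun k => u k + v k) n = sum_n u n + sum_n v n :> C.
Proof.
induction n as [|n IH]; [now rewrite !sum_O|].
rewrite !sum_n_CS, IH; ring.
Qed.

Lemma sum_n_exchange (u : nat -> nat -> C) (n m : nat) :
  sum_n (fun k => sum_n (u k) m) n = sum_n (fun j => sum_n (fun k => u k j) n) m :> C.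
Proof.
induction n as [|n IH].
- rewrite sum_O; apply sum_n_ext; intros j; now rewrite sum_O.
- rewrite sum_n_CS, IH, <- sum_n_Cplus.
  apply sum_n_ext; intros j; now rewrite sum_n_CS.
Qed.

Lemma is_CInt_sum_n (f : nat -> R -> C) (a b : R) (l : nat -> C) (n : nat) :
  (forall m, is_CInt (f m) a b (l m)) ->
  is_CInt (fun t => sum_n (fun m => f m t) n) a b (sum_n l n).
Proof.
intros H; induction n as [|n IH].
- rewrite sum_O; eapply is_CInt_ext; [|apply (H 0%nat)].
  intros t; now rewrite sum_O.
- rewrite sum_n_CS; eapply is_CInt_ext; [|apply (is_CInt_plus _ _ _ _ _ _ IH (H (S n)))].
  intros t; now rewrite sum_n_CS.
Qed.

(** * The 3phi2 as a series of q-Gauss sums, and the weights that result *)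

Section Transformation.

Variable q : R.
Hypothesis Hq : (0 < q < 1)%R.

Local Notation P x := (qpoch_inf x q).

Section Expansion.

Variables alpha w : C.
Hypothesis Halpha : (Cmod (q * alpha) < 1)%R.
Hypothesis Hw : (Cmod w < 1)%R.

(** Since [|alpha|] may exceed 1, one [q^m] taken from [q^(3m^2-m)] turns [alpha^m] into
    [(q alpha)^m]; another gives the decay, and [q^(3m^2-3m)] is left over. *)
Lemma bailey_coef_bound : exists K : R, (0 < K)%R /\
  forall m, (Cmod (bailey_coef q alpha m) <= K * q ^ m)%R.
Proof.
assert (Hq2 := q2_bounds q Hq).
destruct (qpoch_lower q Hq q ltac:(lra)) as [m1 [Hm1 L1]].
destruct (qpoch_lower (q ^ 2) Hq2 (Cmod (q * alpha))) as [m2 [Hm2 L2]];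
  [split; [apply Cmod_ge_0|exact Halpha]|].
assert (HB1 := qbound_pos q 1); assert (HB2 := qbound_pos (q ^ 2) 1).
exists ((1 + 2 * qbound q 1) * qbound (q ^ 2) 1 / (m1 * m2))%R; split.
- apply Rdiv_lt_0_compat; apply Rmult_lt_0_compat; lra.
- intros m.
  assert (Hqm : (Cmod q <= q)%R) by (rewrite Cmod_R, Rabs_pos_eq; lra).
  assert (Hwp : (Cmod (wp_factor alpha q m) <= 1 + 2 * qbound q 1)%R).
  { rewrite wp_factorE; destruct m as [|m]; [rewrite Cmod_1; lra|].
    rewrite Cmod_mult.
    apply Rle_trans with (2 * qbound q 1)%R; [|lra].
    apply Rmult_le_compat; try apply Cmod_ge_0.
    - eapply Rle_trans; [apply Cmod_sub_le|]; rewrite Cmod_1.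
      replace (4 * S m)%nat with (S (4 * m + 3)) by lia; rewrite Cpow_S.
      replace (alpha * (q * q ^ (4 * m + 3))) with (q * alpha * q ^ (4 * m + 3)) by ring.
      assert (T := Cmod_mul_qpow_le q Hq (q * alpha) (4 * m + 3)); lra.
    - eapply Rle_trans; [apply (qpoch_bound q Hq)|apply qbound_incr; [exact Hq|lra]]. }
  assert (Hnum : (Cmod (qpoch q (q ^ 2)%R m) <= qbound (q ^ 2) 1)%R).
  { eapply Rle_trans; [apply (qpoch_bound (q ^ 2) Hq2)|apply qbound_incr; [exact Hq2|lra]]. }
  specialize (L1 q (2 * m)%nat Hqm); specialize (L2 (q * alpha) m (Rle_refl _)).
  assert (Hpow : (Cmod ((- alpha) ^ m * q ^ (3 * m ^ 2 - m)) <= q ^ m)%R).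
  { replace ((- alpha) ^ m * q ^ (3 * m ^ 2 - m))
      with ((- (q * alpha)) ^ m * (q ^ m * q ^ (3 * m ^ 2 - 3 * m))).
    - rewrite !Cmod_mult, Cmod_pow, Cmod_opp, !(Cmod_qpow q Hq).
      assert (T1 := qpow_bounds q Hq m).
      assert (T2 := qpow_bounds q Hq (3 * m ^ 2 - 3 * m)).
      assert (T3 : (0 <= Cmod (q * alpha) ^ m <= 1)%R).
      { split; [apply pow_le, Cmod_ge_0|].
        rewrite <- (pow1 m); apply pow_incr; split; [apply Cmod_ge_0|lra]. }
      apply Rle_trans with (1 * (q ^ m * 1))%R; [|lra].
      apply Rmult_le_compat; [lra|apply Rmult_le_pos; lra|lra|].
      apply Rmult_le_compat_l; lra.
    - replace (- (q * alpha)) with (- alpha * q) by ring.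
      rewrite Cpow_mult_l, <- !Cmult_assoc; f_equal.
      rewrite <- !Cpow_add_r; f_equal.
      destruct m as [|m]; [reflexivity|simpl; nia]. }
  unfold bailey_coef; rewrite <- Cmult_assoc, Cmod_mult.
  apply Rmult_le_compat; try apply Cmod_ge_0; [|exact Hpow].
  assert (N1 := qpoch_qq_neq0 q Hq (2 * m)).
  assert (N2 := qpoch_qa2_neq0 q Hq alpha Halpha m).
  rewrite Cmod_div, !Cmod_mult by now apply Cmult_neq_0.
  apply Rmult_le_compat.
  + apply Rmult_le_pos; apply Cmod_ge_0.
  + apply Rlt_le, Rinv_0_lt_compat, Rmult_lt_0_compat; lra.
  + apply Rmult_le_compat; auto; apply Cmod_ge_0.
  + apply Rinv_le_contravar; [now apply Rmult_lt_0_compat|].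
    apply Rmult_le_compat; lra.
Qed.

Section Arguments.

Variables x y : C.
Hypothesis Hx : (Cmod x <= 1)%R.
Hypothesis Hy : (Cmod y <= 1)%R.
Hypothesis Hxyw : x * y * w = q * alpha.

(** The summands of a conjugate Bailey pair at index [2m], built on [delta_k = (x, y; q)_k w^k]. *)
Definition conj_bailey (m k : nat) : C :=
  qpoch x q k * qpoch y q k * w ^ k
  * (inv_qfact q k (2 * m) / qpoch (q * alpha) q (k + 2 * m)).

(* The sum of [conj_bailey m k] over [k], a q-Gauss sum. *)
Definition conj_bailey_sum (m : nat) : C :=
  qpoch x q (2 * m) * qpoch y q (2 * m) * w ^ (2 * m)
  * (P (x * q ^ (2 * m) * w) * P (y * q ^ (2 * m) * w)) / (P (q * alpha) * P w).

(** Terms with [k < 2m] vanish. Putting [k = 2m + j] leaves a q-Gauss sum in [x q^(2m)] and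
    [y q^(2m)] with the same [w], whose denominator parameter is [x y w q^(4m) = q alpha q^(4m)]. *)
Lemma conj_bailey_cv (m : nat) : Ccv (sum_n (conj_bailey m)) (conj_bailey_sum m).
Proof.
set (Q := q ^ (2 * m)).
assert (HQ : forall v, (Cmod v <= 1)%R -> (Cmod (v * Q) <= 1)%R)
  by (intros v Hv; eapply Rle_trans; [apply Cmod_mul_qpow_le, Hq|exact Hv]).
assert (H := q_gauss q Hq (x * Q) (y * Q) (HQ _ Hx) (HQ _ Hy) w Hw).
assert (Eqa : x * Q * (y * Q) * w = q * alpha * q ^ (2 * m + 2 * m)).
{ rewrite Cpow_add_r; fold Q.
  transitivity (x * y * w * (Q * Q)); [ring|rewrite Hxyw; ring]. }
set (c := qpoch x q (2 * m) * qpoch y q (2 * m) * w ^ (2 * m)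
  / qpoch (q * alpha) q (2 * m + 2 * m)).
apply Ccv_from with (2 * m)%nat.
apply Ccv_ext with (fun n => c * sum_n (gauss_term q (x * Q) (y * Q) w) n).
- intros n; rewrite sum_n_skip.
  + rewrite <- sum_n_Cmult_l; apply sum_n_ext; intros k.
    unfold c, conj_bailey, gauss_term, inv_qfact.
    rewrite Eqa, (qpoch_add x), (qpoch_add y); fold Q.
    replace (2 * m <=? 2 * m + k)%nat with true by (symmetry; apply Nat.leb_le; lia).
    replace (2 * m + k - 2 * m)%nat with k by lia.
    replace (2 * m + k + 2 * m)%nat with (2 * m + 2 * m + k)%nat by lia.
    rewrite (qpoch_add (q * alpha) q (2 * m + 2 * m) k), (Cpow_add_r w).
    assert (N1 := qpoch_qq_neq0 q Hq k).
    assert (N2 := qpoch_qa_neq0 q Hq alpha Halpha (2 * m + 2 * m)).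
    assert (N3 : qpoch (q * alpha * q ^ (2 * m + 2 * m)) q k <> 0).
    { apply qpoch_neq0; [exact Hq|].
      eapply Rle_lt_trans; [apply Cmod_mul_qpow_le, Hq|exact Halpha]. }
    match goal with |- ?l = ?r => change (l = r :> C) end.
    field; repeat split; assumption.
  + intros k Hk; unfold conj_bailey, inv_qfact.
    replace (2 * m <=? k)%nat with false by (symmetry; apply Nat.leb_gt; lia).
    unfold Cdiv; ring.
- replace (conj_bailey_sum m)
    with (c * (P (x * Q * w) * P (y * Q * w) / (P (x * Q * (y * Q) * w) * P w)));
    [now apply Ccv_scal|].
  unfold c, conj_bailey_sum; fold Q; rewrite Eqa.
  rewrite (qpoch_inf_split q Hq (q * alpha) (2 * m + 2 * m)).
  assert (N1 := qpoch_qa_neq0 q Hq alpha Halpha (2 * m + 2 * m)).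
  assert (N2 := qpoch_inf_neq0 q Hq w Hw).
  assert (N3 : P (q * alpha * q ^ (2 * m + 2 * m)) <> 0).
  { apply qpoch_inf_neq0; [exact Hq|].
    eapply Rle_lt_trans; [apply Cmod_mul_qpow_le, Hq|exact Halpha]. }
  field; repeat split; assumption.
Qed.

End Arguments.

(** Uniform in [n] and [m], to provide the domination for [tannery], and in [x] and [y], so that the
    estimates hold uniformly over the circle. *)
Lemma conj_bailey_bound : exists K : R, (0 < K)%R /\
  forall x y m n, (Cmod x <= 1)%R -> (Cmod y <= 1)%R ->
    (Cmod (sum_n (conj_bailey x y m) n) <= K)%R.
Proof.
destruct (qpoch_lower q Hq q ltac:(lra)) as [m1 [Hm1 L1]].
destruct (qpoch_lower q Hq (Cmod (q * alpha))) as [m2 [Hm2 L2]];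
  [split; [apply Cmod_ge_0|exact Halpha]|].
assert (HB := qbound_pos q 1).
set (K := (qbound q 1 * qbound q 1 * (/ m1 * / m2))%R).
assert (Hi1 : (0 < / m1)%R) by now apply Rinv_0_lt_compat.
assert (Hi2 : (0 < / m2)%R) by now apply Rinv_0_lt_compat.
assert (HK : (0 < K)%R) by (unfold K; repeat apply Rmult_lt_0_compat; assumption).
assert (Hex : ex_series (fun k => K * Cmod w ^ k)%R).
{ apply (ex_series_scal_l K (fun n => Cmod w ^ n)%R), ex_series_geom.
  rewrite Rabs_pos_eq; [exact Hw|apply Cmod_ge_0]. }
assert (Hpos : forall k, (0 <= K * Cmod w ^ k)%R).
{ intros k; apply Rmult_le_pos; [lra|apply pow_le, Cmod_ge_0]. }
exists (Series (fun k => K * Cmod w ^ k)%R + 1)%R; split.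
- assert (T := sum_n_le_Series _ 0 Hpos Hex); rewrite sum_O in T.
  specialize (Hpos 0%nat); lra.
- intros x y m n Hx Hy.
  apply Rle_trans with (sum_n (fun k => K * Cmod w ^ k)%R n).
  + apply Cmod_sum_n; intros k; unfold conj_bailey.
    assert (Hb : forall v, (Cmod v <= 1)%R -> (Cmod (qpoch v q k) <= qbound q 1)%R).
    { intros v Hv; eapply Rle_trans; [apply (qpoch_bound q Hq)|now apply qbound_incr]. }
    assert (N2 := qpoch_qa_neq0 q Hq alpha Halpha (k + 2 * m)).
    rewrite !Cmod_mult, Cmod_div, Cmod_pow by exact N2.
    replace (K * Cmod w ^ k)%R
      with (qbound q 1 * qbound q 1 * Cmod w ^ k * (/ m1 * / m2))%R
      by (unfold K; ring).
    assert (Hp : (0 <= Cmod w ^ k)%R) by apply pow_le, Cmod_ge_0.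
    apply Rmult_le_compat.
    * repeat apply Rmult_le_pos; try apply Cmod_ge_0; exact Hp.
    * apply Rmult_le_pos; [apply Cmod_ge_0|].
      apply Rlt_le, Rinv_0_lt_compat, Cmod_gt_0, N2.
    * apply Rmult_le_compat_r; [exact Hp|].
      apply Rmult_le_compat; auto; apply Cmod_ge_0.
    * apply Rmult_le_compat.
      -- apply Cmod_ge_0.
      -- apply Rlt_le, Rinv_0_lt_compat, Cmod_gt_0, N2.
      -- unfold inv_qfact; destruct (Nat.leb_spec (2 * m) k).
         ++ rewrite Cmod_inv by (apply qpoch_qq_neq0, Hq).
            apply Rinv_le_contravar; [exact Hm1|].
            apply L1; rewrite Cmod_R, Rabs_pos_eq; lra.
         ++ rewrite Cmod_0; lra.
      -- apply Rinv_le_contravar; [exact Hm2|apply L2, Rle_refl].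
  + assert (T := sum_n_le_Series _ n Hpos Hex); lra.
Qed.

(** Bailey's lemma: insert the pair for [beta_k] and sum over [k] first. [K] precedes [x] and [y]
    because the series is later integrated term by term in [theta]. *)
Lemma bailey_expansion : exists K : R, (0 < K)%R /\
  forall x y, (Cmod x <= 1)%R -> (Cmod y <= 1)%R -> x * y * w = q * alpha ->
  (forall m, (Cmod (bailey_coef q alpha m * conj_bailey_sum x y m) <= K * q ^ m)%R)
  /\ exists S,
    Ccv (sum_n (fun k => qpoch x q k * qpoch y q k * w ^ k
      * / (qpoch q q k * qpoch (q * alpha) (q ^ 2)%R k))) S
    /\ Ccv (sum_n (fun m => bailey_coef q alpha m * conj_bailey_sum x y m)) S.
Proof.
destruct bailey_coef_bound as [K1 [HK1 B1]].
destruct conj_bailey_bound as [K2 [HK2 B2]].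
exists (K1 * K2)%R; split; [now apply Rmult_lt_0_compat|].
intros x y Hx Hy Hxyw.
set (u := fun m n => bailey_coef q alpha m * sum_n (conj_bailey x y m) n).
assert (Hu : forall m, Ccv (u m) (bailey_coef q alpha m * conj_bailey_sum x y m)).
{ intros m; apply Ccv_scal; now apply conj_bailey_cv. }
assert (Hb : forall m n, (Cmod (u m n) <= K1 * K2 * q ^ m)%R).
{ intros m n; unfold u; rewrite Cmod_mult.
  replace (K1 * K2 * q ^ m)%R with (K1 * q ^ m * K2)%R by ring.
  apply Rmult_le_compat; try apply Cmod_ge_0; auto. }
assert (Hex : ex_series (fun m => K1 * K2 * q ^ m)%R).
{ apply (ex_series_scal_l (K1 * K2)%R (fun n => q ^ n)%R), ex_series_geom.
  rewrite Rabs_pos_eq; lra. }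
split.
- intros m.
  replace (bailey_coef q alpha m * conj_bailey_sum x y m)
    with (bailey_coef q alpha m * conj_bailey_sum x y m - 0) by ring.
  apply (Ccv_le (u m) _ _ _ 0); [|apply Hu].
  intros n _; replace (u m n - 0) with (u m n) by ring; apply Hb.
- destruct (tannery u _ _ Hu Hb Hex) as [S [HS1 HS2]].
  exists S; split; [|exact HS1].
  eapply Ccv_ext; [|exact HS2].
  intros N; cbv beta; unfold u.
  transitivity (sum_n (fun m => sum_n (fun k => bailey_coef q alpha m
    * conj_bailey x y m k) N) N).
  { apply sum_n_ext; intros m; now rewrite sum_n_Cmult_l. }
  rewrite <- (sum_n_exchange (fun k m => bailey_coef q alpha m * conj_bailey x y m k)).
  (* Both sums stop at [N], so [k <= N] and the truncated sum over [m] is already the full Bailey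
     relation. *)
  apply sum_n_ext_loc; intros k Hk.
  rewrite <- (bailey_pair q Hq alpha Halpha k N Hk), <- sum_n_Cmult_l.
  apply sum_n_ext; intros m; unfold conj_bailey.
  match goal with |- ?l = ?r => change (l = r :> C) end.
  ring.
Qed.

End Expansion.

Definition circle_bounded (f : C -> C) : Prop :=
  exists B : R, (0 < B)%R /\ forall z, Cmod z = 1%R -> (Cmod (f z) <= B)%R.

Lemma circle_bounded_mult (f g : C -> C) :
  circle_bounded f -> circle_bounded g -> circle_bounded (fun z => f z * g z).
Proof.
intros [B [HB Hf]] [D [HD Hg]]; exists (B * D)%R; split; [now apply Rmult_lt_0_compat|].
intros z Hz; rewrite Cmod_mult; apply Rmult_le_compat; auto; apply Cmod_ge_0.
Qed.

Lemma circle_bounded_qpoch_inf (u : C -> C) :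
  (forall z, Cmod z = 1%R -> (Cmod (u z) <= 1)%R) -> circle_bounded (fun z => P (u z)).
Proof.
intros H; exists (qbound q 1); split; [apply qbound_pos|]; intros z Hz.
eapply Rle_trans; [apply (qpoch_inf_bound q Hq)|apply qbound_incr; auto].
Qed.

Lemma circle_bounded_inv_qpoch_inf (u : C -> C) (t : C) : (Cmod t < 1)%R ->
  (forall z, Cmod z = 1%R -> Cmod (u z) = Cmod t) -> circle_bounded (fun z => / P (u z)).
Proof.
intros Ht H.
destruct (qpoch_inf_lower q Hq (Cmod t)) as [m [Hm L]]; [split; [apply Cmod_ge_0|exact Ht]|].
exists (/ m)%R; split; [now apply Rinv_0_lt_compat|]; intros z Hz.
assert (T : (m <= Cmod (P (u z)))%R) by (apply L; rewrite H; [lra|exact Hz]).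
rewrite Cmod_inv by (apply Cmod_gt_0; lra).
now apply Rinv_le_contravar.
Qed.

(** The integrand without its 3phi2, at [z = e^(i theta)]. *)
Definition base_weight (a b c d r z : C) : C :=
  P (z ^ 2) * P ((/ z) ^ 2)
  * (/ P (a * z) * / P (b * z) * / P (c * z) * / P (d * z) * / P (r * z))
  * (/ P (a * / z) * / P (b * / z) * / P (c * / z) * / P (d * / z) * / P (r * / z)).

Lemma base_weight_bounded (a b c d r : C) :
  (Cmod a < 1)%R -> (Cmod b < 1)%R -> (Cmod c < 1)%R -> (Cmod d < 1)%R ->
  (Cmod r < 1)%R -> circle_bounded (base_weight a b c d r).
Proof.
intros Ha Hb Hc Hd Hr.
assert (H1 : forall t, (Cmod t < 1)%R -> circle_bounded (fun z => / P (t * z))).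
{ intros t Ht; apply circle_bounded_inv_qpoch_inf with t; [exact Ht|].
  intros z Hz; now apply Cmod_mult_unit. }
assert (H2 : forall t, (Cmod t < 1)%R -> circle_bounded (fun z => / P (t * / z))).
{ intros t Ht; apply circle_bounded_inv_qpoch_inf with t; [exact Ht|].
  intros z Hz; now apply Cmod_mult_unit, Cmod_inv_unit. }
assert (H3 : circle_bounded (fun z => P (z ^ 2))).
{ apply circle_bounded_qpoch_inf; intros z Hz; rewrite Cmod_pow, Hz; lra. }
assert (H4 : circle_bounded (fun z => P ((/ z) ^ 2))).
{ apply circle_bounded_qpoch_inf; intros z Hz.
  rewrite Cmod_pow, (Cmod_inv_unit z Hz); lra. }
assert (Hm := circle_bounded_mult).
unfold base_weight.
exact (Hm _ _ (Hm _ _ (Hm _ _ H3 H4)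
  (Hm _ _ (Hm _ _ (Hm _ _ (Hm _ _ (H1 a Ha) (H1 b Hb)) (H1 c Hc)) (H1 d Hd)) (H1 r Hr)))
  (Hm _ _ (Hm _ _ (Hm _ _ (Hm _ _ (H2 a Ha) (H2 b Hb)) (H2 c Hc)) (H2 d Hd)) (H2 r Hr))).
Qed.

(** The factorials [(a z, a/z; q)_(2m)] shift [a] to [a q^(2m)] in the denominator, and the q-Gauss
    numerators supply the products with [f = a q^(2m) b c d r]. *)
Lemma base_weight_conj_bailey (a b c d r alpha z : C) (m : nat) :
  (Cmod a < 1)%R -> Cmod z = 1%R ->
  let w := b * c * d * r in
  base_weight a b c d r z * conj_bailey_sum alpha w (a * z) (a * / z) m
  = w ^ (2 * m) / (P (q * alpha) * P w)
    * rahman_weight q (a * q ^ (2 * m)) b c d r z.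
Proof.
intros Ha Hz w.
assert (E : forall u, (Cmod u < 1)%R ->
  / P (u * q ^ (2 * m)) = qpoch u q (2 * m) * / P u).
{ intros u Hu; rewrite (qpoch_inf_split q Hq u (2 * m)).
  assert (T1 := qpoch_neq0 q Hq u (2 * m) Hu).
  assert (T2 : P (u * q ^ (2 * m)) <> 0).
  { apply qpoch_inf_neq0; [exact Hq|].
    eapply Rle_lt_trans; [apply Cmod_mul_qpow_le, Hq|exact Hu]. }
  field; now split. }
unfold base_weight, conj_bailey_sum, rahman_weight.
replace (a * q ^ (2 * m) * b * c * d * r * z) with (a * z * q ^ (2 * m) * w)
  by (unfold w; ring).
replace (a * q ^ (2 * m) * b * c * d * r * / z) with (a * / z * q ^ (2 * m) * w)
  by (unfold w; ring).
replace (a * q ^ (2 * m) * z) with (a * z * q ^ (2 * m)) by ring.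
replace (a * q ^ (2 * m) * / z) with (a * / z * q ^ (2 * m)) by ring.
rewrite (E (a * z)), (E (a * / z)).
- unfold Cdiv; ring.
- rewrite Cmod_mult_unit; [exact Ha|now apply Cmod_inv_unit].
- now rewrite Cmod_mult_unit.
Qed.

End Transformation.

(** * Closed form of the integrated terms *)

Section FinalValue.

Variable q : R.
Hypothesis Hq : (0 < q < 1)%R.

Local Notation P x := (qpoch_inf x q).

(** Each [P (u q^(2m))] is [P u / (u; q)_(2m)], which separates the prefactor from the summand.
    [P (b c d r)] cancels, and [P (q alpha)] supplies the factor with [a^2 b c d r]. *)
Lemma rahman_value_scaled (a b c d r alpha : C) (m : nat) :
  (Cmod a < 1)%R -> (Cmod b < 1)%R -> (Cmod c < 1)%R -> (Cmod d < 1)%R ->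
  (Cmod r < 1)%R -> alpha = a ^ 2 * b * c * d * r / q ->
  bailey_coef q alpha m * ((b * c * d * r) ^ (2 * m)
    / (P (q * alpha) * P (b * c * d * r))
    * (RtoC (2 * PI) / P q * rahman_value q (a * q ^ (2 * m)) b c d r))
  = 2 * PI
    * qpochs_inf [a * b * c * d; a * b * c * r; a * b * d * r; a * c * d * r] q
    / qpochs_inf [RtoC q; a * b; a * c; a * d; a * r; b * c; b * d; b * r;
                  c * d; c * r; d * r; a ^ 2 * b * c * d * r] q
    * (wp_factor alpha q m
      * qpochs [a * b; a * c; a * d; a * r] q (2 * m)
      * qpoch q (q ^ 2)%R m
      / (qpochs [RtoC q; a * b * c * d; a * b * c * r; a * b * d * r;
                 a * c * d * r] q (2 * m)
         * qpoch (q * alpha) (q ^ 2)%R m)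
      * (- alpha) ^ m * (b * c * d * r) ^ (2 * m) * q ^ (3 * m ^ 2 - m)).
Proof.
intros Ha Hb Hc Hd Hr Halpha.
assert (Hq0 := q_neq0 q Hq).
assert (Eqa : q * alpha = a ^ 2 * b * c * d * r) by (rewrite Halpha; field; exact Hq0).
assert (Hqa : (Cmod (q * alpha) < 1)%R).
{ rewrite Eqa; replace (a ^ 2) with (a * a) by ring; repeat apply Cmod_mult_lt1; assumption. }
unfold qpochs, qpochs_inf, bailey_coef, rahman_value; cbn [fold_right].
rewrite <- Eqa.
set (Q := q ^ (2 * m)).
assert (E : forall u, (Cmod u < 1)%R ->
  P (u * Q) = P u / qpoch u q (2 * m) /\ / P (u * Q) = qpoch u q (2 * m) / P u
  /\ qpoch u q (2 * m) <> 0 /\ P u <> 0).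
{ intros u Hu.
  assert (T1 := qpoch_neq0 q Hq u (2 * m) Hu).
  assert (T2 : P (u * Q) <> 0).
  { apply qpoch_inf_neq0; [exact Hq|].
    eapply Rle_lt_trans; [apply Cmod_mul_qpow_le, Hq|exact Hu]. }
  assert (T3 := qpoch_inf_neq0 q Hq u Hu).
  assert (S := qpoch_inf_split q Hq u (2 * m)); fold Q in S.
  split; [|split; [|split; assumption]]; rewrite S; field; repeat split; assumption. }
replace (a * Q * c * d * r) with (a * c * d * r * Q) by ring.
replace (a * Q * b * d * r) with (a * b * d * r * Q) by ring.
replace (a * Q * b * c * r) with (a * b * c * r * Q) by ring.
replace (a * Q * b * c * d) with (a * b * c * d * Q) by ring.
replace (a * Q * b) with (a * b * Q) by ring.
replace (a * Q * c) with (a * c * Q) by ring.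
replace (a * Q * d) with (a * d * Q) by ring.
replace (a * Q * r) with (a * r * Q) by ring.
assert (L4 : forall u v w' x, (Cmod u < 1)%R -> (Cmod v < 1)%R -> (Cmod w' < 1)%R ->
  (Cmod x < 1)%R -> (Cmod (u * v * w' * x) < 1)%R)
  by (intros; repeat apply Cmod_mult_lt1; assumption).
assert (L2 := Cmod_mult_lt1).
destruct (E (a * b * c * d) (L4 _ _ _ _ Ha Hb Hc Hd)) as (E1 & _ & N1 & _).
destruct (E (a * b * c * r) (L4 _ _ _ _ Ha Hb Hc Hr)) as (E2 & _ & N2 & _).
destruct (E (a * b * d * r) (L4 _ _ _ _ Ha Hb Hd Hr)) as (E3 & _ & N3 & _).
destruct (E (a * c * d * r) (L4 _ _ _ _ Ha Hc Hd Hr)) as (E4 & _ & N4 & _).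
destruct (E (a * b) (L2 _ _ Ha Hb)) as (_ & E5 & _ & M5).
destruct (E (a * c) (L2 _ _ Ha Hc)) as (_ & E6 & _ & M6).
destruct (E (a * d) (L2 _ _ Ha Hd)) as (_ & E7 & _ & M7).
destruct (E (a * r) (L2 _ _ Ha Hr)) as (_ & E8 & _ & M8).
rewrite E1, E2, E3, E4, E5, E6, E7, E8.
assert (K1 := qpoch_inf_neq0 q Hq _ (L2 _ _ Hb Hc)).
assert (K2 := qpoch_inf_neq0 q Hq _ (L2 _ _ Hb Hd)).
assert (K3 := qpoch_inf_neq0 q Hq _ (L2 _ _ Hb Hr)).
assert (K4 := qpoch_inf_neq0 q Hq _ (L2 _ _ Hc Hd)).
assert (K5 := qpoch_inf_neq0 q Hq _ (L2 _ _ Hc Hr)).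
assert (K6 := qpoch_inf_neq0 q Hq _ (L2 _ _ Hd Hr)).
assert (K7 := qpoch_inf_neq0 q Hq _ (L4 _ _ _ _ Hb Hc Hd Hr)).
assert (K8 := qpoch_inf_neq0 q Hq _ Hqa).
assert (K9 := qpoch_inf_neq0 q Hq _ (Cmod_q_lt1 q Hq)).
assert (J1 := qpoch_qq_neq0 q Hq (2 * m)).
assert (J2 := qpoch_qa2_neq0 q Hq alpha Hqa m).
rewrite RtoC_mult.
clear E E1 E2 E3 E4 E5 E6 E7 E8 L2 L4 Ha Hb Hc Hd Hr Hqa Halpha Hq0.
generalize (wp_factor alpha q m) (qpoch q (q ^ 2)%R m) ((- alpha) ^ m)
  (q ^ (3 * m ^ 2 - m)) ((b * c * d * r) ^ (2 * m)) (RtoC PI)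
  (qpoch (a * b) q (2 * m)) (qpoch (a * c) q (2 * m))
  (qpoch (a * d) q (2 * m)) (qpoch (a * r) q (2 * m)) (P (a * b * c * d))
  (P (a * b * c * r)) (P (a * b * d * r)) (P (a * c * d * r)).
revert N1 N2 N3 N4 M5 M6 M7 M8 K1 K2 K3 K4 K5 K6 K7 K8 K9 J1 J2.
generalize (qpoch (a * b * c * d) q (2 * m)) (qpoch (a * b * c * r) q (2 * m))
  (qpoch (a * b * d * r) q (2 * m)) (qpoch (a * c * d * r) q (2 * m))
  (P (a * b)) (P (a * c)) (P (a * d)) (P (a * r))
  (P (b * c)) (P (b * d)) (P (b * r)) (P (c * d)) (P (c * r)) (P (d * r))
  (P (b * c * d * r)) (P (q * alpha)) (P q)
  (qpoch q q (2 * m)) (qpoch (q * alpha) (q ^ 2)%R m).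
intros; field; repeat split; assumption.
Qed.

End FinalValue.

Theorem theorem6p5 :
  forall (q : R) (a b c d r alpha s : C),
    (0 < q < 1)%R ->
    (Cmod a < 1)%R -> (Cmod b < 1)%R -> (Cmod c < 1)%R ->
    (Cmod d < 1)%R -> (Cmod r < 1)%R ->
    alpha = a ^ 2 * b * c * d * r / q ->
    s ^ 2 = q * alpha ->
    let rhs_term (n : nat) : C :=
      wp_factor alpha q n
      * qpochs [a * b; a * c; a * d; a * r] q (2 * n)
      * qpoch q (q ^ 2)%R n
      / (qpochs [RtoC q; a * b * c * d; a * b * c * r; a * b * d * r;
                 a * c * d * r] q (2 * n)
         * qpoch (q * alpha) (q ^ 2)%R n)
      * (- alpha) ^ n * (b * c * d * r) ^ (2 * n) * q ^ (3 * n ^ 2 - n) in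
    (forall theta : R,
       @ex_series C_AbsRing C_NormedModule
         (phi32_term (a * cis theta) (a * cis (- theta)) 0 s (- s)
            q (b * c * d * r)))
    /\ @ex_series C_AbsRing C_NormedModule rhs_term
    /\ @is_RInt C_R_NormedModule
      (fun theta : R =>
         let e := cis theta in
         let e' := cis (- theta) in
         qpochs_inf [cis (2 * theta); cis (- (2 * theta))] q
         / qpochs_inf [a * e; a * e'; b * e; b * e'; c * e; c * e';
                       d * e; d * e'; r * e; r * e'] q
         * phi32 (a * e) (a * e') 0 s (- s) q (b * c * d * r))
      0%R PI
      (2 * PI
       * qpochs_inf [a * b * c * d; a * b * c * r; a * b * d * r;
                     a * c * d * r] q
       / qpochs_inf [RtoC q; a * b; a * c; a * d; a * r; b * c; b * d; b * r;
                     c * d; c * r; d * r; a ^ 2 * b * c * d * r] q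
       * C_series rhs_term).
Proof.
intros q a b c d r alpha s Hq Ha Hb Hc Hd Hr Halpha Hs rhs_term.
set (w := b * c * d * r).
assert (Hw : (Cmod w < 1)%R) by (unfold w; repeat apply Cmod_mult_lt1; assumption).
assert (Hq0 := q_neq0 q Hq).
assert (Eqa : q * alpha = a ^ 2 * b * c * d * r) by (rewrite Halpha; field; exact Hq0).
assert (Hqa : (Cmod (q * alpha) < 1)%R).
{ rewrite Eqa; replace (a ^ 2) with (a * a) by ring; repeat apply Cmod_mult_lt1; assumption. }
destruct (bailey_expansion q Hq alpha w Hqa Hw) as [K [HK Hexp]].
set (l := fun theta m => bailey_coef q alpha m
  * conj_bailey_sum q alpha w (a * cis theta) (a * / cis theta) m).
assert (Hphi : forall theta,
  (forall m, (Cmod (l theta m) <= K * q ^ m)%R)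
  /\ exists S, Ccv (sum_n (phi32_term (a * cis theta) (a * cis (- theta)) 0 s (- s) q w)) S
    /\ Ccv (sum_n (l theta)) S).
{ intros theta; rewrite cis_opp.
  assert (Hc1 := Cmod_cis theta); assert (Hc2 := Cmod_inv_unit _ Hc1).
  destruct (Hexp (a * cis theta) (a * / cis theta)) as [HB [S [HS1 HS2]]].
  - rewrite Cmod_mult_unit by exact Hc1; lra.
  - rewrite Cmod_mult_unit by exact Hc2; lra.
  - rewrite Eqa; unfold w; field; apply cis_neq0.
  - split; [exact HB|]; exists S; split; [|exact HS2].
    eapply Ccv_ext; [|exact HS1].
    intros n; apply sum_n_ext; intros k.
    unfold phi32_term, qpochs; cbn [fold_right].
    (* The numerator parameter 0 contributes 1, and [(s, -s; q)_k] is the base [q^2] factorial in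
       [beta_k]. *)
    rewrite qpoch_0, <- Hs, <- qpoch_pm.
    unfold Cdiv; match goal with |- ?l = ?r => change (l = r :> C) end.
    rewrite !Cmult_1_r; ring. }
assert (Hphi32 : forall theta, Ccv (sum_n (l theta))
  (phi32 (a * cis theta) (a * cis (- theta)) 0 s (- s) q w)).
{ intros theta; destruct (Hphi theta) as [_ [S [HS1 HS2]]].
  unfold phi32, C_series; now rewrite (Ccv_lim_seq _ _ HS1). }
set (pref := 2 * PI
   * qpochs_inf [a * b * c * d; a * b * c * r; a * b * d * r; a * c * d * r] q
   / qpochs_inf [RtoC q; a * b; a * c; a * d; a * r; b * c; b * d; b * r;
                 c * d; c * r; d * r; a ^ 2 * b * c * d * r] q).
(* Convergence is obtained for [pref * rhs_term]; dividing by [pref] transfers it to [rhs_term]. *)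
assert (Hpref : pref <> 0).
{ assert (Hinv : forall u : C, u <> 0 -> / u <> 0).
  { intros u Hu E; assert (T : u * / u = 1) by now apply Cinv_r.
    rewrite E, Cmult_0_r in T; injection T; lra. }
  assert (Hpi := PI_RGT_0).
  unfold pref, Cdiv, qpochs_inf; cbn [fold_right]; rewrite <- Eqa.
  assert (H1 : RtoC 1 <> 0) by (apply RtoC_neq_0; lra).
  repeat apply Cmult_neq_0; try apply Hinv; repeat apply Cmult_neq_0;
    try exact H1; try (apply RtoC_neq_0; lra);
    apply (qpoch_inf_neq0 q Hq); try exact Hqa; try apply (Cmod_q_lt1 q Hq);
    repeat apply Cmod_mult_lt1; assumption. }
set (rterm := fun m t => bailey_coef q alpha m * (w ^ (2 * m)
   / (qpoch_inf (q * alpha) q * qpoch_inf w q)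
   * rahman_weight q (a * q ^ (2 * m)) b c d r (cis t))).
set (bw := fun t => base_weight q a b c d r (cis t)).
assert (Hbw : forall t m, bw t * l t m = rterm m t).
{ intros t m; unfold bw, l, rterm.
  assert (E := base_weight_conj_bailey q Hq a b c d r alpha (cis t) m Ha (Cmod_cis t)).
  cbv zeta in E; fold w in E; rewrite <- E; ring. }
assert (Hint : forall m, is_CInt (rterm m) 0 PI (pref * rhs_term m)).
{ intros m; unfold pref, rhs_term.
  rewrite <- (rahman_value_scaled q Hq a b c d r alpha m Ha Hb Hc Hd Hr Halpha).
  fold w; unfold rterm; do 2 apply is_CInt_scal.
  apply (rahman_integral q Hq); try assumption.
  eapply Rle_lt_trans; [apply Cmod_mul_qpow_le, Hq|exact Ha]. }
destruct (base_weight_bounded q Hq a b c d r Ha Hb Hc Hd Hr) as [B [HB HBz]].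
assert (Hex : ex_series (fun m => K * q ^ m)%R).
{ apply (ex_series_scal_l K (fun n => q ^ n)%R), ex_series_geom.
  rewrite Rabs_pos_eq; lra. }
assert (Hpos : forall m, (0 <= K * q ^ m)%R).
{ intros m; apply Rmult_le_pos; [lra|apply Rlt_le, (qpow_bounds q Hq)]. }
destruct (is_CInt_ulim (fun n t => sum_n (fun m => rterm m t) n)
  (fun t => bw t * phi32 (a * cis t) (a * cis (- t)) 0 s (- s) q w) 0 PI
  (fun n => sum_n (fun m => pref * rhs_term m) n)) as [I [HI1 HI2]].
- intros n; apply is_CInt_sum_n, Hint.
- intros eps He.
  assert (Ht : forall n, (0 <= Series (fun m => K * q ^ m) - sum_n (fun m => K * q ^ m) n)%R).
  { intros n; assert (T := sum_n_le_Series _ n Hpos Hex); lra. }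
  assert (HeB : (0 < eps / (B + 1))%R) by (apply Rdiv_lt_0_compat; lra).
  destruct (proj1 (lim0_eps _ Ht) (Series_tail_lim0 _ Hex) _ HeB) as [N HN].
  exists N; intros n Hn t; specialize (HN n Hn).
  replace (sum_n (fun m => rterm m t) n) with (bw t * sum_n (l t) n).
  + replace (bw t * sum_n (l t) n - bw t * phi32 _ _ _ _ _ _ _)
      with (- (bw t * (phi32 (a * cis t) (a * cis (- t)) 0 s (- s) q w - sum_n (l t) n)))
      by ring.
    rewrite Cmod_opp, Cmod_mult.
    (* The tail bound is uniform in [t] because [K] was fixed before the point of the circle. *)
    assert (HT : (Cmod (phi32 (a * cis t) (a * cis (- t)) 0 s (- s) q w - sum_n (l t) n)
       <= Series (fun m => K * q ^ m) - sum_n (fun m => K * q ^ m) n)%R).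
    { apply (Ccv_le (sum_n (l t)) _ _ _ n); [|apply Hphi32].
      intros k Hk; apply sum_n_tail_bound; auto; apply Hphi. }
    assert (HBt : (Cmod (bw t) <= B)%R) by (apply HBz, Cmod_cis).
    apply Rle_lt_trans with (B * (eps / (B + 1)))%R.
    * apply Rmult_le_compat; try apply Cmod_ge_0; lra.
    * apply Rlt_le_trans with ((B + 1) * (eps / (B + 1)))%R; [|right; field; lra].
      apply Rmult_lt_compat_r; lra.
  + rewrite <- sum_n_Cmult_l; apply sum_n_ext; intros m; apply Hbw.
(* Summability of the right side comes from the convergence of the integrated partial sums, with no
   estimate of its own. *)
- assert (Hrhs : Ccv (sum_n rhs_term) (/ pref * I)).
  { eapply Ccv_ext; [|apply (Ccv_scal (/ pref)), HI1].
    intros n; cbv beta; rewrite sum_n_Cmult_l.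
    match goal with |- ?l = ?r => change (l = r :> C) end.
    field; exact Hpref. }
  split; [|split].
  + intros theta; destruct (Hphi theta) as [_ [S [HS1 _]]].
    exists S; now apply Ccv_is_series.
  + eexists; apply Ccv_is_series, Hrhs.
  + replace (C_series rhs_term) with (/ pref * I)
      by (symmetry; apply Ccv_lim_seq, Hrhs).
    replace (pref * (/ pref * I)) with I by (field; exact Hpref).
    eapply is_CInt_ext; [|exact HI2].
    intros t; cbv zeta beta; f_equal.
    unfold bw, base_weight, qpochs_inf; cbn [fold_right].
    assert (H2 : cis (2 * t) = cis t ^ 2).
    { rewrite cis_pow; f_equal; simpl; ring. }
    assert (Hn : forall u v, (Cmod u < 1)%R -> Cmod v = 1%R -> qpoch_inf (u * v) q <> 0).
    { intros u v Hu Hv; apply qpoch_inf_neq0; [exact Hq|now rewrite Cmod_mult_unit]. }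
    assert (Hc1 := Cmod_cis t); assert (Hc2 := Cmod_inv_unit _ Hc1).
    rewrite !cis_opp, H2.
    replace (/ cis t ^ 2) with ((/ cis t) ^ 2)
      by (rewrite Cpow_inv; [reflexivity|apply cis_neq0]).
    field; repeat split; apply Hn; assumption.
Qed.
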